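(* Let $T$ be a first order theory with a countable signature $L$, every model of which has at least two elements. Then $T$ is $\omega$-categorical if and only if its randomization theory $T^R$ is $\omega$-categorical.
   Context: Convention: ''countable'' means finite or of cardinality $\omega$. A complete first order theory is $\omega$-categorical if it has a finite model or has a unique model of cardinality $\omega$ up to isomorphism; a complete continuous theory with countable signature is $\omega$-categorical if it has a unique separable model up to isomorphism. $T^R$ is the continuous-logic randomization theory of $T$: two-sorted signature with sort $\mathbf{K}$ (random elements) and $\mathbf{B}$ (events), function symbols $\llbracket\varphi(\cdot)\rrbracket:\mathbf{K}^n\to\mathbf{B}$ for $L$-formulas $\varphi$, probability predicate $\mu$ on $\mathbf B$, Boolean operations on $\mathbf B$, and metrics $d_\mathbf{K},d_\mathbf{B}$; axioms: $\mathbf B$ is a Boolean algebra and $\llbracket\cdot\rrbracket$ commutes with $\neg,\vee,\wedge$ and sends logically valid formulas to $\top$; $d_\mathbf{K}(x,y)=1-\mu\llbracket x=y\rrbracket$, $d_\mathbf{B}(\mathsf U,\mathsf V)=\mu(\mathsf U\triangle\mathsf V)$; $\sup_{\bar y}\inf_x d_\mathbf{B}(\llbracket\varphi(x,\bar y)\rrbracket,\llbracket(\exists x\varphi)(\bar y)\rrbracket)=0$; $\sup_{\mathsf U}\inf_{x,y}d_\mathbf{B}(\mathsf U,\llbracket x=y\rrbracket)=0$; $\mu(\top)=1$, $\mu(\bot)=0$, $\mu(\mathsf U)+\mu(\mathsf V)=\mu(\mathsf U\sqcup\mathsf V)+\mu(\mathsf U\sqcap\mathsf V)$; $\sup_{\mathsf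 U}\inf_{\mathsf V}|\mu(\mathsf U\sqcap\mathsf V)-\mu(\mathsf U)/2|=0$; and $\llbracket\varphi\rrbracket=\top$ for each sentence $\varphi\in T$. *)

(* Defs.v *)
From HB Require Import structures.
From mathcomp Require Import all_boot all_order all_algebra.
From mathcomp Require Import boolp classical_sets functions cardinality reals.
From mathcomp Require Import topology normedtype.

Set Implicit Arguments.
Unset Strict Implicit.
Unset Printing Implicit Defensive.

Import Order.TTheory GRing.Theory Num.Theory.
Import numFieldNormedType.Exports.

Local Open Scope classical_set_scope.
Local Open Scope card_scope.
Local Open Scope ring_scope.

Record fo_signature := FOSignature {
  fo_fun : Type;
  fo_far : fo_fun -> nat;
  fo_rel : Type;
  fo_rar : fo_rel -> nat
}.

Definition fo_countable (L : fo_signature) : Prop :=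
  countable [set: fo_fun L] /\ countable [set: fo_rel L].

Inductive fo_term (L : fo_signature) : Type :=
| FVar of nat
| FApp (f : fo_fun L) of ('I_(fo_far f) -> fo_term L).
Arguments FVar {L}.

Inductive fo_formula (L : fo_signature) : Type :=
| FEq of fo_term L & fo_term L
| FRel (r : fo_rel L) of ('I_(fo_rar r) -> fo_term L)
| FNot of fo_formula L
| FOr of fo_formula L & fo_formula L
| FAnd of fo_formula L & fo_formula L
| FEx of nat & fo_formula L.

Fixpoint fo_term_vars (L : fo_signature) (t : fo_term L) : seq nat :=
  match t with
  | FVar i => [:: i]
  | FApp _ a => flatten [seq fo_term_vars (a k) | k <- enum 'I_ _]
  end.

Fixpoint fo_free_occ (L : fo_signature) (phi : fo_formula L) : seq nat :=
  match phi with
  | FEq t u => fo_term_vars t ++ fo_term_vars u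
  | FRel _ a => flatten [seq fo_term_vars (a k) | k <- enum 'I_ _]
  | FNot phi => fo_free_occ phi
  | FOr phi psi | FAnd phi psi => fo_free_occ phi ++ fo_free_occ psi
  | FEx i phi => [seq j <- fo_free_occ phi | j != i]
  end.

Definition fo_fv (L : fo_signature) (phi : fo_formula L) : seq nat :=
  undup (fo_free_occ phi).

Definition fo_sentence (L : fo_signature) :=
  {phi : fo_formula L | fo_fv phi == [::]}.

Definition fo_theory (L : fo_signature) := set (fo_sentence L).

Record fo_structure (L : fo_signature) := FOStructure {
  fo_car :> Type;
  fo_inh : inhabited fo_car;
  fo_fint : forall f : fo_fun L, ('I_(fo_far f) -> fo_car) -> fo_car;
  fo_rint : forall r : fo_rel L, ('I_(fo_rar r) -> fo_car) -> Prop
}.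

Fixpoint fo_teval (L : fo_signature) (M : fo_structure L) (rho : nat -> M)
    (t : fo_term L) : M :=
  match t with
  | FVar i => rho i
  | FApp f a => @fo_fint L M f (fun k => fo_teval rho (a k))
  end.

Fixpoint fo_holds (L : fo_signature) (M : fo_structure L) (rho : nat -> M)
    (phi : fo_formula L) : Prop :=
  match phi with
  | FEq t u => fo_teval rho t = fo_teval rho u
  | FRel r a => @fo_rint L M r (fun k => fo_teval rho (a k))
  | FNot phi => ~ fo_holds rho phi
  | FOr phi psi => fo_holds rho phi \/ fo_holds rho psi
  | FAnd phi psi => fo_holds rho phi /\ fo_holds rho psi
  | FEx i phi => exists a : M, fo_holds [eta rho with i |-> a] phi
  end.

Definition fo_true (L : fo_signature) (M : fo_structure L)
    (phi : fo_formula L) : Prop :=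
  forall rho : nat -> M, fo_holds rho phi.

Definition fo_valid (L : fo_signature) (phi : fo_formula L) : Prop :=
  forall M : fo_structure L, fo_true M phi.

Definition fo_model (L : fo_signature) (T : fo_theory L)
    (M : fo_structure L) : Prop :=
  forall phi : fo_sentence L, T phi -> fo_true M (sval phi).

Definition fo_complete (L : fo_signature) (T : fo_theory L) : Prop :=
  (exists M : fo_structure L, fo_model T M) /\
  forall phi : fo_sentence L,
    (forall M, fo_model T M -> fo_true M (sval phi)) \/
    (forall M, fo_model T M -> fo_true M (FNot (sval phi))).

Definition fo_iso (L : fo_signature) (M N : fo_structure L) : Prop :=
  exists h : M -> N,
    [/\ bijective h,
        forall (f : fo_fun L) (x : 'I_(fo_far f) -> M),
          h (fo_fint x) = @fo_fint L N f (h \o x)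
      & forall (r : fo_rel L) (x : 'I_(fo_rar r) -> M),
          fo_rint x <-> @fo_rint L N r (h \o x)].

(* Omega-categoricity is a property of complete theories only. *)
Definition fo_omega_categorical (L : fo_signature) (T : fo_theory L) : Prop :=
  fo_complete T /\
  ((exists2 M : fo_structure L, fo_model T M & finite_set [set: M]) \/
   (exists2 M : fo_structure L, fo_model T M /\ [set: M] #= [set: nat] &
      forall N : fo_structure L,
        fo_model T N -> [set: N] #= [set: nat] -> fo_iso M N)).

(* Continuous logic is many-sorted, with truth values in [0, 1] and 0 read as
   truth. The moduli of uniform continuity are relative to the maximum metric
   on products; see [cl_fint_unif] and [cl_pint_unif]. *)
Record cl_signature (R : realType) := CLSignature {
  cl_sort : eqType;
  cl_fun : Type;
  cl_far : cl_fun -> nat;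
  cl_fdom : forall f : cl_fun, 'I_(cl_far f) -> cl_sort;
  cl_fcod : cl_fun -> cl_sort;
  cl_fmod : cl_fun -> R -> R;
  cl_fmod_gt0 : forall f e, 0 < e -> 0 < cl_fmod f e;
  cl_pred : Type;
  cl_par : cl_pred -> nat;
  cl_pdom : forall p : cl_pred, 'I_(cl_par p) -> cl_sort;
  cl_pmod : cl_pred -> R -> R;
  cl_pmod_gt0 : forall p e, 0 < e -> 0 < cl_pmod p e
}.
Arguments cl_fdom {R c} f _.
Arguments cl_pdom {R c} p _.

Inductive cl_term (R : realType) (L : cl_signature R) : cl_sort L -> Type :=
| CVar (s : cl_sort L) of nat : cl_term s
| CApp (f : cl_fun L) of (forall k, cl_term (cl_fdom f k)) :
    cl_term (cl_fcod f).
Arguments CVar {R L}.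
Arguments CApp {R L}.

Definition unit_cube (R : realType) (n : nat) : set 'rV[R]_n :=
  [set x | forall k, 0 <= x 0 k <= 1].

Record connective (R : realType) (n : nat) := Connective {
  conn_fun :> 'rV[R]_n -> R;
  conn_continuous : {within @unit_cube R n, continuous conn_fun};
  conn_range : forall x, unit_cube x -> 0 <= conn_fun x <= 1
}.

Inductive cl_formula (R : realType) (L : cl_signature R) : Type :=
| CDist (s : cl_sort L) of cl_term s & cl_term s
| CPred (p : cl_pred L) of (forall k, cl_term (cl_pdom p k))
| CConn (n : nat) of connective R n & ('I_n -> cl_formula L)
| CSup (s : cl_sort L) of nat & cl_formula L
| CInf (s : cl_sort L) of nat & cl_formula L.
Arguments CPred {R L}.
Arguments CSup {R L}.
Arguments CInf {R L}.

Fixpoint cl_term_vars (R : realType) (L : cl_signature R) (s : cl_sort L)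
    (t : cl_term s) : seq (cl_sort L * nat) :=
  match t with
  | CVar s i => [:: (s, i)]
  | CApp _ a => flatten [seq cl_term_vars (a k) | k <- enum 'I_ _]
  end.

Fixpoint cl_fv (R : realType) (L : cl_signature R) (phi : cl_formula L) :
    seq (cl_sort L * nat) :=
  match phi with
  | CDist _ t u => cl_term_vars t ++ cl_term_vars u
  | CPred _ a => flatten [seq cl_term_vars (a k) | k <- enum 'I_ _]
  | CConn _ _ a => flatten [seq cl_fv (a k) | k <- enum 'I_ _]
  | CSup s i phi | CInf s i phi => [seq v <- cl_fv phi | v != (s, i)]
  end.

Definition cl_sentence (R : realType) (L : cl_signature R) :=
  {phi : cl_formula L | cl_fv phi == [::]}.

(* A set of sentences [phi] stands for the set of conditions [phi = 0]. *)
Definition cl_theory (R : realType) (L : cl_signature R) :=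
  set (cl_sentence L).

Record cl_structure (R : realType) (L : cl_signature R) := CLStructure {
  cl_car :> cl_sort L -> metricType R;
  cl_inh : forall s, inhabited (cl_car s);
  cl_diam : forall s (x y : cl_car s), mdist x y <= 1;
  cl_cauchy_cvg : forall s (F : set_system (cl_car s)),
    ProperFilter F -> cauchy F -> exists x : cl_car s, F --> x;
  cl_fint : forall f : cl_fun L,
    (forall k, cl_car (cl_fdom f k)) -> cl_car (cl_fcod f);
  cl_fint_unif : forall (f : cl_fun L) (e : R), 0 < e ->
    forall x y : forall k, cl_car (cl_fdom f k),
    (forall k, mdist (x k) (y k) < cl_fmod f e) ->
    mdist (cl_fint x) (cl_fint y) <= e;
  cl_pint : forall p : cl_pred L, (forall k, cl_car (cl_pdom p k)) -> R;
  cl_pint_range : forall (p : cl_pred L) (x : forall k, cl_car (cl_pdom p k)),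
    0 <= cl_pint x <= 1;
  cl_pint_unif : forall (p : cl_pred L) (e : R), 0 < e ->
    forall x y : forall k, cl_car (cl_pdom p k),
    (forall k, mdist (x k) (y k) < cl_pmod p e) ->
    `|cl_pint x - cl_pint y| <= e
}.

Definition cl_assignment (R : realType) (L : cl_signature R)
  (M : cl_structure L) := forall s : cl_sort L, nat -> M s.

Definition cl_update (R : realType) (L : cl_signature R) (M : cl_structure L)
    (rho : cl_assignment M) (s : cl_sort L) (i : nat) (a : M s) :
    cl_assignment M :=
  dfwith rho ([eta rho s with i |-> a] : nat -> M s).

Fixpoint cl_teval (R : realType) (L : cl_signature R) (M : cl_structure L)
    (rho : cl_assignment M) (s : cl_sort L) (t : cl_term s) : M s :=
  match t in cl_term s return M s with
  | CVar s i => rho s i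
  | CApp f a => @cl_fint R L M f (fun k => cl_teval rho (a k))
  end.

Fixpoint cl_value (R : realType) (L : cl_signature R) (M : cl_structure L)
    (rho : cl_assignment M) (phi : cl_formula L) : R :=
  match phi with
  | CDist _ t u => mdist (cl_teval rho t) (cl_teval rho u)
  | CPred p a => @cl_pint R L M p (fun k => cl_teval rho (a k))
  | CConn _ u a => u (\row_k cl_value rho (a k))
  | CSup s i phi => sup (range (fun a : M s => cl_value (cl_update rho i a) phi))
  | CInf s i phi => inf (range (fun a : M s => cl_value (cl_update rho i a) phi))
  end.

Definition cl_model (R : realType) (L : cl_signature R) (T : cl_theory L)
    (M : cl_structure L) : Prop :=
  forall phi : cl_sentence L, T phi ->
  forall rho : cl_assignment M, cl_value rho (sval phi) = 0.

Definition cl_complete (R : realType) (L : cl_signature R) (T : cl_theory L) :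
    Prop :=
  (exists M : cl_structure L, cl_model T M) /\
  forall phi : cl_sentence L, exists r : R,
    forall M : cl_structure L, cl_model T M ->
    forall rho : cl_assignment M, cl_value rho (sval phi) = r.

Definition cl_iso (R : realType) (L : cl_signature R) (M N : cl_structure L) :
    Prop :=
  exists h : forall s, M s -> N s,
    [/\ forall s, bijective (h s),
        forall s (x y : M s), mdist (h s x) (h s y) = mdist x y,
        forall (f : cl_fun L) (x : forall k, M (cl_fdom f k)),
          h _ (cl_fint x) = @cl_fint R L N f (fun k => h _ (x k))
      & forall (p : cl_pred L) (x : forall k, M (cl_pdom p k)),
          @cl_pint R L N p (fun k => h _ (x k)) = cl_pint x].

Definition cl_separable (R : realType) (L : cl_signature R)
    (M : cl_structure L) : Prop :=
  forall s, exists2 D : set (M s), countable D & dense D.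

Definition cl_omega_categorical (R : realType) (L : cl_signature R)
    (T : cl_theory L) : Prop :=
  cl_complete T /\
  exists2 M : cl_structure L, cl_model T M /\ cl_separable M &
    forall N : cl_structure L, cl_model T N -> cl_separable N -> cl_iso M N.

(* As truth values are nonnegative, the condition [cl_closure phi = 0] (see
   below) says that [phi] vanishes identically. *)

Definition cl_sup_all (R : realType) (L : cl_signature R)
    (vs : seq (cl_sort L * nat)) (phi : cl_formula L) : cl_formula L :=
  foldr (fun v psi => CSup v.1 v.2 psi) phi vs.

Lemma cl_fv_sup_all (R : realType) (L : cl_signature R)
    (vs : seq (cl_sort L * nat)) (phi : cl_formula L) :
  cl_fv (cl_sup_all vs phi) = [seq v <- cl_fv phi | v \notin vs].
Proof.
elim: vs => [|[s i] vs IH] /=; first by rewrite filter_predT.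
rewrite IH -filter_predI; apply: eq_filter => v.
by rewrite /= in_cons negb_or.
Qed.

Lemma cl_closureP (R : realType) (L : cl_signature R) (phi : cl_formula L) :
  cl_fv (cl_sup_all (cl_fv phi) phi) == [::].
Proof.
rewrite cl_fv_sup_all -size_eq0 size_filter -leqn0 leqNgt -has_count.
by apply/hasPn => v /= ->.
Qed.

Definition cl_closure (R : realType) (L : cl_signature R)
    (phi : cl_formula L) : cl_sentence L :=
  exist _ (cl_sup_all (cl_fv phi) phi) (cl_closureP phi).

Section Connectives.
Variable R : realType.

Let coord_cont n (k : 'I_n) : continuous (fun x : 'rV[R]_n => x 0 k : R).
Proof. exact: coord_continuous. Qed.

Let cst_cont n (a : R) : continuous (fun _ : 'rV[R]_n => a).
Proof. exact: cst_continuous. Qed.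

Lemma conn_compl_cont :
  {within @unit_cube R 1, continuous (fun x : 'rV[R]_1 => 1 - x 0 0)}.
Proof.
apply: continuous_subspaceT => x.
exact: (continuousB (@cst_cont 1 1 x) (@coord_cont 1 0 x)).
Qed.

Lemma conn_compl_range (x : 'rV[R]_1) :
  unit_cube x -> 0 <= 1 - x 0 0 <= 1.
Proof. by move=> /(_ 0) /andP[x0 x1]; rewrite subr_ge0 x1 gerBl. Qed.

Definition conn_compl : connective R 1 :=
  Connective conn_compl_cont conn_compl_range.

Lemma conn_half_cont :
  {within @unit_cube R 1, continuous (fun x : 'rV[R]_1 => x 0 0 / 2)}.
Proof.
apply: continuous_subspaceT => x.
exact: (continuousM (@coord_cont 1 0 x) (@cst_cont 1 2^-1 x)).
Qed.

Lemma conn_half_range (x : 'rV[R]_1) :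
  unit_cube x -> 0 <= x 0 0 / 2 <= 1.
Proof.
move=> /(_ 0) /andP[x0 x1]; rewrite divr_ge0//= ler_pdivrMr// mul1r.
by rewrite (le_trans x1)// ler1n.
Qed.

Definition conn_half : connective R 1 :=
  Connective conn_half_cont conn_half_range.

Lemma conn_mean_cont : {within @unit_cube R 2,
  continuous (fun x : 'rV[R]_2 => (x 0 0 + x 0 1) / 2)}.
Proof.
apply: continuous_subspaceT => x.
exact: (continuousM (continuousD (@coord_cont 2 0 x) (@coord_cont 2 1 x))
                    (@cst_cont 2 2^-1 x)).
Qed.

Lemma conn_mean_range (x : 'rV[R]_2) :
  unit_cube x -> 0 <= (x 0 0 + x 0 1) / 2 <= 1.
Proof.
move=> xC; have /andP[a0 a1] := xC 0; have /andP[b0 b1] := xC 1.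
by rewrite divr_ge0 ?addr_ge0//= ler_pdivrMr// mul1r (_ : 2 = 1 + 1)// lerD.
Qed.

Definition conn_mean : connective R 2 :=
  Connective conn_mean_cont conn_mean_range.

Lemma conn_diff_cont : {within @unit_cube R 2,
  continuous (fun x : 'rV[R]_2 => `|x 0 0 - x 0 1|)}.
Proof.
apply: continuous_subspaceT => x.
exact: (@cvg_norm _ R^o _ _ _ _ _
  (continuousB (@coord_cont 2 0 x) (@coord_cont 2 1 x))).
Qed.

Lemma conn_diff_range (x : 'rV[R]_2) :
  unit_cube x -> 0 <= `|x 0 0 - x 0 1| <= 1.
Proof.
move=> xC; have /andP[a0 a1] := xC 0; have /andP[b0 b1] := xC 1.
rewrite normr_ge0/= ler_norml lerBrDr addrC; apply/andP; split.
  by rewrite (le_trans _ a0)// subr_le0.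
by rewrite lerBlDr (le_trans a1)// lerDl.
Qed.

Definition conn_diff : connective R 2 :=
  Connective conn_diff_cont conn_diff_range.

End Connectives.

Inductive rand_sort := sK | sB.

Definition rand_sort_bool (s : rand_sort) : bool := if s is sB then true else false.
Definition bool_rand_sort (b : bool) : rand_sort := if b then sB else sK.
Lemma rand_sort_boolK : cancel rand_sort_bool bool_rand_sort.
Proof. by case. Qed.
HB.instance Definition _ := Equality.copy rand_sort (can_type rand_sort_boolK).

(* The arity of the symbol [REv phi] is the number of free variables of [phi];
   its k-th argument corresponds to the variable [nth 0 (fo_fv phi) k]. *)
Inductive rand_fun (L : fo_signature) : Type :=
| REv of fo_formula L
| RTop | RBot | RNeg | RJoin | RMeet.
Arguments RTop {L}.
Arguments RBot {L}.
Arguments RNeg {L}.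
Arguments RJoin {L}.
Arguments RMeet {L}.

Definition rand_far (L : fo_signature) (f : rand_fun L) : nat :=
  match f with
  | REv phi => size (fo_fv phi)
  | RTop | RBot => 0
  | RNeg => 1
  | RJoin | RMeet => 2
  end.

Definition rand_fdom (L : fo_signature) (f : rand_fun L) (k : 'I_(rand_far f)) :
    rand_sort :=
  match f with REv _ => sK | _ => sB end.

(* The axioms of the randomization theory force every symbol to be 1-Lipschitz
   in each argument, so that [e / n] is a modulus for an [n]-ary symbol; [n.+1]
   avoids a division by zero. These moduli thus exclude no model. *)
Definition lipschitz_mod (R : realType) (n : nat) (e : R) : R := e / n.+1%:R.

Lemma lipschitz_mod_gt0 (R : realType) (n : nat) (e : R) :
  0 < e -> 0 < lipschitz_mod n e.
Proof. by move=> e0; rewrite divr_gt0. Qed.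

Definition rand_signature (R : realType) (L : fo_signature) : cl_signature R :=
  @CLSignature R rand_sort
    (rand_fun L) (@rand_far L) (@rand_fdom L) (fun=> sB)
    (fun f => lipschitz_mod (rand_far f))
    (fun f => @lipschitz_mod_gt0 R (rand_far f))
    unit (fun=> 1) (fun _ _ => sB)
    (fun=> lipschitz_mod 1) (fun=> @lipschitz_mod_gt0 R 1).

Section RandomizationTheory.
Variables (R : realType) (L : fo_signature).

Let LR : cl_signature R := rand_signature R L.
Let Kterm : Type := @cl_term R LR sK.
Let Bterm : Type := @cl_term R LR sB.

Definition Kvar (i : nat) : Kterm := @CVar R LR sK i.
Definition Bvar (i : nat) : Bterm := @CVar R LR sB i.

Definition event (phi : fo_formula L) : Bterm :=
  @CApp R LR (REv phi) (fun k => Kvar (nth 0%N (fo_fv phi) k)).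

Definition Btop : Bterm :=
  @CApp R LR RTop (fun k => Bvar k).
Definition Bbot : Bterm :=
  @CApp R LR RBot (fun k => Bvar k).
Definition Bneg (U : Bterm) : Bterm :=
  @CApp R LR RNeg (fun=> U).
Definition Bjoin (U V : Bterm) : Bterm :=
  @CApp R LR RJoin (fun k => if val k == 0%N then U else V).
Definition Bmeet (U V : Bterm) : Bterm :=
  @CApp R LR RMeet (fun k => if val k == 0%N then U else V).
Definition Bsymdiff (U V : Bterm) : Bterm :=
  Bjoin (Bmeet U (Bneg V)) (Bmeet (Bneg U) V).

Definition dK (x y : Kterm) : cl_formula LR := CDist x y.
Definition dB (U V : Bterm) : cl_formula LR := CDist U V.
Definition mu (U : Bterm) : cl_formula LR := @CPred R LR tt (fun=> U).

Definition Ccompl (phi : cl_formula LR) : cl_formula LR :=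
  CConn (conn_compl R) (fun=> phi).
Definition Chalf (phi : cl_formula LR) : cl_formula LR :=
  CConn (conn_half R) (fun=> phi).
Definition Cmean (phi psi : cl_formula LR) : cl_formula LR :=
  CConn (conn_mean R) (fun k => if val k == 0%N then phi else psi).
Definition Cdiff (phi psi : cl_formula LR) : cl_formula LR :=
  CConn (conn_diff R) (fun k => if val k == 0%N then phi else psi).

(* The axioms are open formulas; [randomization] takes the supremum over their
   free variables. A first-order variable [i] is matched with the random-element
   variable [Kvar i]. *)
Let U := Bvar 0.
Let V := Bvar 1.
Let W := Bvar 2.

Inductive rand_axiom (T : fo_theory L) : cl_formula LR -> Prop :=
| rand_valid phi : fo_valid phi -> rand_axiom T (dB (event phi) Btop)
| rand_not phi : rand_axiom T (dB (event (FNot phi)) (Bneg (event phi)))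
| rand_or phi psi :
    rand_axiom T (dB (event (FOr phi psi)) (Bjoin (event phi) (event psi)))
| rand_and phi psi :
    rand_axiom T (dB (event (FAnd phi psi)) (Bmeet (event phi) (event psi)))
| rand_joinC : rand_axiom T (dB (Bjoin U V) (Bjoin V U))
| rand_meetC : rand_axiom T (dB (Bmeet U V) (Bmeet V U))
| rand_joinA : rand_axiom T (dB (Bjoin U (Bjoin V W)) (Bjoin (Bjoin U V) W))
| rand_meetA : rand_axiom T (dB (Bmeet U (Bmeet V W)) (Bmeet (Bmeet U V) W))
| rand_joinI :
    rand_axiom T (dB (Bjoin U (Bmeet V W)) (Bmeet (Bjoin U V) (Bjoin U W)))
| rand_meetU :
    rand_axiom T (dB (Bmeet U (Bjoin V W)) (Bjoin (Bmeet U V) (Bmeet U W)))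
| rand_joinx0 : rand_axiom T (dB (Bjoin U Bbot) U)
| rand_meetx1 : rand_axiom T (dB (Bmeet U Btop) U)
| rand_joinxN : rand_axiom T (dB (Bjoin U (Bneg U)) Btop)
| rand_meetxN : rand_axiom T (dB (Bmeet U (Bneg U)) Bbot)
| rand_dK i j :
    rand_axiom T (Cdiff (dK (Kvar i) (Kvar j))
                        (Ccompl (mu (event (FEq (FVar i) (FVar j))))))
| rand_dB : rand_axiom T (Cdiff (dB U V) (mu (Bsymdiff U V)))
| rand_full i phi :
    rand_axiom T (@CInf R LR sK i (dB (event phi) (event (FEx i phi))))
| rand_event :
    rand_axiom T (@CInf R LR sK 0 (@CInf R LR sK 1
                    (dB U (event (FEq (FVar 0) (FVar 1))))))
| rand_mu1 : rand_axiom T (Ccompl (mu Btop))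
| rand_mu0 : rand_axiom T (mu Bbot)
(* Halving both sides of the modular law keeps its values in [0, 1]. *)
| rand_muUI :
    rand_axiom T (Cdiff (Cmean (mu U) (mu V))
                        (Cmean (mu (Bjoin U V)) (mu (Bmeet U V))))
| rand_atomless :
    rand_axiom T (@CInf R LR sB 1 (Cdiff (mu (Bmeet U V)) (Chalf (mu U))))
| rand_transfer (phi : fo_sentence L) :
    T phi -> rand_axiom T (dB (event (sval phi)) Btop).

Definition randomization (T : fo_theory L) : cl_theory LR :=
  @cl_closure R LR @` rand_axiom T.

End RandomizationTheory.

(* Main.v *)
(** Let K be a model of T^R. For an ultrafilter U of events, the
    formulas whose event lies in U form a complete Henkin diagram over K, so
    K/U is a model of T; an identity of events can be checked at every U.

    If T is omega-categorical, then for each n finitely many formulas isolate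
    the complete n-types (omitting types, and an ultrapower to see that there
    are finitely many). Hence the type of a tuple of K is determined by the
    measures of finitely many disjoint events. Since K is full and atomless, a
    new element of one model can be matched in any other model by splitting
    events in prescribed proportions. This back-and-forth shows that T^R is
    complete and, along dense sequences, that its separable model is unique.

    Conversely, let M be a model of T with m0 <> m1. The periodic functions
    from nat to M, under the density of the set where two of them differ,
    complete to a model of T^R, separable when M is countable; its constants
    satisfy in probability 1 whatever holds in M. If T^R is omega-categorical,
    T is therefore complete, and for countable M and N there is an isomorphism
    h between the two completions. The pairs of tuples m, n such that
    [[h(m) = n]] has positive measure form a back-and-forth system. *)
Require Import Defs.
From HB Require Import structures.
From mathcomp Require Import all_boot all_order all_algebra.
From mathcomp Require Import boolp classical_sets functions cardinality reals.
From mathcomp Require Import topology normedtype sequences.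
From mathcomp Require Import lra zify.

Set Implicit Arguments.
Unset Strict Implicit.
Unset Printing Implicit Defensive.

Import Order.TTheory GRing.Theory Num.Theory.
Import numFieldNormedType.Exports.

Local Open Scope classical_set_scope.
Local Open Scope card_scope.
Local Open Scope ring_scope.

(** * First-order formulas and truth systems *)
Section FirstOrder.
Variable L : fo_signature.
Implicit Types (M N : fo_structure L) (phi psi chi : fo_formula L).
Implicit Types (t u : fo_term L) (s : seq (fo_formula L)).

(** An ultrafilter of events ignores measure: it may contain events of arbitrarily small measure.
    The axioms of fullness and of event representation promise witnesses only up to an error, so
    before K/U can be formed they must be made exact, by limits that exist because both sorts are
    complete. Two everywhere distinct random elements [c] and [d], available because models of T
    have two elements, then turn each event into an equation [[[x = c]]]; back-and-forth handles
    random elements only, and events follow. Finiteness of the set of types matters because a new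
    element is glued from finitely many pieces. In the converse, an isomorphism need not send
    constants to constants. But a random element of a completion is as close as desired to a
    periodic function, so with probability above 1 - e it takes one of finitely many constant
    values; with e the measure reached so far, one of these values keeps the measure positive.
    Periodic sets have additive densities, a countable model has only countably many periodic
    functions, and doubling the period halves an event. *)

Lemma mem_flatten_enum (T : eqType) n (a : 'I_n -> seq T) (k : 'I_n) (x : T) :
  x \in a k -> x \in flatten [seq a k | k <- enum 'I_n].
Proof.
by move=> xa; apply/flatten_mapP; exists k => //; rewrite mem_enum.
Qed.

Lemma fo_teval_local M (r q : nat -> M) t :
  {in fo_term_vars t, r =1 q} -> fo_teval r t = fo_teval q t.
Proof.
elim: t => [i|f a IH] /= rq; first by apply: rq; rewrite inE.
congr fo_fint; apply: funext => k; apply: IH => i ik; apply: rq.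
exact: mem_flatten_enum ik.
Qed.

Lemma fo_holds_local M (r q : nat -> M) phi :
  {in fo_fv phi, r =1 q} -> fo_holds r phi <-> fo_holds q phi.
Proof.
rewrite /fo_fv => H; have {H} : {in fo_free_occ phi, r =1 q}.
  by move=> i ip; apply: H; rewrite mem_undup.
elim: phi r q => [t u|p a|phi IH|phi IH psi IH'|phi IH psi IH'|i phi IH] r q /= rq.
- by rewrite !(@fo_teval_local _ r q)// => i ii; apply: rq; rewrite mem_cat ii ?orbT.
- suff -> : (fun k => fo_teval r (a k)) = (fun k => fo_teval q (a k)) by [].
  apply: funext => k; apply: fo_teval_local => i ik; apply: rq.
  exact: mem_flatten_enum ik.
- by rewrite (IH r q).
- by rewrite (IH r q) ?(IH' r q)// => i ii; apply: rq; rewrite mem_cat ii ?orbT.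
- by rewrite (IH r q) ?(IH' r q)// => i ii; apply: rq; rewrite mem_cat ii ?orbT.
- suff H a : fo_holds [eta r with i |-> a] phi <-> fo_holds [eta q with i |-> a] phi.
    by split=> -[a /H]; exists a.
  apply: IH => j jp /=; case: eqP => // /eqP ji; apply: rq.
  by rewrite mem_filter ji.
Qed.

Definition fo_imp phi psi := FOr (FNot phi) psi.
Definition fo_all i phi := FNot (FEx i (FNot phi)).
(** Truth is written as a closed formula, so that conjunctions and disjunctions ending in it gain no
    free variable. *)
Definition fo_top : fo_formula L := FEx 0 (FEq (FVar 0) (FVar 0)).
Definition fo_conj s := foldr (@FAnd L) fo_top s.
Definition fo_disj s := foldr (@FOr L) (FNot fo_top) s.

Lemma fo_holds_imp M (r : nat -> M) phi psi :
  fo_holds r (fo_imp phi psi) <-> (fo_holds r phi -> fo_holds r psi).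
Proof.
rewrite /=; split=> [[]//|H].
by have [/H|] := pselect (fo_holds r phi); [right|left].
Qed.

Lemma fo_holds_all M (r : nat -> M) i phi :
  fo_holds r (fo_all i phi) <-> forall a, fo_holds [eta r with i |-> a] phi.
Proof.
rewrite /=; split=> [H a|H [a]]; last by apply.
by apply: contrapT => na; apply: H; exists a.
Qed.

Lemma fo_holds_top M (r : nat -> M) : fo_holds r fo_top.
Proof. by exists (r 0%N). Qed.

Lemma fo_holds_conj (I : eqType) M (r : nat -> M) (s : seq I) (F : I -> fo_formula L) :
  fo_holds r (fo_conj (map F s)) <-> forall i, i \in s -> fo_holds r (F i).
Proof.
elim: s => [|i s IH] /=; first by split=> // _; exists (r 0%N).
rewrite IH; split=> [[Hi H] j|H].
  by rewrite inE => /orP[/eqP->|/H].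
by split=> [|j js]; apply: H; rewrite inE ?eqxx ?js ?orbT.
Qed.

Lemma fo_holds_disj (I : eqType) M (r : nat -> M) (s : seq I) (F : I -> fo_formula L) :
  fo_holds r (fo_disj (map F s)) <-> exists2 i, i \in s & fo_holds r (F i).
Proof.
elim: s => [|i s IH] /=.
  by split=> [[]|[]//]; exists (r 0%N).
rewrite IH; split=> [[Hi|[j js Hj]]|[j]].
- by exists i => //; rewrite inE eqxx.
- by exists j => //; rewrite inE js orbT.
- by rewrite inE => /orP[/eqP->|js] Hj; [left|right; exists j].
Qed.

Lemma mem_fv_conj (I : eqType) (s : seq I) (F : I -> fo_formula L) j :
  j \in fo_fv (fo_conj (map F s)) -> exists2 i, i \in s & j \in fo_fv (F i).
Proof.
rewrite mem_undup; elim: s => [|i s IH] //=.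
rewrite mem_cat => /orP[ji|/IH[k ks jk]].
  by exists i; rewrite ?inE ?eqxx// mem_undup.
by exists k; rewrite // inE ks orbT.
Qed.

Fixpoint fo_tren (sg : nat -> nat) t : fo_term L :=
  match t with
  | FVar i => FVar (sg i)
  | FApp f a => FApp (fun k => fo_tren sg (a k))
  end.

(** [sg] is arbitrary, possibly not injective. The new bound variable exceeds the image of every
    variable free in the body, so nothing is captured. *)
Fixpoint fo_ren (sg : nat -> nat) phi : fo_formula L :=
  match phi with
  | FEq t u => FEq (fo_tren sg t) (fo_tren sg u)
  | FRel p a => FRel (fun k => fo_tren sg (a k))
  | FNot phi => FNot (fo_ren sg phi)
  | FOr phi psi => FOr (fo_ren sg phi) (fo_ren sg psi)
  | FAnd phi psi => FAnd (fo_ren sg phi) (fo_ren sg psi)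
  | FEx i phi =>
      let j := (\max_(k <- fo_free_occ phi) sg k).+1 in
      FEx j (fo_ren [eta sg with i |-> j] phi)
  end.

Lemma fo_teval_ren M (r : nat -> M) sg t :
  fo_teval r (fo_tren sg t) = fo_teval (r \o sg) t.
Proof.
by elim: t => [i|f a IH] //=; congr fo_fint; apply: funext => k; rewrite IH.
Qed.

Lemma fo_holds_ren M (r : nat -> M) sg phi :
  fo_holds r (fo_ren sg phi) <-> fo_holds (r \o sg) phi.
Proof.
elim: phi r sg => [t u|p a|phi IH|phi IH psi IH'|phi IH psi IH'|i phi IH] r sg /=.
- by rewrite !fo_teval_ren.
- suff -> : (fun k => fo_teval r (fo_tren sg (a k))) =
            (fun k => fo_teval (r \o sg) (a k)) by [].
  by apply: funext => k; rewrite fo_teval_ren.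
- by rewrite IH.
- by rewrite IH IH'.
- by rewrite IH IH'.
- set j := (\max_(k <- _) _).+1.
  suff H a : fo_holds [eta r with j |-> a] (fo_ren [eta sg with i |-> j] phi) <->
             fo_holds [eta r \o sg with i |-> a] phi.
    by split=> -[a /H]; exists a.
  rewrite IH; apply: fo_holds_local => k; rewrite mem_undup => kp /=.
  case: (k =P i) => [_|_]; first by rewrite eqxx.
  case: eqP => // skj; have : (sg k <= \max_(k <- fo_free_occ phi) sg k)%N.
    exact: leq_bigmax_seq.
  by rewrite skj /j ltnn.
Qed.

Lemma fo_vars_tren sg t : fo_term_vars (fo_tren sg t) = map sg (fo_term_vars t).
Proof.
elim: t => [i|f a IH] //=; rewrite map_flatten -map_comp; congr flatten.
by apply: eq_map => k /=; rewrite IH.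
Qed.

Lemma fo_occ_ren sg phi :
  {subset fo_free_occ (fo_ren sg phi) <= map sg (fo_free_occ phi)}.
Proof.
elim: phi sg => [t u|p a|phi IH|phi IH psi IH'|phi IH psi IH'|i phi IH] sg j //=.
- by rewrite !fo_vars_tren map_cat.
- rewrite map_flatten -map_comp; suff -> : [seq fo_term_vars (fo_tren sg (a k)) | k <- enum 'I_ _] =
    [seq (map sg \o (fun k => fo_term_vars (a k))) i | i <- enum 'I_ _] by [].
  by apply: eq_map => k /=; rewrite fo_vars_tren.
- exact: IH.
- by rewrite map_cat !mem_cat => /orP[/IH->|/IH'->]; rewrite ?orbT.
- by rewrite map_cat !mem_cat => /orP[/IH->|/IH'->]; rewrite ?orbT.
- rewrite mem_filter => /andP[jn /IH/mapP[k kp jE]]; move: jn; rewrite {}jE /=.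
  case: (k =P i) => [_|/eqP ki _]; first by move=> /negP[]; exact: eqxx.
  by apply: map_f; rewrite mem_filter ki.
Qed.

Lemma fo_fv_ren sg phi j :
  j \in fo_fv (fo_ren sg phi) -> exists2 i, i \in fo_fv phi & j = sg i.
Proof.
by rewrite mem_undup => /fo_occ_ren/mapP[i ip ->]; exists i; rewrite ?mem_undup.
Qed.

Definition fo_bound phi := (\max_(k <- fo_fv phi) k).+1.

Lemma fo_boundP phi i : i \in fo_fv phi -> (i < fo_bound phi)%N.
Proof. by move=> ip; rewrite ltnS (@leq_bigmax_seq _ _ predT id). Qed.

End FirstOrder.

Notation fo_below n phi := (forall i, i \in fo_fv phi -> (i < n)%N).

Section TruthSystem.
Variables (L : fo_signature) (K : Type) (Tr : (nat -> K) -> fo_formula L -> Prop).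
Implicit Types (phi psi : fo_formula L) (rho : nat -> K).

(* [Tr rho phi] asserts that [phi] holds at the names [rho]; with witnesses for existential
   formulas, it is realized by a structure on the classes of names. *)
Record truth_system : Prop := TruthSystem {
  tr_not : forall rho phi, Tr rho (FNot phi) <-> ~ Tr rho phi;
  tr_or : forall rho phi psi, Tr rho (FOr phi psi) <-> Tr rho phi \/ Tr rho psi;
  tr_and : forall rho phi psi, Tr rho (FAnd phi psi) <-> Tr rho phi /\ Tr rho psi;
  tr_valid : forall rho phi, fo_valid phi -> Tr rho phi;
  tr_local : forall rho rho' phi,
    {in fo_fv phi, rho =1 rho'} -> Tr rho phi -> Tr rho' phi;
  tr_eq : forall rho i j, rho i = rho j -> Tr rho (FEq (FVar i) (FVar j)) }.

Hypothesis TS : truth_system.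

Lemma tr_localE rho rho' phi :
  {in fo_fv phi, rho =1 rho'} -> Tr rho phi <-> Tr rho' phi.
Proof. by move=> e; split; apply: (tr_local TS) => // i /e. Qed.

(** The implication is valid, and a truth system accepts valid formulas. Semantic arguments in
    structures thus replace derivations. *)
Lemma tr_entail rho phi psi :
  (forall (M : fo_structure L) (r : nat -> M), fo_holds r phi -> fo_holds r psi) ->
  Tr rho phi -> Tr rho psi.
Proof.
move=> H tphi; have /(tr_or TS)[/(tr_not TS)//|//] : Tr rho (fo_imp phi psi).
by apply: (tr_valid TS) => M r; apply/fo_holds_imp/H.
Qed.

Lemma tr_equiv rho phi psi :
  (forall (M : fo_structure L) (r : nat -> M), fo_holds r phi <-> fo_holds r psi) ->
  Tr rho phi <-> Tr rho psi.
Proof. by move=> H; split; apply: tr_entail => M r /H. Qed.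

Lemma tr_conj (I : eqType) rho (s : seq I) (F : I -> fo_formula L) :
  (forall i, i \in s -> Tr rho (F i)) -> Tr rho (fo_conj (map F s)).
Proof.
elim: s => [|i s IH] H /=.
  by apply: (tr_valid TS) => M r; apply: fo_holds_top.
apply/(tr_and TS); split; first by apply: H; rewrite inE eqxx.
by apply: IH => j js; apply: H; rewrite inE js orbT.
Qed.

Lemma tr_equiv_under (I : finType) rho (t u : I -> fo_term L) phi psi :
  (forall k, Tr rho (FEq (t k) (u k))) ->
  (forall (M : fo_structure L) (r : nat -> M),
    (forall k, fo_teval r (t k) = fo_teval r (u k)) -> fo_holds r phi <-> fo_holds r psi) ->
  Tr rho phi <-> Tr rho psi.
Proof.
move=> tu H; have teqs : Tr rho (fo_conj [seq FEq (t k) (u k) | k <- enum I]).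
  by apply: tr_conj.
have eqs (M : fo_structure L) (r : nat -> M) : fo_holds r (fo_conj [seq FEq (t k) (u k) | k <- enum I]) ->
    forall k, fo_teval r (t k) = fo_teval r (u k).
  move=> /(@fo_holds_conj L _ M r (enum I) (fun k => FEq (t k) (u k))) h k.
  by apply: h; rewrite mem_enum.
by split=> tp; have /(tr_and TS) := conj teqs tp; apply: tr_entail => M r [/eqs/H h] /h.
Qed.

Lemma tr_ren_eq rho sg phi :
  (forall i, i \in fo_fv phi -> Tr rho (FEq (FVar i) (FVar (sg i)))) ->
  Tr rho phi <-> Tr rho (fo_ren sg phi).
Proof.
move=> H; apply: (@tr_equiv_under (seq_sub (fo_fv phi)) rho (fun i => FVar (val i))
  (fun i => FVar (sg (val i)))) => [[i ip]|M r e]; first exact: H.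
rewrite fo_holds_ren; apply: fo_holds_local => i ip /=.
exact: (e (SeqSub ip)).
Qed.

(** No clause of a truth system speaks of renaming. But variables that carry the same name are
    equal, and truth passes along equations; moving both sides to the one assignment [rho'] by fresh
    variables leaves a logical equivalence. *)
Lemma tr_ren rho sg phi : Tr rho (fo_ren sg phi) <-> Tr (rho \o sg) phi.
Proof.
set N := maxn (fo_bound phi) (fo_bound (fo_ren sg phi)).
(* The assignment [r] shows the old variables below [N] and their fresh copies from [N] on at the
   same time, with equal names. *)
have step psi tau rho1 rho2 : (fo_bound psi <= N)%N ->
    (forall i, i \in fo_fv psi -> rho2 (N + tau i)%N = rho1 i) ->
    Tr rho1 psi <-> Tr rho2 (fo_ren (fun i => N + tau i)%N psi).
  move=> bN e; pose r i := if (i < N)%N then rho1 i else rho2 i.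
  rewrite (@tr_localE rho1 r); last first.
    by move=> i /fo_boundP ib; rewrite /r (leq_trans ib bN).
  rewrite (@tr_localE rho2 r); last first.
    by move=> i /fo_fv_ren[j _ ->]; rewrite /r ltnNge leq_addr.
  apply: tr_ren_eq => i ip; apply: (tr_eq TS).
  by rewrite /r [in RHS]ltnNge leq_addr/= e// (leq_trans (fo_boundP ip) bN).
pose rho' j := rho (j - N)%N.
rewrite (step _ id rho rho') ?leq_maxr//; last first.
  by move=> i _; rewrite /rho' addKn.
rewrite (step phi sg (rho \o sg) rho') ?leq_maxl//; last first.
  by move=> i _; rewrite /rho' addKn.
by apply: tr_equiv => M r; rewrite !fo_holds_ren.
Qed.

Definition tr_eqv (a b : K) :=
  Tr (fun i => if i == 0%N then a else b) (FEq (FVar 0) (FVar 1)).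

Lemma tr_eqvE rho i j : Tr rho (FEq (FVar i) (FVar j)) <-> tr_eqv (rho i) (rho j).
Proof.
have := tr_ren rho (fun k => if k == 0%N then i else j) (FEq (FVar 0) (FVar 1)).
move=> /= ->; rewrite /tr_eqv.
suff -> : rho \o (fun k => if k == 0 then i else j) =
  (fun i0 => if i0 == 0%N then rho i else rho j) by [].
by apply: funext => k /=; case: ifP.
Qed.

Lemma tr_eqv_refl a : tr_eqv a a.
Proof. exact: (tr_eq TS). Qed.

Lemma tr_eqv_sym a b : tr_eqv a b -> tr_eqv b a.
Proof.
pose r i := if i == 0%N then a else b.
by move=> /(tr_eqvE r 0 1) H; apply/(tr_eqvE r 1 0); apply: tr_entail H => M q /= ->.
Qed.

Lemma tr_eqv_trans b a c : tr_eqv a b -> tr_eqv b c -> tr_eqv a c.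
Proof.
pose r i := if i == 0%N then a else if i == 1%N then b else c.
move=> /(tr_eqvE r 0 1) H /(tr_eqvE r 1 2) H'; apply/(tr_eqvE r 0 2).
have /(tr_and TS) := conj H H'.
by apply: tr_entail => M q /= [-> ->].
Qed.

(** Both assignments are put into one, the second above [N]; there a renaming along true equations
    leads from one to the other. *)
Lemma tr_cong rho rho' phi :
  (forall i, i \in fo_fv phi -> tr_eqv (rho i) (rho' i)) -> Tr rho phi -> Tr rho' phi.
Proof.
move=> e tphi; pose N := fo_bound phi.
pose r i := if (i < N)%N then rho i else rho' (i - N)%N.
have : Tr r phi by apply: (tr_local TS) tphi => i /fo_boundP iN; rewrite /r iN.
move=> /(@tr_ren_eq r (addn N) phi) H.
have /H/tr_ren : forall i, i \in fo_fv phi -> Tr r (FEq (FVar i) (FVar (N + i)%N)).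
  move=> i ip; apply/tr_eqvE.
  by rewrite /r fo_boundP// ltnNge leq_addr/= addKn; apply: e.
by apply: (tr_local TS) => i _ /=; rewrite /r ltnNge leq_addr addKn.
Qed.

Hypothesis tr_ex : forall rho i phi,
  Tr rho (FEx i phi) -> exists a, Tr [eta rho with i |-> a] phi.

Lemma tr_exE rho i phi : Tr rho (FEx i phi) <-> exists a, Tr [eta rho with i |-> a] phi.
Proof.
split=> [/tr_ex//|[a H]].
have : Tr [eta rho with i |-> a] (FEx i phi).
  apply: tr_entail H => M r H; exists (r i).
  by apply/(fo_holds_local _).1: H => j _ /=; case: eqP => // ->.
apply: (tr_local TS) => j /=; rewrite mem_undup/= mem_filter => /andP[ji _].
by rewrite (negbTE ji).
Qed.

Hypothesis k0 : K.

(** A choice that depends on the set alone: equivalent names have equal classes, hence equal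
    representatives, and the quotient is the subtype of representatives. *)
Definition tr_pick (P : set K) : K :=
  if pselect (exists x, P x) is left h then projT1 (cid h) else k0.

Definition tr_rep a := tr_pick (tr_eqv a).

Lemma tr_rep_eqv a : tr_eqv a (tr_rep a).
Proof.
rewrite /tr_rep /tr_pick; case: pselect => [h|[]]; first by case: (cid h).
by exists a; apply: tr_eqv_refl.
Qed.

Lemma tr_repE a b : tr_eqv a b -> tr_rep a = tr_rep b.
Proof.
move=> ab; rewrite /tr_rep; congr tr_pick; apply/seteqP; split=> c.
  exact/tr_eqv_trans/tr_eqv_sym.
exact: tr_eqv_trans.
Qed.

Definition tr_car := {a : K | `[< tr_rep a = a >]}.

Lemma tr_clsP a : `[< tr_rep (tr_rep a) = tr_rep a >].
Proof. by apply/asboolP; apply/esym/tr_repE/tr_rep_eqv. Qed.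

Definition tr_cls a : tr_car := exist _ (tr_rep a) (tr_clsP a).

Lemma tr_clsE a b : tr_cls a = tr_cls b <-> tr_eqv a b.
Proof.
split=> [/(congr1 val)/= e|/tr_repE e]; last exact: val_inj.
apply: (tr_eqv_trans (tr_rep_eqv a)); rewrite e.
exact/tr_eqv_sym/tr_rep_eqv.
Qed.

Lemma tr_cls_val (x : tr_car) : tr_cls (val x) = x.
Proof. by apply: val_inj => /=; apply/asboolP; exact: (valP x). Qed.

(** Made for [tr_graph], where variable [n] holds the value of the function at the variables below
    [n]. *)
Definition tr_asg n (y : 'I_n -> K) (c : K) (i : nat) : K :=
  if insub i is Some k then y k else c.

Lemma tr_asg_ord n (y : 'I_n -> K) c (k : 'I_n) : tr_asg y c k = y k.
Proof. by rewrite /tr_asg valK. Qed.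

Lemma tr_asg_out n (y : 'I_n -> K) c : tr_asg y c n = c.
Proof. by rewrite /tr_asg insubF ?ltnn. Qed.

Definition tr_graph (f : fo_fun L) : fo_formula L :=
  FEq (FVar (fo_far f)) (FApp (fun k : 'I_(fo_far f) => FVar k)).

Definition tr_fint (f : fo_fun L) (x : 'I_(fo_far f) -> tr_car) : tr_car :=
  tr_cls (tr_pick (fun c => Tr (tr_asg (val \o x) c) (tr_graph f))).

Definition tr_rint (p : fo_rel L) (x : 'I_(fo_rar p) -> tr_car) : Prop :=
  Tr (tr_asg (val \o x) k0) (FRel (fun k : 'I_(fo_rar p) => FVar k)).

Definition tr_struct : fo_structure L :=
  @FOStructure L tr_car (inhabits (tr_cls k0)) tr_fint tr_rint.

Lemma tr_asg_cong n (y y' : 'I_n -> K) c c' i :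
  (forall k, tr_eqv (y k) (y' k)) -> tr_eqv c c' ->
  tr_eqv (tr_asg y c i) (tr_asg y' c' i).
Proof.
by move=> ey ec; rewrite /tr_asg; case: insubP.
Qed.

(** Variable [n.+1] is free to hold the second value; one assignment then satisfies both equations,
    which entail that the values are equal. *)
Lemma tr_graph_eq f (y : 'I_(fo_far f) -> K) c d :
  Tr (tr_asg y c) (tr_graph f) -> Tr (tr_asg y d) (tr_graph f) -> tr_eqv c d.
Proof.
move=> H H'; set n := fo_far f in y H H' *.
pose r := [eta tr_asg y c with n.+1 |-> d].
have {H} H : Tr r (tr_graph f).
  apply: (tr_local TS) H => i; rewrite mem_undup /r /= inE => /orP[/eqP->|].
    by rewrite ltn_eqF.
  move=> /flatten_mapP[k _]; rewrite inE => /eqP->.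
  by rewrite ltn_eqF// ltnS ltnW.
pose sg i := if i == n then n.+1 else i.
have : Tr (r \o sg) (tr_graph f).
  apply: (tr_local TS) H' => i; rewrite mem_undup /r /sg /= inE => /orP[/eqP->|].
    by rewrite !eqxx tr_asg_out.
  move=> /flatten_mapP[k _]; rewrite inE => /eqP->.
  by rewrite (@ltn_eqF k n)// (@ltn_eqF k n.+1) ?ltnS 1?ltnW// !tr_asg_ord.
move=> /tr_ren {}H'; have : Tr r (FEq (FVar n) (FVar n.+1)).
  have /(tr_and TS) := conj H H'.
  apply: tr_entail => M q [/= -> +].
  rewrite /= /sg eqxx => ->; congr fo_fint.
  by apply: funext => k /=; rewrite ltn_eqF.
by move=> /tr_eqvE; rewrite /r /= eqxx ltn_eqF// tr_asg_out.
Qed.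

Lemma tr_fintP f (y : 'I_(fo_far f) -> K) d :
  Tr (tr_asg y d) (tr_graph f) <-> tr_cls d = tr_fint (tr_cls \o y).
Proof.
set x := tr_cls \o y; set P := fun c => Tr (tr_asg (val \o x) c) (tr_graph f).
have xy k : tr_eqv (y k) ((val \o x) k) by apply: tr_rep_eqv.
have PP : P (tr_pick P).
  rewrite /tr_pick; case: pselect => [h|[]]; first by case: (cid h).
  have : Tr (tr_asg (val \o x) k0) (FEx (fo_far f) (tr_graph f)).
    apply: (tr_valid TS) => M r; exists (fo_fint (fun k : 'I_(fo_far f) => r k)) => /=.
    rewrite eqxx; congr fo_fint; apply: funext => k /=.
    by rewrite ltn_eqF.
  move=> /tr_ex[a H]; exists a; apply: (tr_local TS) H => i.
  rewrite mem_undup /= inE => /orP[/eqP->|].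
    by rewrite eqxx tr_asg_out.
  move=> /flatten_mapP[k _]; rewrite inE => /eqP->.
  by rewrite ltn_eqF//= !tr_asg_ord.
rewrite -/(tr_cls _) /tr_fint -/P tr_clsE; split=> [H|e].
  apply: tr_graph_eq PP => /=; apply: tr_cong H => i _.
  by apply: tr_asg_cong; [exact: xy|exact: tr_eqv_refl].
apply: tr_cong PP => i _; apply: tr_asg_cong (tr_eqv_sym e).
by move=> k; apply/tr_eqv_sym/xy.
Qed.

(** Induction on [t]. Names for the values of the arguments are stored in fresh variables from [N]
    on, where the induction hypothesis gives the equations with the arguments; rewriting along them
    leaves the graph of [f]. *)
Lemma tr_termP t rho j : j \notin fo_term_vars t ->
  Tr rho (FEq (FVar j) t) <->
  tr_cls (rho j) = @fo_teval L tr_struct (tr_cls \o rho) t.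
Proof.
elim: t rho j => [i|f a IH] rho j jt.
  by rewrite tr_clsE tr_eqvE.
have [y yE] : exists y : 'I_(fo_far f) -> K,
    forall k, tr_cls (y k) = @fo_teval L tr_struct (tr_cls \o rho) (a k).
  by exists (fun k => val (@fo_teval L tr_struct (tr_cls \o rho) (a k))) => k;
     rewrite tr_cls_val.
have {}jt k : j \notin fo_term_vars (a k).
  by apply: contra jt => /=; apply: mem_flatten_enum.
pose N := maxn j.+1 (fo_bound (FEq (FVar j) (FApp a))).
pose n := fo_far f; have Nj : (j < N)%N by rewrite leq_max ltnSn.
have Na k i : i \in fo_term_vars (a k) -> (i < N)%N.
  move=> ik; rewrite leq_max; apply/orP; right; apply: fo_boundP.
  by rewrite mem_undup /= inE (mem_flatten_enum ik) orbT.
pose r i := if (i < N)%N then rho i else tr_asg y k0 (i - N)%N.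
have ra (k : 'I_n) : Tr r (FEq (FVar (N + k)%N) (a k)).
  apply/IH; first by apply/negP => /Na; rewrite ltnNge leq_addr.
  rewrite {1}/r ltnNge leq_addr/= addKn tr_asg_ord yE.
  by apply: (@fo_teval_local L tr_struct) => i /Na iN /=; rewrite /r iN.
have -> : Tr rho (FEq (FVar j) (FApp a)) <-> Tr r (FEq (FVar j) (FApp a)).
  apply: tr_localE => i /fo_boundP iN; rewrite /r ifT//.
  by rewrite leq_max iN orbT.
pose sg i := if (i < n)%N then (N + i)%N else j.
have -> : Tr r (FEq (FVar j) (FApp a)) <-> Tr r (fo_ren sg (tr_graph f)).
  apply: tr_equiv_under ra _ => M q e /=; rewrite /sg ltnn.
  suff -> : (fun k => fo_teval q (a k)) =
      (fun k : 'I_n => q (if (k < n)%N then N + k else j)%N) by [].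
  by apply: funext => k; rewrite ltn_ord -e.
rewrite tr_ren /=.
have -> : (fun k : 'I_(fo_far f) => fo_teval (M:=tr_struct) (tr_cls \o rho) (a k)) = tr_cls \o y.
  by apply: funext => k /=; rewrite yE.
rewrite -tr_fintP; apply: tr_localE => i; rewrite mem_undup /= inE => /orP[/eqP->|].
  by rewrite /sg ltnn /r Nj tr_asg_out.
move=> /flatten_mapP[k _]; rewrite inE => /eqP->.
by rewrite /sg ltn_ord /r ltnNge leq_addr/= addKn !tr_asg_ord.
Qed.

(** The truth lemma of the Henkin construction. Compound terms in atoms are flattened: fresh
    variables hold names of their values, identified by [tr_termP]. *)
Lemma tr_structP rho phi :
  @fo_holds L tr_struct (tr_cls \o rho) phi <-> Tr rho phi.
Proof.
elim: phi rho => [t u|p a|phi IH|phi IH psi IH'|phi IH psi IH'|i phi IH] rho.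
- pose j := fo_bound (FEq t u).
  have jt v : v = t \/ v = u -> j \notin fo_term_vars v.
    move=> vE; apply/negP => jv; have : j \in fo_fv (FEq t u).
      by rewrite mem_undup /= mem_cat; case: vE jv => <- ->; rewrite ?orbT.
    by move=> /fo_boundP; rewrite ltnn.
  pose x := val (@fo_teval L tr_struct (tr_cls \o rho) t).
  pose r := [eta rho with j |-> x].
  have rE v : v = t \/ v = u ->
      @fo_teval L tr_struct (tr_cls \o rho) v = @fo_teval L tr_struct (tr_cls \o r) v.
    move=> /jt jv; apply: (@fo_teval_local L tr_struct) => i iv /=; rewrite /r /=.
    by case: eqP iv jv => // -> ->.
  have Ht : Tr r (FEq (FVar j) t).
    apply/tr_termP; first by apply: jt; left.
    by rewrite -rE; [rewrite /r /= eqxx tr_cls_val|left].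
  have -> : Tr rho (FEq t u) <-> Tr r (FEq t u).
    apply: tr_localE => i ip; rewrite /r /=; case: eqP => // ij.
    by have := fo_boundP ip; rewrite ij ltnn.
  have -> : Tr r (FEq t u) <-> Tr r (FEq (FVar j) u).
    split=> H; have /(tr_and TS) := conj Ht H; apply: tr_entail => M q /= [].
      by move=> -> ->.
    by move=> <- ->.
  rewrite tr_termP; last by apply: jt; right.
  rewrite /= !rE; [|by right|by left].
  move: Ht; rewrite tr_termP; last by apply: jt; left.
  by move=> ->.
- pose n := fo_rar p; pose y k := val (@fo_teval L tr_struct (tr_cls \o rho) (a k)).
  pose N := fo_bound (FRel a).
  have Na k i : i \in fo_term_vars (a k) -> (i < N)%N.
    move=> ik; apply: fo_boundP.
    by rewrite mem_undup /= (mem_flatten_enum ik).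
  pose r i := if (i < N)%N then rho i else tr_asg y k0 (i - N)%N.
  have ra (k : 'I_n) : Tr r (FEq (FVar (N + k)%N) (a k)).
    apply/tr_termP; first by apply/negP => /Na; rewrite ltnNge leq_addr.
    rewrite {1}/r ltnNge leq_addr/= addKn tr_asg_ord tr_cls_val.
    by apply: (@fo_teval_local L tr_struct) => i /Na iN /=; rewrite /r iN.
  have -> : Tr rho (FRel a) <-> Tr r (FRel a).
    by apply: tr_localE => i /fo_boundP iN; rewrite /r ifT.
  have -> : Tr r (FRel a) <-> Tr r (fo_ren (addn N) (FRel (fun k : 'I_(fo_rar p) => FVar k))).
    apply: tr_equiv_under ra _ => M q e /=.
    suff -> : (fun k => fo_teval q (a k)) = (fun k : 'I_n => q (N + k)%N) by [].
    by apply: funext => k; rewrite -e.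
  rewrite tr_ren /= /tr_rint; apply: tr_localE => i; rewrite mem_undup.
  move=> /flatten_mapP[k _]; rewrite inE => /eqP->.
  by rewrite /r /= ltnNge leq_addr/= addKn !tr_asg_ord.
- by rewrite /= IH (tr_not TS).
- by rewrite /= IH IH' (tr_or TS).
- by rewrite /= IH IH' (tr_and TS).
- have updE a : tr_cls \o [eta rho with i |-> a] = [eta tr_cls \o rho with i |-> tr_cls a].
    by apply: funext => j /=; case: ifP.
  rewrite tr_exE /=; split=> -[a].
    by rewrite -(tr_cls_val a) -updE => /IH; exists (val a).
  by move=> /IH; rewrite updE; exists (tr_cls a).
Qed.

End TruthSystem.

Lemma truth_system_realized (L : fo_signature) (K : Type)
    (Tr : (nat -> K) -> fo_formula L -> Prop) :
  inhabited K -> truth_system Tr ->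
  (forall rho i phi, Tr rho (FEx i phi) -> exists a, Tr [eta rho with i |-> a] phi) ->
  exists (M : fo_structure L) (c : K -> M),
    (forall x, exists a, c a = x) /\
    forall rho phi, fo_holds (c \o rho) phi <-> Tr rho phi.
Proof.
move=> [k0] TS ex; exists (tr_struct TS k0), (@tr_cls L K Tr TS k0); split.
  by move=> x; exists (val x); apply: tr_cls_val.
by move=> rho phi; apply: (tr_structP TS ex).
Qed.

(** * Countability, universal closures and back-and-forth *)

Lemma countable_surj (X : Type) : inhabited X -> countable [set: X] ->
  exists e : nat -> X, forall x, exists n, e n = x.
Proof.
move=> [x0] /countable_injP[f finj].
pose e n := if pselect (exists x, f x = n) is left h then projT1 (cid h) else x0.
exists e => x; exists (f x); rewrite /e; case: pselect => [h|[]]; last by exists x.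
by case: (cid h) => y /= /finj ->//; rewrite inE.
Qed.

Lemma surj_countable (K : countType) (X : Type) (c : K -> X) :
  (forall x, exists a, c a = x) -> countable [set: X].
Proof.
move=> /choice[g gK]; apply/countable_injP; exists (pickle \o g) => x y _ _ /=.
by move=> /(pcan_inj pickleK) /(congr1 c); rewrite !gK.
Qed.

Lemma surj_lift (I X Y : Type) (c : X -> Y) (r : I -> Y) :
  (forall y, exists x, c x = y) -> exists r', r = c \o r'.
Proof.
by move=> cs; have [r' r'E] := choice (fun i => cs (r i)); exists r'; apply: funext => i /=.
Qed.

Section Countability.
Variables (L : fo_signature) (cf : fo_fun L -> nat) (cr : fo_rel L -> nat).
Hypotheses (cf_inj : injective cf) (cr_inj : injective cr).

Fixpoint fo_tcode (t : fo_term L) : GenTree.tree nat :=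
  match t with
  | FVar i => GenTree.Leaf i
  | FApp f a => GenTree.Node (cf f) [seq fo_tcode (a k) | k <- enum 'I_ _]
  end.

Lemma fo_tcode_inj : injective fo_tcode.
Proof.
elim=> [i|f a IH] [j|g b] //=; first by move=> [->].
case=> /cf_inj fg; case: _ / fg b => b /eq_in_map ab; congr FApp.
by apply: funext => k; apply/IH/ab; rewrite mem_enum.
Qed.

Fixpoint fo_code (phi : fo_formula L) : GenTree.tree nat :=
  match phi with
  | FEq t u => GenTree.Node 0 [:: fo_tcode t; fo_tcode u]
  | FRel r a => GenTree.Node (5 + cr r) [seq fo_tcode (a k) | k <- enum 'I_ _]
  | FNot phi => GenTree.Node 1 [:: fo_code phi]
  | FOr phi psi => GenTree.Node 2 [:: fo_code phi; fo_code psi]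
  | FAnd phi psi => GenTree.Node 3 [:: fo_code phi; fo_code psi]
  | FEx i phi => GenTree.Node 4 [:: GenTree.Leaf i; fo_code phi]
  end.

Lemma fo_code_inj : injective fo_code.
Proof.
elim=> [t u|r a|phi IH|phi IH psi IH'|phi IH psi IH'|i phi IH]
  [t' u'|r' a'|phi'|phi' psi'|phi' psi'|i' phi'] //=.
- by move=> [/fo_tcode_inj -> /fo_tcode_inj ->].
- case=> /cr_inj rr; case: _ / rr a' => a' /eq_in_map aa; congr FRel.
  by apply: funext => k; apply/fo_tcode_inj/aa; rewrite mem_enum.
- by move=> [/IH ->].
- by move=> [/IH -> /IH' ->].
- by move=> [/IH -> /IH' ->].
- by move=> [-> /IH ->].
Qed.

End Countability.

Lemma fo_formula_enum (L : fo_signature) : fo_countable L ->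
  exists e : nat -> fo_formula L, forall phi, exists n, e n = phi.
Proof.
move=> [/countable_injP[cf cfi] /countable_injP[cr cri]].
have ci : injective cf by move=> x y; apply: cfi; rewrite inE.
have ri : injective cr by move=> x y; apply: cri; rewrite inE.
apply: countable_surj; first exact: inhabits (fo_top L).
apply/countable_injP; exists (pickle \o fo_code cf cr) => x y _ _ /=.
by move=> /(pcan_inj pickleK) /(fo_code_inj ci ri).
Qed.

Section Closure.
Variable L : fo_signature.
Implicit Types (phi : fo_formula L) (M N : fo_structure L) (T : fo_theory L).

Definition fo_alls vs phi := foldr (@fo_all L) phi vs.

Lemma fo_alls_occ vs phi :
  fo_free_occ (fo_alls vs phi) = [seq v <- fo_free_occ phi | v \notin vs].
Proof.
elim: vs => [|i vs IH] /=; first by rewrite filter_predT.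
by rewrite IH -filter_predI; apply: eq_filter => v; rewrite /= in_cons negb_or.
Qed.

Lemma fo_closeP phi : fo_fv (fo_alls (fo_fv phi) phi) == [::].
Proof.
rewrite /fo_fv fo_alls_occ; suff -> : [seq v <- fo_free_occ phi | v \notin undup (fo_free_occ phi)] = [::] by [].
apply/eqP; rewrite -size_eq0 size_filter -leqn0 leqNgt -has_count.
by apply/hasPn => v /=; rewrite mem_undup => ->.
Qed.

Definition fo_close phi : fo_sentence L :=
  exist (fun psi => fo_fv psi == [::]) _ (fo_closeP phi).

Lemma fo_true_all M i phi : fo_true M (fo_all i phi) <-> fo_true M phi.
Proof.
split=> H rho; last by apply/fo_holds_all => a; apply: H.
have /fo_holds_all/(_ (rho i)) := H rho.
by apply/(fo_holds_local _).1 => j _ /=; case: eqP => // ->.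
Qed.

Lemma fo_true_close M phi : fo_true M (sval (fo_close phi)) <-> fo_true M phi.
Proof.
by rewrite /=; elim: (fo_fv phi) => [//|i vs IH] /=; rewrite fo_true_all.
Qed.

Lemma fo_complete_true T M N phi : fo_complete T -> fo_model T M -> fo_model T N ->
  fo_true M phi -> fo_true N phi.
Proof.
move=> [_ /(_ (fo_close phi)) H] TM TN Mphi; apply/fo_true_close.
case: H => [/(_ N TN)//|/(_ M TM)]; have /fo_true_close Mc := Mphi.
have [x] := fo_inh M; move=> /(_ (fun=> x)) /= H; exfalso; apply: H; exact: Mc.
Qed.

(** Left open on purpose: [fo_true] quantifies over the variables below [n], so its truth means that
    no [n] elements exhaust the structure. *)
Definition fo_more_than n : fo_formula L :=
  FEx n (fo_conj [seq FNot (FEq (FVar n) (FVar i)) | i <- iota 0 n]).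

Lemma fo_infiniteP M :
  infinite_set [set: M] <-> forall n, fo_true M (fo_more_than n).
Proof.
have moreP n (rho : nat -> M) : fo_holds rho (fo_more_than n) <->
    exists a, forall i, (i < n)%N -> a <> rho i.
  rewrite /fo_more_than; split=> -[a].
    move=> /(@fo_holds_conj L _ M [eta rho with n |-> a] (iota 0 n)
      (fun i => FNot (FEq (FVar n) (FVar i)))) H; exists a => i ilt.
    have := H i; rewrite mem_iota/= add0n => /(_ ilt).
    by rewrite eqxx ltn_eqF.
  move=> H; exists a.
  apply/(@fo_holds_conj L _ M [eta rho with n |-> a] (iota 0 n)
      (fun i => FNot (FEq (FVar n) (FVar i)))) => i.
  by rewrite mem_iota/= add0n eqxx => ilt; rewrite ltn_eqF//; apply: H.
split=> [Minf n rho|H fin].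
  apply/moreP; apply: contrapT => H; apply: Minf.
  apply: (@sub_finite_set _ _ [set rho i | i in `I_n]); last exact/finite_image/finite_II.
  move=> a _ /=; apply: contrapT => na; apply: H; exists a => i ilt ai.
  by apply: na; exists i.
have [x0] := fo_inh M.
have /finite_setP[n /card_set_bijP[f [/= fn finj _]]] := fin.
pose g i := if pselect (exists x, f x = i) is left h then projT1 (cid h) else x0.
have gK x : g (f x) = x.
  rewrite /g; case: pselect => [h|[]]; last by exists x.
  by case: (cid h) => y /= /finj; apply; rewrite inE.
have /moreP[a na] := H n g; apply: (na (f a)) => //.
exact: (fn a).
Qed.

End Closure.

(** Even stages serve [eX], odd stages serve [eY], and stage [n] fixes the values at [n] for good.
    Total functions stand for finite tuples, which is why [P n] may depend only on the values below
    [n]. *)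
Lemma back_and_forth (X Y : Type) (eX : nat -> X) (eY : nat -> Y)
    (P : nat -> (nat -> X) -> (nat -> Y) -> Prop) :
  (forall n a b a' b', (forall i, (i < n)%N -> a i = a' i /\ b i = b' i) ->
     P n a b -> P n a' b') ->
  P 0 (fun=> eX 0%N) (fun=> eY 0%N) ->
  (forall n a b x, P n a b ->
     exists y, P n.+1 [eta a with n |-> x] [eta b with n |-> y]) ->
  (forall n a b y, P n a b ->
     exists x, P n.+1 [eta a with n |-> x] [eta b with n |-> y]) ->
  exists (a : nat -> X) (b : nat -> Y),
    [/\ forall n, P n a b, forall m, exists n, a n = eX m
      & forall m, exists n, b n = eY m].
Proof.
move=> Ploc P0 forth back.
pose S n := {ab : (nat -> X) * (nat -> Y) | P n ab.1 ab.2}.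
pose upd (Z : Type) (c : nat -> Z) n z : nat -> Z := [eta c with n |-> z].
have step n (s : S n) : {s' : S n.+1 |
    (forall i, (i < n)%N -> (sval s).1 i = (sval s').1 i /\ (sval s).2 i = (sval s').2 i) /\
    (if odd n then (sval s').2 n = eY n./2 else (sval s').1 n = eX n./2)}.
  apply: cid; case: s => -[a b] /= Pab; case: (odd n).
    have [x Px] := back n a b (eY n./2) Pab.
    exists (exist _ (upd _ a n x, upd _ b n (eY n./2)) Px); rewrite /upd /=.
    by rewrite eqxx; split=> // i ilt; rewrite ltn_eqF.
  have [y Py] := forth n a b (eX n./2) Pab.
  exists (exist _ (upd _ a n (eX n./2), upd _ b n y) Py); rewrite /upd /=.
  by rewrite eqxx; split=> // i ilt; rewrite ltn_eqF.
pose s0 : S 0%N := exist _ (fun=> eX 0%N, fun=> eY 0%N) P0.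
pose st := fix st n : S n := if n is m.+1 then sval (step m (st m)) else s0.
have stE n i : (i < n)%N ->
    (sval (st i.+1)).1 i = (sval (st n)).1 i /\ (sval (st i.+1)).2 i = (sval (st n)).2 i.
  elim: n => // n IH; rewrite ltnS leq_eqVlt => /orP[/eqP<-//|ilt].
  have [/(_ i ilt) [e1 e2] _] := svalP (step n (st n)).
  by have [-> ->] := IH ilt.
exists (fun i => (sval (st i.+1)).1 i), (fun i => (sval (st i.+1)).2 i); split.
- move=> n; apply: Ploc (svalP (st n)) => i /stE[-> ->] //.
- move=> m; exists m.*2; have [_ +] := svalP (step m.*2 (st m.*2)).
  rewrite -[sval (step _ _)]/(st m.*2.+1); move: (st m.*2.+1) => x.
  by rewrite odd_double doubleK.
- move=> m; exists m.*2.+1; have [_ +] := svalP (step m.*2.+1 (st m.*2.+1)).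
  rewrite -[sval (step _ _)]/(st m.*2.+2); move: (st m.*2.+2) => x.
  by rewrite /= odd_double /= uphalf_double.
Qed.

(** * Isomorphisms, Skolem hulls and ultrapowers *)

Section Isomorphism.
Variable L : fo_signature.
Implicit Types (M N : fo_structure L) (phi : fo_formula L).

(** Atomic formulas suffice: equations between variables make the map from [a i] to [b i] well
    defined and injective, the other atoms make it preserve the symbols. *)
Lemma fo_iso_of_sequences M N (a : nat -> M) (b : nat -> N) :
  (forall x, exists n, a n = x) -> (forall y, exists n, b n = y) ->
  (forall phi, fo_holds a phi <-> fo_holds b phi) -> fo_iso M N.
Proof.
move=> /choice[g gK] /choice[g' gK'] ab.
have eqE i j : a i = a j <-> b i = b j := ab (FEq (FVar i) (FVar j)).
have hE i : b (g (a i)) = b i by apply/eqE; rewrite gK.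
exists (b \o g); split.
- by exists (a \o g') => [x|y] /=; [rewrite -[RHS]gK; apply/eqE; rewrite gK'|rewrite hE gK'].
- move=> f x.
  have := ab (FEq (FVar (g (fo_fint x))) (FApp (fun k => FVar (g (x k))))).
  move=> /= [+ _]; apply; rewrite gK; congr fo_fint.
  by apply: funext => k; rewrite gK.
- move=> r x; have := ab (FRel (fun k => FVar (g (x k)))) => /=.
  suff -> : (fun k => a (g (x k))) = x by [].
  by apply: funext => k; rewrite gK.
Qed.

Lemma fo_iso_holds M N (h : M -> N) :
  bijective h ->
  (forall (f : fo_fun L) (x : 'I_(fo_far f) -> M), h (fo_fint x) = @fo_fint L N f (h \o x)) ->
  (forall (r : fo_rel L) (x : 'I_(fo_rar r) -> M), fo_rint x <-> @fo_rint L N r (h \o x)) ->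
  forall (rho : nat -> M) phi, fo_holds rho phi <-> fo_holds (h \o rho) phi.
Proof.
move=> hbij hf hr rho phi; have [g gK hK] := hbij.
have te r t : h (fo_teval r t) = fo_teval (h \o r) t.
  elim: t => [//|f a IH] /=; rewrite hf; congr fo_fint.
  by apply: funext => k /=.
elim: phi rho => [t u|p a|phi IH|phi IH psi IH'|phi IH psi IH'|i phi IH] r /=.
- by rewrite -!te; split=> [->//|/(can_inj gK)].
- rewrite hr; suff -> : h \o (fun k => fo_teval r (a k)) = (fun k => fo_teval (h \o r) (a k)) by [].
  by apply: funext => k /=; rewrite te.
- by rewrite IH.
- by rewrite IH IH'.
- by rewrite IH IH'.
- have E x : h \o [eta r with i |-> x] = [eta h \o r with i |-> h x].
    by apply: funext => j /=; case: ifP.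
  split=> -[x]; first by move=> /IH; rewrite E; exists (h x).
  by rewrite -(hK x) -E => /IH; exists (g x).
Qed.

(** The Skolem hull of [S] stays a set [K] of names with two readings, [g] in [M] and [c] in the
    quotient [N]. Since both readings satisfy the same formulas, [N] is an elementary substructure
    of [M] up to isomorphism, and assignments travel between the two through names. *)
Lemma lowenheim_skolem M (S : nat -> M) : fo_countable L ->
  exists (N : fo_structure L) (K : countType) (g : K -> M) (c : K -> N),
    [/\ forall x, exists k, c k = x, forall n, exists k, g k = S n
      & forall rho phi, fo_holds (c \o rho) phi <-> fo_holds (g \o rho) phi].
Proof.
move=> /fo_formula_enum[e eP].
pose wit (i : nat) (phi : fo_formula L) (l : seq M) : M :=
  let r := nth (S 0%N) l in
  if pselect (exists a, fo_holds [eta r with i |-> a] phi) is left h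
  then projT1 (cid h) else S 0%N.
(* Terms of the Skolem hull: a node carries the code of [(i, phi)], its children the parameters. *)
pose K := GenTree.tree nat.
pose g := fix g (x : K) : M :=
  match x with
  | GenTree.Leaf n => S n
  | GenTree.Node m l =>
      if @unpickle (nat * nat)%type m is Some (i, k) then wit i (e k) (map g l) else S 0%N
  end.
pose Tr (rho : nat -> K) phi := fo_holds (g \o rho) phi.
have TS : truth_system Tr.
  split=> //; first by move=> rho phi; apply.
  - by move=> rho rho' phi E; apply/(fo_holds_local _).1 => i ip /=; rewrite E.
  - by move=> rho i j; rewrite /Tr /= => ->.
have ex rho i phi : Tr rho (FEx i phi) -> exists a, Tr [eta rho with i |-> a] phi.
  move=> [a Ha]; have [k ek] := eP phi.
  pose l := [seq rho j | j <- iota 0 (fo_bound phi)].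
  exists (GenTree.Node (pickle (i, k)) l); rewrite /Tr.
  set r := nth (S 0%N) (map g l).
  have re j : j \in fo_fv phi -> r j = g (rho j).
    move=> jp; rewrite /r /l -map_comp (nth_map 0%N) ?size_iota ?fo_boundP//.
    by rewrite nth_iota ?fo_boundP.
  have : fo_holds [eta r with i |-> g (GenTree.Node (pickle (i, k)) l)] phi.
    rewrite /= pickleK ek /wit; case: pselect => [h|[]]; first by case: (cid h).
    exists a; apply/(fo_holds_local _).1: Ha => j jp.
    by move: (re j jp) => /=; case: (j == i) => // ->.
  by apply/(fo_holds_local _).1 => j jp; move: (re j jp) => /=; case: (j == i) => // ->.
have [N [c [cs cP]]] := truth_system_realized (inhabits (GenTree.Leaf 0%N)) TS ex.
exists N, K, g, c; split=> // n.
by exists (GenTree.Leaf n).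
Qed.

(** The ultrafilter contains all tails, so the class of the sequence of tuples satisfies whatever
    [rho n] satisfies eventually. This is the compactness that bounds the number of types. *)
Lemma ultrapower M (rho : nat -> nat -> M) : exists (N : fo_structure L) (r : nat -> N),
  forall phi, ((exists m, forall n, (m <= n)%N -> fo_holds (rho n) phi) -> fo_holds r phi) /\
    ((forall (s : nat -> M), fo_holds s phi) -> fo_true N phi).
Proof.
have [U [Uu Usub]] := ultraFilterLemma eventually_filter.
pose K := nat -> M.
pose Tr (r : nat -> K) phi := U [set n | fo_holds (fun i => r i n) phi].
have UT : U setT by apply: filterT.
have US A B : (forall x, A x -> B x) -> U A -> U B by move=> H; apply: filterS.
have U0 A : (forall x, ~ A x) -> ~ U A.
  by move=> H UA; apply: (@filter_not_empty _ U _); apply: US UA.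
have UI A B : U A -> U B -> U (A `&` B) by apply: filterI.
have UC A : U (~` A) <-> ~ U A.
  split=> [nA UA|]; last by have [] := in_ultra_setVsetC A Uu.
  by have := UI _ _ nA UA; apply: U0 => x [].
have TS : truth_system Tr.
  split.
  - by move=> r phi; rewrite -UC.
  - move=> r phi psi; split=> [H|[]]; last 2 first.
    + by apply: US => n; left.
    + by apply: US => n; right.
    apply: contrapT => /not_orP[/UC H1 /UC H2].
    by have := UI _ _ H (UI _ _ H1 H2); apply: U0 => n [[]? []].
  - move=> r phi psi; split=> [H|[H1 H2]]; last exact: UI H1 H2.
    by split; apply: US H => n [].
  - by move=> r phi v; apply: US UT => n _; apply: v.
  - move=> r r' phi E; apply: US => n.
    by apply/(fo_holds_local _).1 => i ip; rewrite E.
  - by move=> r i j; rewrite /Tr /= => ->; apply: US UT.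
have ex r i phi : Tr r (FEx i phi) -> exists a, Tr [eta r with i |-> a] phi.
  move=> H.
  have /choice[a aP] : forall n, exists a, fo_holds (fun i => r i n) (FEx i phi) ->
      fo_holds [eta (fun i => r i n) with i |-> a] phi.
    move=> n; have [[a Ha]|nH] := pselect (fo_holds (fun i => r i n) (FEx i phi)).
      by exists a.
    by exists (r 0%N n).
  exists a; apply: US H => n /aP; apply/(fo_holds_local _).1 => j _ /=.
  by case: ifP.
have [x0] := fo_inh M.
have [N [c [cs cP]]] := truth_system_realized (inhabits (fun=> x0)) TS ex.
exists N, (fun i => c (fun n => rho n i)) => phi; split=> [[m H]|H s].
  apply/(cP (fun i n => rho n i)); apply: Usub.
  by exists m.
have [s' ->] := surj_lift s cs.
by apply/cP; apply: US UT => n _; apply: H.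
Qed.

End Isomorphism.

(** * Omitting types and the Ryll-Nardzewski theorem *)
Section Projection.
Variable L : fo_signature.
Implicit Types (M : fo_structure L) (phi : fo_formula L).

Definition fo_exs vs phi := foldr (@FEx L) phi vs.

Lemma fo_exs_occ vs phi :
  fo_free_occ (fo_exs vs phi) = [seq v <- fo_free_occ phi | v \notin vs].
Proof.
elim: vs => [|i vs IH] /=; first by rewrite filter_predT.
by rewrite IH -filter_predI; apply: eq_filter => v; rewrite /= in_cons negb_or.
Qed.

Lemma fo_holds_exs M (rho : nat -> M) vs phi :
  fo_holds rho (fo_exs vs phi) <->
  exists rho', (forall i, i \notin vs -> rho' i = rho i) /\ fo_holds rho' phi.
Proof.
elim: vs rho => [|i vs IH] rho /=.
  split=> [H|[r [e]]]; first by exists rho.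
  by rewrite (_ : r = rho)//; apply: funext => j; apply: e.
split=> [[a /IH[r [e H]]]|[r [e H]]].
  exists r; split=> // j; rewrite inE negb_or => /andP[ji /e ->] /=.
  by rewrite (negbTE ji).
exists (r i); apply/IH; exists r; split=> // j jvs /=.
by case: eqP => [->//|/eqP ji]; apply: e; rewrite inE negb_or ji.
Qed.

Lemma fo_project n phi : exists theta : fo_formula L,
  fo_below n theta /\
  forall M (rho : nat -> M), fo_holds rho theta <->
    exists rho', (forall i, (i < n)%N -> rho' i = rho i) /\ fo_holds rho' phi.
Proof.
exists (fo_exs [seq v <- fo_fv phi | (n <= v)%N] phi); split=> [i|M rho].
  rewrite mem_undup fo_exs_occ mem_filter mem_filter mem_undup.
  by move=> /andP[+ ip]; rewrite ip andbT ltnNge.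
rewrite fo_holds_exs; split=> -[r [e H]].
  by exists r; split=> // i ilt; apply: e; rewrite mem_filter leqNgt ilt.
(* [fo_exs] changes only free variables of [phi], so the witness must return to [rho] at all
   others. *)
exists (fun i => if (i < n)%N || (i \notin fo_fv phi) then rho i else r i); split.
  by move=> i; rewrite mem_filter negb_and -ltnNge => ->.
apply/(fo_holds_local _).1: H => i ip /=; rewrite ip orbF.
by case: ifP => // /e.
Qed.

End Projection.

Section OmittingTypes.
Variables (L : fo_signature) (M : fo_structure L).
Variables (n : nat) (p : fo_formula L -> Prop).
Implicit Types (phi psi : fo_formula L) (rho : nat -> M).
Hypothesis L_countable : fo_countable L.
Hypothesis p_fv : forall psi, p psi -> fo_below n psi.
Hypothesis p_nonisolated : forall theta,
  fo_below n theta ->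
  (exists rho, fo_holds rho theta) ->
  exists psi, p psi /\ exists rho, fo_holds rho theta /\ ~ fo_holds rho psi.

(** The conditions of the Henkin construction are the formulas satisfiable in [M] itself, so the
    truths of [M] hold at every stage without being added. *)
Let consistent phi := exists rho, fo_holds rho phi.
Let forces phi (Q : (nat -> M) -> Prop) := forall rho, fo_holds rho phi -> Q rho.

(** [theta] is the trace of [phi] on the tuple [tau]: it holds of the values at [tau] of an
    assignment satisfying [phi], and the shift by [n] keeps the two groups of variables apart. A
    [psi] of [p] that fails at some realization of [theta] can thus be negated at [tau]. *)
Let omit_step phi (tau : nat -> nat) : consistent phi ->
  exists psi, p psi /\ consistent (FAnd phi (FNot (fo_ren tau psi))).
Proof.
move=> [rho0 H0].
pose eqs : fo_formula L := fo_conj [seq FEq (FVar (n + tau i)%N) (FVar i) | i <- iota 0 n].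
have [theta [tfv tP]] := fo_project n (FAnd (fo_ren (addn n) phi) eqs).
have eqsP rho : fo_holds rho eqs <-> forall i, (i < n)%N -> rho (n + tau i)%N = rho i.
  rewrite (@fo_holds_conj L _ M rho (iota 0 n) (fun i => FEq (FVar (n + tau i)%N) (FVar i))).
  by split=> H i; move: (H i); rewrite mem_iota.
have [|psi [ppsi [r1 [/tP[r2 [e [/fo_holds_ren H2 /eqsP H3]]] npsi]]]] := p_nonisolated tfv.
  exists (rho0 \o tau); apply/tP.
  exists (fun i => if (i < n)%N then rho0 (tau i) else rho0 (i - n)%N); split=> [i ->//|].
  split; last by apply/eqsP => i ilt; rewrite ilt ltnNge leq_addr/= addKn.
  apply/fo_holds_ren; rewrite (_ : _ \o _ = rho0)//; apply: funext => i /=.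
  by rewrite ltnNge leq_addr/= addKn.
exists psi; split=> //; exists (r2 \o addn n); split=> //=.
move=> /fo_holds_ren H; apply: npsi; apply/(fo_holds_local _).1: H => i /(p_fv ppsi) ilt /=.
by rewrite H3// e.
Qed.

(** If the existential formula is compatible with [phi], a variable fresh for both formulas is made
    to name a witness; otherwise [phi] already refutes it. *)
Let henkin_step phi i psi : consistent phi ->
  exists phi', [/\ consistent phi', forces phi' (fun rho => fo_holds rho phi) &
    forces phi' (fun rho => ~ fo_holds rho (FEx i psi)) \/
    exists j, forces phi' (fun rho => fo_holds (rho \o [eta id with i |-> j]) psi)].
Proof.
move=> [rho0 H0].
have [[rho1 [H1 [a Ha]]]|nex] := pselect (consistent (FAnd phi (FEx i psi))); last first.
  exists phi; split=> //; first by exists rho0.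
  by left=> rho H H'; apply: nex; exists rho.
pose j := maxn i.+1 (maxn (fo_bound phi) (fo_bound psi)).
exists (FAnd phi (fo_ren [eta id with i |-> j] psi)); split.
- exists [eta rho1 with j |-> a]; split.
    apply/(fo_holds_local _).1: H1 => k /fo_boundP kb /=.
    by rewrite ltn_eqF// /j !leq_max kb !orbT.
  apply/fo_holds_ren; apply/(fo_holds_local _).1: Ha => k /fo_boundP kb /=.
  case: (k == i); first by rewrite eqxx.
  by rewrite ltn_eqF// /j !leq_max kb !orbT.
- by move=> rho [].
- by right; exists j => rho [_ /fo_holds_ren].
Qed.

Let decide_step phi psi : consistent phi ->
  exists phi', [/\ consistent phi', forces phi' (fun rho => fo_holds rho phi) &
    forces phi' (fun rho => ~ fo_holds rho psi) \/ forces phi' (fun rho => fo_holds rho psi)].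
Proof.
move=> [rho0 H0].
have [c|nc] := pselect (consistent (FAnd phi psi)).
  by exists (FAnd phi psi); split=> //; [move=> rho []|right=> rho []].
exists phi; split=> //; first by exists rho0.
by left=> rho H H'; apply: nc; exists rho.
Qed.

(** A Henkin construction whose names are the variables. A task is to decide the formula [e k], to
    give it a witness, or to break [p] at a finite tuple of variables; task [t] is served at stage
    [pickle t]. What some stage forces is a truth system. *)
Lemma omitting_types : exists A : fo_structure L,
  [/\ countable [set: A], forall phi, fo_true M phi -> fo_true A phi
    & forall r : nat -> A, exists psi, p psi /\ ~ fo_holds r psi].
Proof.
have [e eP] := fo_formula_enum L_countable.
pose task := (nat + (nat * nat) + seq nat)%type.
pose completed (t : task) phi := match t with
  | inl (inl k) => forces phi (fun rho => ~ fo_holds rho (e k)) \/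
                   forces phi (fun rho => fo_holds rho (e k))
  | inl (inr (i, k)) => forces phi (fun rho => ~ fo_holds rho (FEx i (e k))) \/
      exists j, forces phi (fun rho => fo_holds (rho \o [eta id with i |-> j]) (e k))
  | inr l => exists psi, p psi /\ forces phi (fun rho => ~ fo_holds (rho \o nth 0%N l) psi)
  end.
have step (phi : {phi | consistent phi}) (m : nat) : {phi' : {phi | consistent phi} |
    forces (sval phi') (fun rho => fo_holds rho (sval phi)) /\
    forall t, unpickle m = Some t -> completed t (sval phi')}.
  apply: cid; case: phi => phi cphi /=.
  case: unpickle => [[[k|[i k]]|l]|].
  - have [phi' [c f H]] := decide_step (e k) cphi.
    by exists (exist _ phi' c); split=> // _ [<-].
  - have [phi' [c f H]] := henkin_step i (e k) cphi.
    by exists (exist _ phi' c); split=> // _ [<-].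
  - have [psi [ppsi c]] := omit_step (nth 0%N l) cphi.
    exists (exist _ _ c); split=> [rho []//|_ [<-]]; exists psi; split=> // rho [_ H] h.
    by apply: H; apply/fo_holds_ren.
  - by exists (exist _ phi cphi); split.
have ctop : consistent (fo_top L).
  by have [x] := fo_inh M; exists (fun=> x); apply: fo_holds_top.
pose c := fix c m := if m is k.+1 then sval (step (c k) k) else exist _ _ ctop.
have cmono m k : (m <= k)%N -> forces (sval (c k)) (fun rho => fo_holds rho (sval (c m))).
  elim: k => [|k IH]; first by rewrite leqn0 => /eqP-> rho.
  rewrite leq_eqVlt => /orP[/eqP-> rho//|/IH H rho].
  by have [f _] := svalP (step (c k) k); move=> /f /H.
have tasks (t : task) : exists m, completed t (sval (c m)).
  exists (pickle t).+1; have [_] := svalP (step (c (pickle t)) (pickle t)).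
  by apply; rewrite pickleK.
pose Tr (tau : nat -> nat) phi :=
  exists m, forces (sval (c m)) (fun rho => fo_holds (rho \o tau) phi).
have Tr2 tau tau' phi phi' : Tr tau phi -> Tr tau' phi' ->
    exists rho, fo_holds (rho \o tau) phi /\ fo_holds (rho \o tau') phi'.
  move=> [m Hm] [k Hk]; have [rho H] := svalP (c (maxn m k)).
  exists rho; split; [apply: Hm|apply: Hk]; apply: cmono H; rewrite ?leq_maxl ?leq_maxr//.
have Trdec tau phi : Tr tau phi \/ Tr tau (FNot phi).
  have [k ek] := eP (fo_ren tau phi); have [m] := tasks (inl (inl k)).
  by case=> H; [right|left]; exists m => rho /H; rewrite ek /= fo_holds_ren.
have Trmp tau phi psi : (forall rho, fo_holds (rho \o tau) phi -> fo_holds (rho \o tau) psi) ->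
    Tr tau phi -> Tr tau psi.
  by move=> H [m Hm]; exists m => rho /Hm /H.
have TS : truth_system Tr.
  split.
  - move=> tau phi; split=> [H H'|H]; first by have [rho []] := Tr2 _ _ _ _ H H'.
    by have [] := Trdec tau phi.
  - move=> tau phi psi; split=> [H|[]]; last 2 first.
    + by apply: Trmp => rho; left.
    + by apply: Trmp => rho; right.
    have [|[m1 H1]] := Trdec tau phi; first by left.
    right; move: H => [m2 H2]; exists (maxn m1 m2) => rho H.
    have /H1 := cmono _ _ (leq_maxl m1 m2) _ H.
    by have /H2[] := cmono _ _ (leq_maxr m1 m2) _ H.
  - move=> tau phi psi; split=> [H|[[m1 H1] [m2 H2]]].
      by split; apply: Trmp H => rho [].
    exists (maxn m1 m2) => rho H; split; [apply: H1|apply: H2]; apply: cmono H;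
      by rewrite ?leq_maxl ?leq_maxr.
  - by move=> tau phi v; exists 0%N => rho _; apply: v.
  - move=> tau tau' phi te [m H]; exists m => rho /H.
    by apply/(fo_holds_local _).1 => i ip /=; rewrite te.
  - by move=> tau i j te; exists 0%N => rho _ /=; rewrite te.
have Trex tau i phi : Tr tau (FEx i phi) -> exists a, Tr [eta tau with i |-> a] phi.
  (* Tasks know nothing of [tau]: the formula that received a witness is the one renamed along
     [tau], with its bound variable moved to the fresh [j]. *)
  move=> H; pose j := (\max_(k <- fo_fv phi) tau k).+1.
  have jfresh k : k \in fo_fv phi -> tau k != j.
    by move=> kp; rewrite ltn_eqF// ltnS leq_bigmax_seq.
  pose sg := [eta tau with i |-> j].
  have [k ek] := eP (fo_ren sg phi); have [m] := tasks (inl (inr (j, k))).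
  rewrite /= ek => -[Hm|[l Hm]].
    have /(Tr2 _ _ _ _ H)[rho [[a Ha] []]] : Tr id (FNot (FEx j (fo_ren sg phi))).
      by exists m.
    exists a; apply/fo_holds_ren; apply/(fo_holds_local _).1: Ha => q qp /=.
    by rewrite /sg /=; case: (q == i); [rewrite eqxx|rewrite (negbTE (jfresh _ qp))].
  exists l, m => rho /Hm; rewrite fo_holds_ren.
  apply/(fo_holds_local _).1 => q qp /=; rewrite /sg /=.
  by case: (q == i); [rewrite eqxx|rewrite (negbTE (jfresh _ qp))].
have [A [d [ds dP]]] := truth_system_realized (inhabits 0%N) TS Trex.
exists A; split.
- exact: surj_countable ds.
- move=> phi Mphi r; have [tau ->] := surj_lift r ds; apply/dP.
  by exists 0%N => rho _; apply: Mphi.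
- move=> r; have [tau ->] := surj_lift r ds.
  have [m [psi [ppsi H]]] := tasks (inr (mkseq tau n)).
  exists psi; split=> //; apply/(dP tau (FNot psi)).
  exists m => rho /H /= npsi h; apply: npsi; apply/(fo_holds_local _).1: h.
  by move=> i /(p_fv ppsi) ilt /=; rewrite nth_mkseq.
Qed.

End OmittingTypes.

Section RyllNardzewski.
Variables (L : fo_signature) (T : fo_theory L).
Implicit Types (phi : fo_formula L) (M N : fo_structure L).

(** The [theta j] isolate the complete [n]-types of T. Some of them may hold nowhere, so the size of
    [I] only bounds the number of types. *)
Definition isolating_family n (I : finType) (theta : I -> fo_formula L) :=
  [/\ forall j, fo_below n (theta j),
      forall M (rho : nat -> M), fo_model T M -> exists j, fo_holds rho (theta j),
      forall M (rho : nat -> M) j j', fo_model T M ->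
        fo_holds rho (theta j) -> fo_holds rho (theta j') -> j = j'
    & forall j phi, fo_below n phi ->
       (forall M (rho : nat -> M), fo_model T M -> fo_holds rho (theta j) -> fo_holds rho phi) \/
       (forall M (rho : nat -> M), fo_model T M -> fo_holds rho (theta j) -> ~ fo_holds rho phi)].

Hypothesis T_complete : fo_complete T.

(** T is complete, so one model decides for all. Overlaps are removed by assigning a tuple to the
    least index that holds. *)
Lemma isolating_familyI M n k (theta : 'I_k -> fo_formula L) : fo_model T M ->
  (forall j, fo_below n (theta j)) ->
  (forall rho : nat -> M, exists j, fo_holds rho (theta j)) ->
  (forall j phi, fo_below n phi ->
    (forall rho : nat -> M, fo_holds rho (theta j) -> fo_holds rho phi) \/
    (forall rho : nat -> M, fo_holds rho (theta j) -> ~ fo_holds rho phi)) ->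
  exists theta' : 'I_k -> fo_formula L, isolating_family n theta'.
Proof.
move=> TM tfv tcov tcomp.
have transfer phi : fo_true M phi -> forall N, fo_model T N -> fo_true N phi.
  by move=> Mphi N TN; apply: fo_complete_true T_complete TM TN Mphi.
pose prev (j : 'I_k) := [seq i : 'I_k <- enum 'I_k | (i < j)%N].
pose theta' j := FAnd (theta j) (fo_conj [seq FNot (theta i) | i <- prev j]).
have t'P N (rho : nat -> N) j : fo_holds rho (theta' j) <->
    fo_holds rho (theta j) /\ forall i : 'I_k, (i < j)%N -> ~ fo_holds rho (theta i).
  rewrite /theta' /=.
  rewrite (@fo_holds_conj L _ N rho (prev j) (fun i => FNot (theta i))).
  split=> -[H H']; split=> // i; first by move=> ilt; apply: H'; rewrite mem_filter ilt mem_enum.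
  by rewrite mem_filter => /andP[/H'].
exists theta'; split.
- move=> j i; rewrite mem_undup/= mem_cat -!(mem_undup (fo_free_occ _)) => /orP[/tfv//|].
  by move=> /(@mem_fv_conj L _ (prev j) (fun i => FNot (theta i)))[i' _ /tfv].
- move=> N rho TN.
  have /transfer/(_ N TN rho) : fo_true M (fo_disj [seq theta j | j <- enum 'I_k]).
    move=> r; apply/(@fo_holds_disj L _ M r (enum 'I_k) theta).
    by have [j Hj] := tcov r; exists j; rewrite ?mem_enum.
  move=> /(@fo_holds_disj L _ N rho (enum 'I_k) theta)[j0 _ Hj0].
  have [m mle] := ubnP j0; elim: m j0 mle Hj0 => // m IH j0 mle Hj0.
  have [H|/existsNP[i /not_implyP[ilt /contrapT Hi]]] :=
      pselect (forall i : 'I_k, (i < j0)%N -> ~ fo_holds rho (theta i)).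
    by exists j0; apply/t'P.
  by apply: IH Hi; apply: leq_trans ilt _.
- move=> N rho j j' TN /t'P[H1 H2] /t'P[H3 H4].
  apply/val_inj/eqP; rewrite eqn_leq; apply/andP; split; rewrite leqNgt; apply/negP.
    by move=> /H2.
  by move=> /H4.
- move=> j phi pfv; case: (tcomp j phi pfv) => H; [left|right] => N rho TN /t'P[Hj _].
    suff /transfer/(_ N TN rho)/fo_holds_imp : fo_true M (fo_imp (theta j) phi) by apply.
    by move=> r; apply/fo_holds_imp/H.
  suff /transfer/(_ N TN rho)/fo_holds_imp : fo_true M (fo_imp (theta j) (FNot phi)) by apply.
  by move=> r; apply/fo_holds_imp/H.
Qed.

Lemma finite_enum (X : Type) (x0 : X) : finite_set [set: X] ->
  exists (k : nat) (g : 'I_k -> X), forall x, exists i, g i = x.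
Proof.
move=> /finite_setP[k /card_set_bijP[f [/= fn finj _]]].
pose g (i : 'I_k) := if pselect (exists x, f x = i) is left h then projT1 (cid h) else x0.
exists k, g => x; exists (Ordinal (fn x I)); rewrite /g; case: pselect => [h|[]]; last by exists x.
by case: (cid h) => y /= /finj; apply; rewrite inE.
Qed.

(** There are finitely many [n]-tuples. [delta] separates the first of two tuples from the second
    whenever some formula does; the conjunction over the second holds only of tuples that have the
    type of the first. *)
Lemma isolating_family_finite M n : fo_model T M -> finite_set [set: M] ->
  exists k (theta : 'I_k -> fo_formula L), isolating_family n theta.
Proof.
move=> TM Mfin; have [x0] := fo_inh M.
have [q [g gP]] := finite_enum x0 Mfin.
pose F := {ffun 'I_n -> 'I_q}.
pose rep (f : F) (i : nat) := if insub i is Some k then g (f k) else x0.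
have repP (rho : nat -> M) : exists f, forall i, (i < n)%N -> rho i = rep f i.
  have /choice[f fP] : forall k : 'I_n, exists i, g i = rho k by move=> k; apply: gP.
  by exists (finfun f) => i ilt; rewrite /rep insubT ffunE fP.
have sepP (ff : F * F) : exists delta, [/\ fo_below n delta,
    fo_holds (rep ff.1) delta & fo_holds (rep ff.2) delta ->
      forall phi, fo_below n phi ->
        fo_holds (rep ff.1) phi -> fo_holds (rep ff.2) phi].
  have [H|/existsNP[phi /not_implyP[pfv /not_implyP[H1 H2]]]] := pselect (forall phi, fo_below n phi ->
        fo_holds (rep ff.1) phi -> fo_holds (rep ff.2) phi).
    exists (fo_top L); split=> //; exact: fo_holds_top.
  by exists phi; split.
have [delta dP] := choice sepP.
pose theta (f : F) := fo_conj [seq delta (f, f') | f' <- enum {: F}].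
have thetaP (rho : nat -> M) f : fo_holds rho (theta f) <-> forall f', fo_holds rho (delta (f, f')).
  rewrite (@fo_holds_conj L _ M rho (enum {: F}) (fun f' => delta (f, f'))).
  by split=> H f'; last move=> _; apply: H; rewrite mem_enum.
have repE rho f phi : (forall i, (i < n)%N -> rho i = rep f i) ->
    fo_below n phi -> fo_holds rho phi <-> fo_holds (rep f) phi.
  by move=> rf pfv; apply: fo_holds_local => i /pfv /rf.
exists #|F|.
apply: (@isolating_familyI M n _ (fun j : 'I_#|F| => theta (enum_val j)) TM).
- move=> j i /(@mem_fv_conj L _ (enum {: F}) (fun f' => delta (enum_val j, f')))[f' _].
  by have [+ _ _] := dP (enum_val j, f'); apply.
- move=> rho; have [f rf] := repP rho; exists (enum_rank f); rewrite enum_rankK.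
  apply/thetaP => f'; have [dfv H _] := dP (f, f').
  by apply/(repE _ _ _ rf dfv).
- move=> j phi pfv; set f := enum_val j.
  have key (rho : nat -> M) psi : fo_below n psi ->
      fo_holds rho (theta f) -> fo_holds (rep f) psi -> fo_holds rho psi.
    move=> sfv /thetaP H Hf; have [f' rf'] := repP rho.
    have [dfv _ Hd] := dP (f, f').
    apply/(repE _ _ _ rf' sfv)/(Hd _ _ sfv Hf).
    by apply/(repE _ _ _ rf' dfv); apply: H.
  have [Hf|Hf] := pselect (fo_holds (rep f) phi).
    by left=> rho H; apply: key Hf.
  by right=> rho H; apply: (key rho (FNot phi) pfv H Hf).
Qed.

(** A tuple whose type is not isolated could be omitted in a countable model, against uniqueness. If
    no finite set of isolating formulas were exhaustive, tuples avoiding longer and longer initial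
    segments of them would produce, in an ultrapower and then in a countable elementary part of it,
    a tuple without isolated type. *)
Lemma isolating_family_infinite M n : fo_countable L -> fo_model T M -> [set: M] #= [set: nat] ->
  (forall N, fo_model T N -> [set: N] #= [set: nat] -> fo_iso M N) ->
  exists k (theta : 'I_k -> fo_formula L), isolating_family n theta.
Proof.
move=> Lc TM Mnat uniq.
have Minf : infinite_set [set: M].
  by move=> Mfin; apply: infinite_nat; rewrite -(eq_finite_set Mnat).
(* Infinity is among the truths that [N] inherits from [M], so a countable [N] has cardinality
   omega. *)
have isoM N : countable [set: N] -> (forall phi, fo_true M phi -> fo_true N phi) -> fo_iso M N.
  move=> Nc MN; apply: uniq => [phi Tphi|]; first exact/MN/TM.
  apply: eq_card_nat => //; apply/fo_infiniteP => k; apply: MN.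
  by move: k; apply/fo_infiniteP.
pose complete theta := forall phi, fo_below n phi ->
  (forall rho : nat -> M, fo_holds rho theta -> fo_holds rho phi) \/
  (forall rho : nat -> M, fo_holds rho theta -> ~ fo_holds rho phi).
have isolated (rho : nat -> M) : exists theta,
    [/\ fo_below n theta, fo_holds rho theta & complete theta].
  apply: contrapT => niso.
  pose p phi := fo_below n phi /\ fo_holds rho phi.
  have [|theta tfv [r Hr]|A [Ac MA omit]] := @omitting_types L M n p Lc.
  - by move=> psi [].
  - apply: contrapT => H.
    have {}H psi (r' : nat -> M) : p psi -> fo_holds r' theta -> fo_holds r' psi.
      move=> ppsi Hr'; apply: contrapT => nH; apply: H; exists psi; split=> //.
      by exists r'.
    apply: niso; exists theta; split=> //.
      by apply: contrapT => nt; exact: (H (FNot theta) r (conj tfv nt) Hr Hr).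
    move=> phi pfv; have [Hp|Hp] := pselect (fo_holds rho phi).
      by left=> r' /H; apply.
    by right=> r' Hr'; exact: (H (FNot phi) r' (conj pfv Hp) Hr').
  - have [h [hb hf hr]] := isoM A Ac MA.
    have [psi [[_ Hp]]] := omit (h \o rho); apply.
    exact/(fo_iso_holds hb hf hr).
have [e eP] := fo_formula_enum Lc.
(* A [good] formula isolates a type or holds nowhere in [M]. *)
pose good k := (forall i, i \in fo_fv (e k) -> (i < n)%N) /\ complete (e k).
have [[K KP]|nK] := pselect (exists K, forall rho : nat -> M,
    exists k, [/\ (k < K)%N, good k & fo_holds rho (e k)]).
  pose theta (j : 'I_K) := if pselect (good j) then e j else FNot (fo_top L).
  exists K; apply: (@isolating_familyI M n _ theta TM); rewrite /theta.
  - by move=> j i; case: pselect => // -[H _] /H.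
  - move=> rho; have [k [kK gk Hk]] := KP rho; exists (Ordinal kK).
    by case: pselect.
  - move=> j phi pfv; case: (pselect (good j)) => /= gj; first exact: gj.2.
    by left=> rho nt; exfalso; apply: nt; exact: fo_holds_top.
exfalso.
have /choice[rho rhoP] : forall m, exists rho : nat -> M,
    forall k, (k < m)%N -> good k -> ~ fo_holds rho (e k).
  move=> m; apply: contrapT => /forallNP H; apply: nK; exists m => rho.
  apply: contrapT => /forallNP H'; apply: (H rho) => k km gk Hk.
  by apply: (H' k).
have [N [r rP]] := ultrapower rho.
have [A [K [g [c [cs gS cg]]]]] := lowenheim_skolem r Lc.
have MA phi : fo_true M phi -> fo_true A phi.
  move=> Mphi s; have [s' ->] := surj_lift s cs.
  by apply/cg; apply: (rP phi).2.
have [h [hb hf hr]] := isoM A (surj_countable cs) MA.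
have /choice[kap kapE] := gS.
have [h' hK h'K] := hb.
have [theta [tfv Ht tc]] := isolated (h' \o (c \o kap)).
have [k ek] := eP theta.
have := Ht; rewrite -ek (fo_iso_holds hb hf hr).
rewrite (_ : h \o _ = c \o kap); last by apply: funext => i /=; rewrite h'K.
rewrite cg (_ : g \o kap = r); last by apply: funext.
have : fo_holds r (FNot (e k)); last by [].
apply: (rP _).1; exists k.+1 => m km /=; apply: rhoP => //.
by rewrite /good ek.
Qed.

End RyllNardzewski.

Lemma ryll_nardzewski (L : fo_signature) (T : fo_theory L) n :
  fo_countable L -> fo_omega_categorical T ->
  exists k (theta : 'I_k -> fo_formula L), isolating_family T n theta.
Proof.
move=> Lc [Tc [[M TM Mfin]|[M [TM Mnat] uniq]]].
  exact: isolating_family_finite TM Mfin.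
exact: isolating_family_infinite Lc TM Mnat uniq.
Qed.

(** * Continuous structures *)
Section HalfPowers.
Variable R : realType.
Implicit Types (x e c : R) (n : nat).

Lemma half_pow_gt0 n : 0 < 2^-1 ^+ n :> R.
Proof. by rewrite exprn_gt0// invr_gt0. Qed.

Lemma half_powS n : 2^-1 ^+ n.+1 + 2^-1 ^+ n.+1 = 2^-1 ^+ n :> R.
Proof. by rewrite exprS; set c := _ ^+ n; lra. Qed.

Lemma geometric_lt e : 0 < e -> exists n, 2^-1 ^+ n < e.
Proof.
move=> e0; have := @cvg_expr R 2^-1; rewrite ger0_norm ?invr_ge0// invf_lt1//.
move=> /(_ (ltr1n _ 2)) /cvgrPdist_lt /(_ e e0) [n _ /(_ n (leqnn _))] /=.
by rewrite sub0r normrN ger0_norm ?ltW ?half_pow_gt0//; exists n.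
Qed.

(** The way limits are taken below: an error proportional to [2^-1 ^+ n] is discarded without a
    limit being named. *)
Lemma geometric_le0 x c : (forall n, x <= c * 2^-1 ^+ n) -> x <= 0.
Proof.
move=> H; rewrite leNgt; apply/negP => x0.
have c0 : 0 < c by have := H 0%N; rewrite expr0 mulr1; apply: lt_le_trans.
have [n] := geometric_lt (divr_gt0 x0 c0).
by rewrite ltr_pdivlMr// mulrC ltNge H.
Qed.

End HalfPowers.

Section ContinuousLogic.
Variables (R : realType) (L : cl_signature R).
Implicit Types (M N : cl_structure L) (phi : cl_formula L).

Lemma sup01 (X : Type) (f : X -> R) : inhabited X -> (forall x, 0 <= f x <= 1) ->
  0 <= sup (range f) <= 1.
Proof.
move=> [x0] f01; have ub : ubound (range f) 1 by move=> _ [x _ <-]; case/andP: (f01 x).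
apply/andP; split; last by apply: ge_sup => //; exists (f x0), x0.
apply: (@le_trans _ _ (f x0)); first by case/andP: (f01 x0).
by apply: ub_le_sup; [exists 1|exists x0].
Qed.

Lemma inf01 (X : Type) (f : X -> R) : inhabited X -> (forall x, 0 <= f x <= 1) ->
  0 <= inf (range f) <= 1.
Proof.
move=> [x0] f01; have lb : lbound (range f) 0 by move=> _ [x _ <-]; case/andP: (f01 x).
apply/andP; split; first by apply: lb_le_inf => //; exists (f x0), x0.
apply: (@le_trans _ _ (f x0)); last by case/andP: (f01 x0).
by apply: ge_inf; [exists 0|exists x0].
Qed.

Lemma cl_value01 M (rho : cl_assignment M) phi : 0 <= cl_value rho phi <= 1.
Proof.
elim: phi rho => [s t u|p a|n u a IH|s i phi IH|s i phi IH] rho /=.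
- by rewrite mdist_ge0 cl_diam.
- exact: cl_pint_range.
- by apply: conn_range => k; rewrite mxE.
- by apply: sup01 => [|a]; [exact: cl_inh|exact: IH].
- by apply: inf01 => [|a]; [exact: cl_inh|exact: IH].
Qed.

Lemma cl_update_id M (rho : cl_assignment M) s i : cl_update rho i (rho s i) = rho.
Proof.
apply: functional_extensionality_dep => s'.
rewrite /cl_update; have [<-|ss'] := eqVneq s s'; last by rewrite dfwith_out.
by rewrite dfwith_in; apply: funext => j /=; case: eqP => [->|].
Qed.

Lemma cl_updateE M (rho : cl_assignment M) s i a : @cl_update R L M rho s i a s = [eta rho s with i |-> a].
Proof. by rewrite /cl_update dfwith_in. Qed.

Lemma cl_update_out M (rho : cl_assignment M) s s' i a : s != s' ->
  @cl_update R L M rho s i a s' = rho s'.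
Proof. by move=> ss'; rewrite /cl_update dfwith_out. Qed.

Lemma cl_value_sup_all M vs phi :
  (forall rho : cl_assignment M, cl_value rho (cl_sup_all vs phi) = 0) <->
  (forall rho : cl_assignment M, cl_value rho phi = 0).
Proof.
elim: vs => //= -[s i] vs <- /=; set psi := cl_sup_all _ _.
split=> H rho; last first.
  rewrite -[RHS](sup1 (0 : R)); congr sup; apply/seteqP; split=> [_ [a _ <-]|_ ->].
    exact: H.
  by have [x] := cl_inh M s; exists x => //; apply: H.
apply/eqP; rewrite eq_le; case/andP: (cl_value01 rho psi) => -> _; rewrite andbT.
rewrite -(H rho) -[X in cl_value X _](cl_update_id rho s i).
apply: ub_le_sup; last by exists (rho s i).
by exists 1 => _ [a _ <-]; case/andP: (cl_value01 (cl_update rho i a) psi).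
Qed.

(** A geometric series sums to twice its first term, which yields a rate along with the limit. *)
Lemma cl_seq_complete M s (x : nat -> M s) :
  (forall n, mdist (x n) (x n.+1) <= 2^-1 ^+ n) ->
  exists y, forall n, mdist (x n) y <= 2 * 2^-1 ^+ n.
Proof.
move=> xC.
have xnm n m : mdist (x n) (x (n + m)%N) <= 2 * 2^-1 ^+ n - 2 * 2^-1 ^+ (n + m).
  elim: m => [|m IH]; first by rewrite addn0 mdistxx subrr.
  apply: le_trans (metric_triangle _ (x (n + m)%N) _) _.
  rewrite addnS (le_trans (lerD IH (xC _)))// exprS; set c := _ ^+ (n + m).
  by lra.
have {}xnm n m : (n <= m)%N -> mdist (x n) (x m) <= 2 * 2^-1 ^+ n.
  move=> nm; rewrite -(subnKC nm); apply: le_trans (xnm _ _) _.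
  by rewrite gerBl mulr_ge0// ltW// half_pow_gt0.
have [|y xy] := @cl_cauchy_cvg R L M s (x @ \oo) _.
  apply: cauchy_exP => e e0; have [n ne] := geometric_lt (divr_gt0 e0 (ltr0Sn R 1)).
  rewrite ltr_pdivlMr// mulrC in ne.
  exists (x n); exists n => //= m nm; rewrite /= ballEmdist /=.
  exact: le_lt_trans (xnm _ _ nm) ne.
exists y => n; apply/ler_addgt0Pl => e e0.
move/metricType_numDomainType.cvgrPdist_lt : xy => /(_ e e0) [m _ H].
have := H (maxn n m) (leq_maxr _ _); have := xnm n (maxn n m) (leq_maxl _ _).
move=> h1 h2; apply: le_trans (metric_triangle _ (x (maxn n m)) _) _.
by rewrite addrC lerD// metric_sym ltW.
Qed.

Lemma cl_fint_eq M (f : cl_fun L) (x y : forall k, M (@cl_fdom R L f k)) :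
  (forall k, x k = y k) -> cl_fint x = cl_fint y.
Proof. by move=> e; congr cl_fint; apply: functional_extensionality_dep. Qed.

(** Membership in the closure of the relation for the product metric. *)
Definition cl_close M N (rel : forall s, M s -> N s -> Prop) s (x : M s) (y : N s) :=
  forall e, 0 < e -> exists x' y', [/\ rel s x' y', mdist x x' < e & mdist y y' < e].

Lemma cl_close_total M N (rel : forall s, M s -> N s -> Prop) :
  (forall s x y x' y', rel s x y -> rel s x' y' -> mdist x x' = mdist y y') ->
  (forall s (x : M s) e, 0 < e -> exists x' y', rel s x' y' /\ mdist x x' < e) ->
  forall s (x : M s), exists y, cl_close rel x y.
Proof.
move=> iso dom s x.
have /choice[uv uvP] : forall n, exists uv : M s * N s, rel s uv.1 uv.2 /\ mdist x uv.1 < 2^-1 ^+ n.+1.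
  by move=> n; have [u [v H]] := dom s x _ (half_pow_gt0 R n.+1); exists (u, v).
have [n|y yP] := @cl_seq_complete N s (fun n => (uv n).2).
  have [r1 d1] := uvP n; have [r2 d2] := uvP n.+1.
  rewrite -(iso _ _ _ _ _ r1 r2); apply: le_trans (metric_triangle _ x _) _.
  have := half_powS R n; have := half_powS R n.+1; have := half_pow_gt0 R n.+2.
  by rewrite metric_sym; lra.
exists y => e e0; have [n ne] := geometric_lt (divr_gt0 e0 (ltr0Sn R 1)).
rewrite ltr_pdivlMr// mulrC in ne; have [r1 d1] := uvP n; exists (uv n).1, (uv n).2; split=> //.
  by have := half_powS R n; have := half_pow_gt0 R n.+1; lra.
by rewrite metric_sym; apply: le_lt_trans (yP n) ne.
Qed.

(** The isomorphism is the closure of [rel], a partial isometry with dense domain and range; the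
    moduli of continuity carry the symbols to limits. A relation is convenient because dense
    sequences may repeat points, and isometry alone makes its closure functional. *)
Lemma cl_iso_of_relation M N (rel : forall s, M s -> N s -> Prop) :
  (forall s x y x' y', rel s x y -> rel s x' y' -> mdist x x' = mdist y y') ->
  (forall s (x : M s) e, 0 < e -> exists x' y', rel s x' y' /\ mdist x x' < e) ->
  (forall s (y : N s) e, 0 < e -> exists x' y', rel s x' y' /\ mdist y y' < e) ->
  (forall (f : cl_fun L) x y, (forall k, rel _ (x k) (y k)) ->
     rel _ (@cl_fint R L M f x) (@cl_fint R L N f y)) ->
  (forall (p : cl_pred L) x y, (forall k, rel _ (x k) (y k)) ->
     @cl_pint R L M p x = @cl_pint R L N p y) ->
  cl_iso M N.
Proof.
move=> iso dom ran relf relp.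
pose cl := cl_close rel.
have cl_isom s x y x' y' : cl s x y -> cl s x' y' -> mdist x x' = mdist y y'.
  move=> H H'; apply/eqP; rewrite -subr_eq0 -normr_le0; apply/ler_addgt0Pl => e e0.
  (* Four approximations enter, two in each structure. *)
  have e4 : 0 < e / 4 by lra.
  have [u [v [ruv xu yv]]] := H _ e4; have [u' [v' [ruv' xu' yv']]] := H' _ e4.
  have e1 := iso _ _ _ _ _ ruv ruv'.
  have t1 := metric_triangle x u x'; have t2 := metric_triangle u u' x'.
  have t3 := metric_triangle u x u'; have t4 := metric_triangle x x' u'.
  have t5 := metric_triangle y v y'; have t6 := metric_triangle v v' y'.
  have t7 := metric_triangle v y v'; have t8 := metric_triangle y y' v'.
  have s1 := metric_sym x u; have s2 := metric_sym y v.
  have s3 := metric_sym x' u'; have s4 := metric_sym y' v'.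
  by rewrite addr0 ler_norml; apply/andP; split; lra.
have tot := cl_close_total iso dom.
have sur s (y : N s) : exists x, cl s x y.
  have [s1 x1 y1 x2 y2 r1 r2|s1 y1 e e0|x xP] := @cl_close_total N M (fun s y x => rel s x y) _ _ s y.
  - by rewrite (iso _ _ _ _ _ r1 r2).
  - by have [x1 [y2 [? ?]]] := ran s1 y1 e e0; exists y2, x1.
  - by exists x => e /xP[y1 [x1 []]]; exists x1, y1.
pose h s (x : M s) : N s := projT1 (cid (tot s x)).
have hP s x : cl s x (h s x) by rewrite /h; case: cid.
pose g s (y : N s) : M s := projT1 (cid (sur s y)).
have gP s y : cl s (g s y) y by rewrite /g; case: cid.
have clh s x y : cl s x y -> h s x = y.
  by move=> H; apply: mdist_positivity; rewrite -(cl_isom _ _ _ _ _ (hP _ x) H) mdistxx.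
have approx n (dm : 'I_n -> cl_sort L) (x : forall k, M (dm k)) (y : forall k, N (dm k)) d :
    0 < d -> (forall k, cl _ (x k) (y k)) ->
    exists (x' : forall k, M (dm k)) (y' : forall k, N (dm k)), forall k,
      [/\ rel _ (x' k) (y' k), mdist (x k) (x' k) < d & mdist (y k) (y' k) < d].
  move=> d0 H.
  pose P k := cid (H k d d0).
  exists (fun k => projT1 (P k)), (fun k => projT1 (cid (projT2 (P k)))) => k.
  by case: (cid (projT2 (P k))).
exists h; split.
- move=> s; exists (g s) => [x|y]; last exact/clh/gP.
  apply: mdist_positivity; rewrite (cl_isom _ _ _ _ _ (gP _ (h _ x)) (hP _ x)).
  exact: mdistxx.
- by move=> s x y; rewrite (cl_isom _ _ _ _ _ (hP _ x) (hP _ y)).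
- move=> f x; apply: clh => e e0.
  have e2 : 0 < e / 2 by lra.
  have [x' [y' H]] := approx _ _ x (fun k => h _ (x k)) _ (cl_fmod_gt0 f e2) (fun k => hP _ (x k)).
  exists (cl_fint x'), (cl_fint y'); split; first by apply: relf => k; case: (H k).
    apply: (@le_lt_trans _ _ (e / 2)); last by lra.
    by apply: cl_fint_unif => // k; case: (H k).
  apply: (@le_lt_trans _ _ (e / 2)); last by lra.
  by apply: cl_fint_unif => // k; case: (H k).
- move=> p x; apply/eqP; rewrite -subr_eq0 -normr_le0; apply/ler_addgt0Pl => e e0.
  have e2 : 0 < e / 2 by lra.
  have [x' [y' H]] := approx _ _ x (fun k => h _ (x k)) _ (cl_pmod_gt0 p e2) (fun k => hP _ (x k)).
  have e1 : @cl_pint R L M p x' = @cl_pint R L N p y' by apply: relp => k; case: (H k).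
  have h1 : `|@cl_pint R L M p x - @cl_pint R L M p x'| <= e / 2.
    by apply: cl_pint_unif => // k; case: (H k).
  have h2 : `|@cl_pint R L N p (fun k => h _ (x k)) - @cl_pint R L N p y'| <= e / 2.
    by apply: cl_pint_unif => // k; case: (H k).
  move: h1 h2; rewrite addr0 !ler_norml e1 => /andP[? ?] /andP[? ?].
  by apply/andP; split; lra.
Qed.

End ContinuousLogic.

(** * The event algebra of a randomization *)
Section Stone.
Variables (B : Type) (join meet : B -> B -> B) (neg : B -> B) (top bot : B).

(** Kept in the form of the axioms of T^R, which concern bare operations on a metric space; the
    order is recovered as [meet x y = x]. *)
Record boolean_laws : Prop := BooleanLaws {
  bl_joinC : forall x y, join x y = join y x;
  bl_meetC : forall x y, meet x y = meet y x;
  bl_joinA : forall x y z, join x (join y z) = join (join x y) z;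
  bl_meetA : forall x y z, meet x (meet y z) = meet (meet x y) z;
  bl_joinI : forall x y z, join x (meet y z) = meet (join x y) (join x z);
  bl_meetU : forall x y z, meet x (join y z) = join (meet x y) (meet x z);
  bl_joinx0 : forall x, join x bot = x;
  bl_meetx1 : forall x, meet x top = x;
  bl_joinxN : forall x, join x (neg x) = top;
  bl_meetxN : forall x, meet x (neg x) = bot }.

Hypothesis BL : boolean_laws.

Record ultra (U : B -> Prop) : Prop := Ultra {
  ultra_top : U top;
  ultra_meet : forall x y, U (meet x y) <-> U x /\ U y;
  ultra_neg : forall x, U (neg x) <-> ~ U x }.

Lemma bl_meetxx x : meet x x = x.
Proof.
by rewrite -{3}(bl_meetx1 BL x) -(bl_joinxN BL x) (bl_meetU BL) (bl_meetxN BL) (bl_joinx0 BL).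
Qed.

Lemma bl_meetx0 x : meet x bot = bot.
Proof. by rewrite -{1}(bl_meetxN BL x) (bl_meetA BL) bl_meetxx (bl_meetxN BL). Qed.

Lemma bl_meet_join x y : meet x (join x y) = x.
Proof.
by rewrite -{1}(bl_joinx0 BL x) -(bl_joinI BL) (bl_meetC BL) bl_meetx0 (bl_joinx0 BL).
Qed.

Lemma bl_split x y : join (meet x y) (meet x (neg y)) = x.
Proof. by rewrite -(bl_meetU BL) (bl_joinxN BL) (bl_meetx1 BL). Qed.

Let filterP (A : set B) :=
  (forall x y, A x -> A y -> A (meet x y)) /\ (forall x y, A x -> meet x y = x -> A y).

(** Zorn's lemma on proper filters containing [x]. If [y] is outside a maximal [A], adjoining it is
    improper, so some member of [A] is disjoint from [y]; were both [y] and [neg y] outside, two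
    such members would meet in [bot]. *)
Lemma ultra_exists x : x <> bot -> exists U, ultra U /\ U x.
Proof.
move=> xb; pose P (A : set B) := forall y, A y -> [/\ A x, filterP A & ~ A bot].
have [F FP Ftot|A [PA Amax]] := @Zorn_bigcup B P.
  move=> y [A FA Ay]; have [Ax [_ up] nb] := FP _ FA _ Ay; split; first by exists A.
    split=> [u v [C FC Cu] [D FD Dv]|u v [C FC Cu] uv]; last first.
      by exists C => //; have [_ [_ upC] _] := FP _ FC _ Cu; apply: upC uv.
    have [CD|DC] := Ftot _ _ FC FD.
      by exists D => //; have [_ [mD _] _] := FP _ FD _ Dv; apply: mD => //; apply: CD.
    by exists C => //; have [_ [mC _] _] := FP _ FC _ Cu; apply: mC => //; apply: DC.
  by move=> [C FC Cb]; have [_ _] := FP _ FC _ Cb.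
(* The empty set is not maximal, since the principal filter of [x] extends it. *)
have [[a Aa]|A0] := pselect (exists a, A a); last first.
  exfalso; apply: (Amax [set y | meet x y = x]).
    split=> [y Ay|H]; first by case: A0; exists y.
    by apply: A0; exists x; apply: H; apply: bl_meetxx.
  move=> y _; split; first exact: bl_meetxx.
    split=> [u v /= xu xv|u v /= xu uv]; first by rewrite (bl_meetA BL) xu.
    by rewrite -{1}xu -(bl_meetA BL) uv.
  by rewrite /= bl_meetx0 => /esym.
have [Ax [Am Aup] Ab] := PA _ Aa.
have Atop : A top by apply: Aup Aa _; rewrite (bl_meetx1 BL).
have ext y : ~ A y -> exists2 b, A b & meet b y = bot.
  move=> nAy; apply: contrapT => H.
  apply: (Amax [set z | exists2 b, A b & meet (meet b y) z = meet b y]).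
    split=> [z Az|sub]; first by exists z => //; rewrite (bl_meetC BL) (bl_meetA BL) bl_meetxx.
    apply: nAy; apply: sub; exists top => //.
    by rewrite (bl_meetC BL top) (bl_meetx1 BL) bl_meetxx.
  have sub z : A z -> exists2 b, A b & meet (meet b y) z = meet b y.
    by move=> Az; exists z => //; rewrite (bl_meetC BL) (bl_meetA BL) bl_meetxx.
  move=> z _; split; first exact: sub.
    split=> [u v [b Ab' bu] [c Ac cv]|u v [b Ab' bu] uv].
      exists (meet b c); first exact: Am.
      have e1 : meet (meet (meet b c) y) u = meet (meet b c) y.
        by rewrite (bl_meetC BL b c) -(bl_meetA BL c b y) -(bl_meetA BL c) bu.
      have e2 : meet (meet (meet b c) y) v = meet (meet b c) y.
        by rewrite -(bl_meetA BL b c y) -(bl_meetA BL b) cv.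
      by rewrite (bl_meetA BL) e1 e2.
    by exists b => //; rewrite -{1}bu -(bl_meetA BL) uv bu.
  by move=> [b Ab']; rewrite bl_meetx0 => e; apply: H; exists b.
have Aneg y : A (neg y) <-> ~ A y.
  split=> [Any Ay|nAy].
    by apply: Ab; rewrite -(bl_meetxN BL y); apply: Am.
  apply: contrapT => nAny; have [b Ab1 b1] := ext _ nAy; have [c Ac c1] := ext _ nAny.
  apply: Ab; suff <- : meet b c = bot by apply: Am.
  rewrite -(bl_split (meet b c) y) -(bl_meetA BL) (bl_meetC BL c) (bl_meetA BL) b1.
  by rewrite -(bl_meetA BL b) c1 (bl_meetC BL bot) !bl_meetx0 (bl_joinx0 BL).
exists A; split=> //; split=> // u v; split=> [Auv|[]]; last exact: Am.
split; apply: Aup Auv _; last by rewrite -(bl_meetA BL) bl_meetxx.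
by rewrite (bl_meetC BL u) -(bl_meetA BL) bl_meetxx.
Qed.

Lemma ultra_bot U : ultra U -> U bot <-> False.
Proof.
move=> HU; split=> // Ub; have := ultra_top HU.
by rewrite -(bl_meetxN BL bot) (ultra_meet HU) (ultra_neg HU) in Ub; case: Ub.
Qed.

Lemma ultra_join U : ultra U -> forall x y, U (join x y) <-> U x \/ U y.
Proof.
move=> HU x y; split=> [Uxy|].
  apply: contrapT => /not_orP[/(ultra_neg HU) nx /(ultra_neg HU) ny].
  apply/(ultra_bot HU); suff <- : meet (join x y) (meet (neg x) (neg y)) = bot.
    by rewrite !(ultra_meet HU).
  rewrite (bl_meetC BL) (bl_meetU BL) -{1}(bl_meetA BL) -(bl_meetA BL).
  rewrite (bl_meetC BL _ y) (bl_meetxN BL) bl_meetx0 (bl_joinx0 BL).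
  by rewrite (bl_meetC BL (neg y)) (bl_meetA BL) (bl_meetC BL _ x) (bl_meetxN BL) (bl_meetC BL) bl_meetx0.
move=> [Ux|Uy]; first by move: Ux; rewrite -{1}(bl_meet_join x y) => /(ultra_meet HU)[].
by move: Uy; rewrite -{1}(bl_meet_join y x) (bl_joinC BL) => /(ultra_meet HU)[].
Qed.

(** If [x] is not below [y], some ultrafilter contains [meet x (neg y)]. Identities of events
    thereby become propositional tautologies. *)
Lemma ultra_ext x y : (forall U, ultra U -> U x <-> U y) -> x = y.
Proof.
have key u v : (forall U, ultra U -> U u -> U v) -> meet u v = u.
  move=> H; rewrite -[RHS](bl_split u v) (_ : meet u (neg v) = bot) ?(bl_joinx0 BL)//.
  apply: contrapT => /ultra_exists[U [HU]]; rewrite (ultra_meet HU) (ultra_neg HU) => -[Uu].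
  by apply; apply: H.
move=> H; rewrite -(key x y); last by move=> U HU /(H U HU).
by rewrite (bl_meetC BL); apply: key => U HU /(H U HU).
Qed.

End Stone.

Section InfimumValues.
Variables (R : realType) (L : cl_signature R) (M : cl_structure L).
Implicit Types (phi : cl_formula L) (rho : cl_assignment M).

Lemma cl_value_inf_lt rho s i phi e : cl_value rho (CInf s i phi) < e <->
  exists a : M s, cl_value (cl_update rho i a) phi < e.
Proof.
have lb : lbound (range (fun a : M s => cl_value (cl_update rho i a) phi)) 0.
  by move=> _ [a _ <-]; case/andP: (cl_value01 (cl_update rho i a) phi).
have [x0] := cl_inh M s; split=> /= [lte|[a]]; last first.
  by apply: le_lt_trans; apply: ge_inf; [exists 0|exists a].
have ne : range (fun a : M s => cl_value (cl_update rho i a) phi) !=set0.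
  by exists (cl_value (cl_update rho i x0) phi), x0.
have e'0 : 0 < e - inf (range (fun a : M s => cl_value (cl_update rho i a) phi)).
  by rewrite subr_gt0.
have [_ [a _ <-]] := inf_adherent e'0 (conj ne (ex_intro _ 0 lb)).
by rewrite addrC subrK; exists a.
Qed.

Lemma cl_value_eq0 rho phi : cl_value rho phi = 0 <-> forall e, 0 < e -> cl_value rho phi < e.
Proof.
split=> [-> //|H]; apply/eqP; rewrite eq_le; apply/andP; split.
  by apply/ler_addgt0Pl => e /H; rewrite addr0 => /ltW.
by case/andP: (cl_value01 rho phi).
Qed.

End InfimumValues.

Section RandomizationLaws.
Variables (R : realType) (L : fo_signature) (T : fo_theory L).
Let LR : cl_signature R := rand_signature R L.
Variable N : cl_structure LR.

Definition rkar : metricType R := @cl_car R LR N sK.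
Definition rbar : metricType R := @cl_car R LR N sB.
Implicit Types (rho : nat -> rkar) (E F G : rbar) (phi : fo_formula L).

Definition rbr rho phi : rbar :=
  @cl_fint R LR N (REv phi) (fun k => rho (nth 0%N (fo_fv phi) k)).
Definition rtop : rbar := @cl_fint R LR N RTop (fun k => False_rect _ (notF (valP k))).
Definition rbot : rbar := @cl_fint R LR N RBot (fun k => False_rect _ (notF (valP k))).
Definition rneg E : rbar := @cl_fint R LR N RNeg (fun=> E).
Definition rjoin E F : rbar := @cl_fint R LR N RJoin (fun k => if val k == 0%N then E else F).
Definition rmeet E F : rbar := @cl_fint R LR N RMeet (fun k => if val k == 0%N then E else F).
Definition rmu E : R := @cl_pint R LR N tt (fun=> E).
Definition rsymdiff E F := rjoin (rmeet E (rneg F)) (rmeet (rneg E) F).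

(** The axioms of T^R read in [N]. Fullness, representation of events and atomlessness are infima
    and remain approximate here; [rfull], [revent] and [rsplit] are their exact forms. *)
Record randomization_laws : Prop := RandomizationLaws {
  rl_valid : forall rho phi, fo_valid phi -> rbr rho phi = rtop;
  rl_not : forall rho phi, rbr rho (FNot phi) = rneg (rbr rho phi);
  rl_or : forall rho phi psi, rbr rho (FOr phi psi) = rjoin (rbr rho phi) (rbr rho psi);
  rl_and : forall rho phi psi, rbr rho (FAnd phi psi) = rmeet (rbr rho phi) (rbr rho psi);
  rl_bool : boolean_laws rjoin rmeet rneg rtop rbot;
  rl_dK : forall rho i j, mdist (rho i) (rho j) = 1 - rmu (rbr rho (FEq (FVar i) (FVar j)));
  rl_dB : forall E F, mdist E F = rmu (rsymdiff E F);
  rl_full : forall rho i phi e, 0 < e ->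
    exists a, mdist (rbr [eta rho with i |-> a] phi) (rbr rho (FEx i phi)) < e;
  rl_event : forall E e, 0 < e -> exists a b, forall rho, rho 0%N = a -> rho 1%N = b ->
    mdist E (rbr rho (FEq (FVar 0) (FVar 1))) < e;
  rl_mu1 : rmu rtop = 1;
  rl_mu0 : rmu rbot = 0;
  rl_muUI : forall E F, rmu E + rmu F = rmu (rjoin E F) + rmu (rmeet E F);
  rl_atomless : forall E e, 0 < e -> exists F, `|rmu (rmeet E F) - rmu E / 2| < e;
  rl_transfer : forall rho (phi : fo_sentence L), T phi -> rbr rho (sval phi) = rtop }.

Lemma rbr_local rho rho' phi : {in fo_fv phi, rho =1 rho'} -> rbr rho phi = rbr rho' phi.
Proof.
move=> e; apply: (@cl_fint_eq R LR N (REv phi)) => k.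
by apply: e; apply: mem_nth.
Qed.

Lemma rfint_ev phi (x : 'I_(size (fo_fv phi)) -> rkar) rho :
  (forall k : 'I_(size (fo_fv phi)), rho (nth 0%N (fo_fv phi) k) = x k) ->
  @cl_fint R LR N (REv phi) x = rbr rho phi.
Proof.
move=> e; apply: (@cl_fint_eq R LR N (REv phi)) => k.
by rewrite e.
Qed.

Lemma rfint_top x : @cl_fint R LR N RTop x = rtop.
Proof. by apply: (@cl_fint_eq R LR N RTop) => -[]. Qed.

Lemma rfint_bot x : @cl_fint R LR N RBot x = rbot.
Proof. by apply: (@cl_fint_eq R LR N RBot) => -[]. Qed.

Lemma rfint_neg (x : 'I_1 -> rbar) : @cl_fint R LR N RNeg x = rneg (x ord0).
Proof.
apply: (@cl_fint_eq R LR N RNeg) => k.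
by congr x; apply: val_inj; case: k => -[].
Qed.

Lemma rfint_join (x : 'I_2 -> rbar) : @cl_fint R LR N RJoin x = rjoin (x ord0) (x (lift ord0 ord0)).
Proof.
apply: (@cl_fint_eq R LR N RJoin) => k.
by case: k => -[|[|]]// k2; congr x; apply: val_inj.
Qed.

Lemma rfint_meet (x : 'I_2 -> rbar) : @cl_fint R LR N RMeet x = rmeet (x ord0) (x (lift ord0 ord0)).
Proof.
apply: (@cl_fint_eq R LR N RMeet) => k.
by case: k => -[|[|]]// k2; congr x; apply: val_inj.
Qed.

Lemma rpint_mu (x : 'I_1 -> rbar) : @cl_pint R LR N tt x = rmu (x ord0).
Proof.
congr (@cl_pint R LR N tt); apply: functional_extensionality_dep => k.
by congr x; apply: val_inj; case: k => -[].
Qed.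

Definition rasg (rho : nat -> rkar) (eta : nat -> rbar) : cl_assignment N :=
  fun s => match s return nat -> N s with sK => rho | sB => eta end.

Lemma rteval_event (r : cl_assignment N) phi : cl_teval r (event R phi) = rbr (r sK) phi.
Proof. by []. Qed.

Lemma rteval_top (r : cl_assignment N) : cl_teval r (Btop R L) = rtop.
Proof. by apply: (@cl_fint_eq R LR N RTop) => -[]. Qed.

Lemma rteval_bot (r : cl_assignment N) : cl_teval r (Bbot R L) = rbot.
Proof. by apply: (@cl_fint_eq R LR N RBot) => -[]. Qed.

Lemma rteval_join (r : cl_assignment N) U V :
  cl_teval r (@Bjoin R L U V) = rjoin (cl_teval r U) (cl_teval r V).
Proof.
apply: (@cl_fint_eq R LR N RJoin) => k /=.
by case: (_ == _).
Qed.

Lemma rteval_meet (r : cl_assignment N) U V :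
  cl_teval r (@Bmeet R L U V) = rmeet (cl_teval r U) (cl_teval r V).
Proof.
apply: (@cl_fint_eq R LR N RMeet) => k /=.
by case: (_ == _).
Qed.

Lemma rvalue_diff (r : cl_assignment N) (phi psi : cl_formula LR) :
  cl_value r (Cdiff phi psi) = `|cl_value r phi - cl_value r psi|.
Proof. by rewrite /= !mxE. Qed.

Lemma rvalue_mean (r : cl_assignment N) (phi psi : cl_formula LR) :
  cl_value r (Cmean phi psi) = (cl_value r phi + cl_value r psi) / 2.
Proof. by rewrite /= !mxE. Qed.

Lemma rvalue_compl (r : cl_assignment N) (phi : cl_formula LR) :
  cl_value r (Ccompl phi) = 1 - cl_value r phi.
Proof. by rewrite /= !mxE. Qed.

Lemma rvalue_half (r : cl_assignment N) (phi : cl_formula LR) :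
  cl_value r (Chalf phi) = cl_value r phi / 2.
Proof. by rewrite /= !mxE. Qed.

Lemma rteval_neg (r : cl_assignment N) U : cl_teval r (@Bneg R L U) = rneg (cl_teval r U).
Proof. by []. Qed.

Lemma rteval_Bvar (r : cl_assignment N) i : cl_teval r (Bvar R L i) = r sB i.
Proof. by []. Qed.

Lemma rteval_Kvar (r : cl_assignment N) i : cl_teval r (Kvar R L i) = r sK i.
Proof. by []. Qed.

Lemma rvalue_mu (r : cl_assignment N) U : cl_value r (@mu R L U) = rmu (cl_teval r U).
Proof. by []. Qed.

Lemma rvalue_dB (r : cl_assignment N) U V :
  cl_value r (@dB R L U V) = mdist (cl_teval r U : rbar) (cl_teval r V).
Proof. by []. Qed.

Lemma rvalue_dK (r : cl_assignment N) x y :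
  cl_value r (@dK R L x y) = mdist (cl_teval r x : rkar) (cl_teval r y).
Proof. by []. Qed.

Definition rvalueE := (rvalue_diff, rvalue_mean, rvalue_compl, rvalue_half,
  rvalue_mu, rvalue_dB, rvalue_dK, rteval_top, rteval_bot, rteval_join, rteval_meet,
  rteval_neg, rteval_event, rteval_Bvar, rteval_Kvar).

Lemma rmodelP : cl_model (@randomization R L T) N <->
  forall chi : cl_formula LR, rand_axiom T chi ->
    forall r : cl_assignment N, cl_value r chi = 0.
Proof.
split=> H phi; last by move=> [psi /H Hpsi <-]; apply/cl_value_sup_all.
by move=> Tphi; apply/cl_value_sup_all; apply: (H (cl_closure phi)); exists phi.
Qed.

Lemma randomization_lawsP : cl_model (@randomization R L T) N -> randomization_laws.
Proof.
have [k0] := cl_inh N sK; have [b0] := cl_inh N sB.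
have dK_eq (x y : R) : `|x - y| = 0 <-> x = y.
  by split=> [/eqP|->]; rewrite ?subrr ?normr0// normr_eq0 subr_eq0 => /eqP.
(* [i] is not free in the existential formula, so the update does not reach its event. *)
have fullE (r : cl_assignment N) i phi a : cl_value (@cl_update _ _ N r sK i a)
    (dB (event R phi) (event R (FEx i phi))) =
    mdist (rbr [eta r sK with i |-> a] phi) (rbr (r sK) (FEx i phi)).
  rewrite !rvalueE cl_updateE; congr mdist; apply: rbr_local => j /=.
  by rewrite mem_undup /= mem_filter => /andP[/negbTE->].
have eventE (r : cl_assignment N) a b : cl_value (@cl_update _ _ N (@cl_update _ _ N r sK 0 a) sK 1 b)
    (dB (Bvar R L 0) (event R (FEq (FVar 0) (FVar 1)))) =
    mdist (r sB 0%N : rbar) (rbr (fun i => if i == 0%N then a else b) (FEq (FVar 0) (FVar 1))).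
  rewrite !rvalueE !cl_updateE !cl_update_out//; congr mdist.
  apply: rbr_local => j; rewrite mem_undup /= !inE => /orP[]/eqP->//=.
have atomlessE (r : cl_assignment N) F : cl_value (@cl_update _ _ N r sB 1 F)
    (Cdiff (mu (Bmeet (Bvar R L 0) (Bvar R L 1))) (Chalf (mu (Bvar R L 0)))) =
    `|rmu (rmeet (r sB 0%N) F) - rmu (r sB 0%N) / 2|.
  by rewrite !rvalueE cl_updateE.
move=> /rmodelP H.
have HE (U V : @cl_term R LR sB) : rand_axiom T (dB U V) ->
    forall r : cl_assignment N, cl_teval r U = cl_teval r V.
  by move=> /H ax r; apply/mdist_positivity/ax.
pose r3 (E F G : rbar) := rasg (fun=> k0) (fun i => if i == 0%N then E else if i == 1%N then F else G).
split.
- by move=> rho phi v; have := HE _ _ (rand_valid R T v) (rasg rho (fun=> b0)); rewrite !rvalueE.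
- by move=> rho phi; apply: (HE _ _ (rand_not R T phi) (rasg rho (fun=> b0))).
- by move=> rho phi psi; have := HE _ _ (rand_or R T phi psi) (rasg rho (fun=> b0)); rewrite !rvalueE.
- by move=> rho phi psi; have := HE _ _ (rand_and R T phi psi) (rasg rho (fun=> b0)); rewrite !rvalueE.
- by split=> [x y|x y|x y z|x y z|x y z|x y z|x|x|x|x]; [
    have := HE _ _ (rand_joinC R T) (r3 x y x)|
    have := HE _ _ (rand_meetC R T) (r3 x y x)|
    have := HE _ _ (rand_joinA R T) (r3 x y z)|
    have := HE _ _ (rand_meetA R T) (r3 x y z)|
    have := HE _ _ (rand_joinI R T) (r3 x y z)|
    have := HE _ _ (rand_meetU R T) (r3 x y z)|
    have := HE _ _ (rand_joinx0 R T) (r3 x x x)|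
    have := HE _ _ (rand_meetx1 R T) (r3 x x x)|
    have := HE _ _ (rand_joinxN R T) (r3 x x x)|
    have := HE _ _ (rand_meetxN R T) (r3 x x x)]; rewrite !rvalueE.
- move=> rho i j; have := H _ (rand_dK R T i j) (rasg rho (fun=> b0)).
  by rewrite !rvalueE => /dK_eq.
- move=> E F; have := H _ (rand_dB R T) (r3 E F E).
  by rewrite /Bsymdiff !rvalueE => /dK_eq.
- move=> rho i phi e e0; have := H _ (rand_full R T i phi) (rasg rho (fun=> b0)).
  by move=> /cl_value_eq0/(_ e e0)/cl_value_inf_lt[a]; rewrite fullE; exists a.
- move=> E e e0; have := H _ (rand_event R T) (rasg (fun=> k0) (fun=> E)).
  move=> /cl_value_eq0/(_ e e0)/cl_value_inf_lt[a /cl_value_inf_lt[b]].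
  rewrite eventE => Hab; exists a, b => rho ra rb.
  by rewrite (rbr_local (rho' := fun i => if i == 0%N then a else b))// => -[|[|i]].
- have := H _ (rand_mu1 R T) (rasg (fun=> k0) (fun=> b0)).
  by rewrite !rvalueE => /eqP; rewrite subr_eq0 => /eqP<-.
- have := H _ (rand_mu0 R T) (rasg (fun=> k0) (fun=> b0)).
  by rewrite !rvalueE.
- move=> E F; have := H _ (rand_muUI R T) (r3 E F E).
  rewrite !rvalueE => /dK_eq /(congr1 (fun x => x * 2)).
  by rewrite !divfK ?pnatr_eq0.
- move=> E e e0; have := H _ (rand_atomless R T) (rasg (fun=> k0) (fun=> E)).
  move=> /cl_value_eq0/(_ e e0)/cl_value_inf_lt[F]; rewrite atomlessE.
  by exists F.
- by move=> rho phi Tphi; have := HE _ _ (rand_transfer R Tphi) (rasg rho (fun=> b0)); rewrite !rvalueE.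
Qed.

End RandomizationLaws.

#[local] Opaque rbr rtop rbot rneg rjoin rmeet rmu.

(** * Exact witnesses and prescribed measures in a model of T^R *)

Section RandomizationModel.
Variables (R : realType) (L : fo_signature) (T : fo_theory L).
Variable N : cl_structure (rand_signature R L).
Hypothesis RL : randomization_laws T N.
Implicit Types (rho : nat -> rkar N) (E F G : rbar N) (phi : fo_formula L).
Implicit Types (U : rbar N -> Prop).

Definition rultra U := ultra (@rmeet R L N) (@rneg R L N) (rtop N) U.

Lemma rultra_neg U : rultra U -> forall E, U (rneg E) <-> ~ U E.
Proof. exact: ultra_neg. Qed.

Lemma rultra_meet U : rultra U -> forall E F, U (rmeet E F) <-> U E /\ U F.
Proof. exact: ultra_meet. Qed.

Lemma rultra_join U : rultra U -> forall E F, U (rjoin E F) <-> U E \/ U F.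
Proof. exact: (ultra_join (rl_bool RL)). Qed.

Lemma rultra_top U : rultra U -> U (rtop N) <-> True.
Proof. by move=> HU; split=> // _; apply: ultra_top HU. Qed.

Lemma rultra_bot U : rultra U -> U (rbot N) <-> False.
Proof. exact: (ultra_bot (rl_bool RL)). Qed.

Lemma rultra_symdiff U : rultra U -> forall E F, U (rsymdiff E F) <-> ~ (U E <-> U F).
Proof.
move=> HU E F; rewrite /rsymdiff rultra_join// !rultra_meet// !rultra_neg//.
by have [] := pselect (U E); have [] := pselect (U F); tauto.
Qed.

Lemma rext E F : (forall U, rultra U -> U E <-> U F) -> E = F.
Proof. exact: (ultra_ext (rl_bool RL)). Qed.

Lemma rultra_exists E : E <> rbot N -> exists U, rultra U /\ U E.
Proof. exact: (ultra_exists (rl_bool RL)). Qed.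

(** Order and disjointness are tested on ultrafilters, which keeps their proofs propositional. *)
Definition rle E F := forall U, rultra U -> U E -> U F.
Definition rdisj E F := forall U, rultra U -> U E -> ~ U F.

Lemma rmu_ge0 E : 0 <= rmu E.
Proof. by case/andP: (cl_pint_range (p := tt : cl_pred (rand_signature R L)) (fun=> E)). Qed.

Lemma rmu_disj E F : rdisj E F -> rmu (rjoin E F) = rmu E + rmu F.
Proof.
move=> EF; rewrite (rl_muUI RL) (_ : rmeet E F = rbot N) ?(rl_mu0 RL) ?addr0//.
apply: rext => U HU; rewrite rultra_meet// rultra_bot//; split=> // -[UE].
exact: EF.
Qed.

Lemma rmu_split E F : rmu E = rmu (rmeet E F) + rmu (rmeet E (rneg F)).
Proof.
rewrite -rmu_disj => [|U HU]; last by rewrite !rultra_meet// rultra_neg//; tauto.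
congr rmu; apply: rext => U HU; rewrite rultra_join// !rultra_meet// rultra_neg//.
by have [] := pselect (U F); tauto.
Qed.

Lemma rmu_le E F : rle E F -> rmu E <= rmu F.
Proof.
move=> EF; rewrite (rmu_split F E) (_ : rmeet F E = E) ?lerDl ?rmu_ge0//.
by apply: rext => U HU; rewrite rultra_meet//; have := EF U HU; tauto.
Qed.

Lemma rmu_neg E : rmu (rneg E) = 1 - rmu E.
Proof.
have := rmu_split (rtop N) E; rewrite (rl_mu1 RL).
have -> : rmeet (rtop N) E = E.
  by apply: rext => U HU; rewrite rultra_meet// rultra_top//; tauto.
have -> : rmeet (rtop N) (rneg E) = rneg E.
  by apply: rext => U HU; rewrite rultra_meet// rultra_top//; tauto.
by move=> ->; rewrite addrC addKr.
Qed.

Lemma rmu_le_join E F : rmu (rjoin E F) <= rmu E + rmu F.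
Proof. by rewrite (rl_muUI RL) lerDl rmu_ge0. Qed.

(** [rmu E] is the distance from [E] to [rbot], and this distance is a metric, not only a
    pseudometric. *)
Lemma rmu_eq0 E : rmu E <= 0 -> E = rbot N.
Proof.
move=> E0; apply: mdist_positivity; rewrite (rl_dB RL).
rewrite (_ : rsymdiff _ _ = E); last first.
  by apply: rext => U HU; rewrite rultra_symdiff// rultra_bot//; have [] := pselect (U E); tauto.
by apply/eqP; rewrite eq_le E0 rmu_ge0.
Qed.

Lemma rmu_neg_eq0 E : rmu (rneg E) <= 0 -> E = rtop N.
Proof.
move=> /rmu_eq0 e; apply: rext => U HU; rewrite rultra_top//; split=> // _.
by apply: contrapT => /(rultra_neg HU); rewrite e rultra_bot.
Qed.

Lemma rmu_lipschitz E F : rmu E <= rmu F + mdist E F.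
Proof.
rewrite (rl_dB RL); apply: le_trans (rmu_le_join _ _); apply: rmu_le => U HU.
by rewrite rultra_join// rultra_symdiff//; have [] := pselect (U F); tauto.
Qed.

Lemma rdist_top E : mdist E (rtop N) = rmu (rneg E).
Proof.
rewrite (rl_dB RL); congr rmu; apply: rext => U HU.
by rewrite rultra_symdiff// rultra_top// rultra_neg//; tauto.
Qed.

(** Only equality needs an argument: equal random elements have distance 0, so their equality event
    has measure 1 and is [rtop]. *)
Lemma rtruth U : rultra U -> truth_system (fun rho phi => U (rbr rho phi)).
Proof.
move=> HU; split.
- by move=> rho phi; rewrite (rl_not RL) rultra_neg.
- by move=> rho phi psi; rewrite (rl_or RL) rultra_join.
- by move=> rho phi psi; rewrite (rl_and RL) rultra_meet.
- by move=> rho phi v; rewrite (rl_valid RL)//; apply: ultra_top HU.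
- by move=> rho rho' phi /rbr_local ->.
- move=> rho i j e; have := rl_dK RL rho i j; rewrite e mdistxx => /esym.
  rewrite -rmu_neg => n0; suff -> : rbr rho (FEq (FVar i) (FVar j)) = rtop N.
    exact: ultra_top HU.
  by apply: rmu_neg_eq0; rewrite n0.
Qed.

Lemma rbr_ren rho sg phi : rbr rho (fo_ren sg phi) = rbr (rho \o sg) phi.
Proof. by apply: rext => U HU; apply: (tr_ren (rtruth HU)). Qed.

Definition req (a b : rkar N) := rbr (fun i => if i == 0%N then a else b) (FEq (FVar 0) (FVar 1)).

Lemma rbr_eq rho i j : rbr rho (FEq (FVar i) (FVar j)) = req (rho i) (rho j).
Proof. by apply: rext => U HU; apply: (tr_eqvE (rtruth HU)). Qed.

Lemma req_refl U a : rultra U -> U (req a a).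
Proof. by move=> HU; apply: (tr_eqv_refl (rtruth HU)). Qed.

Lemma req_sym U a b : rultra U -> U (req a b) -> U (req b a).
Proof. by move=> HU; apply: (tr_eqv_sym (rtruth HU)). Qed.

Lemma req_trans U b a c : rultra U -> U (req a b) -> U (req b c) -> U (req a c).
Proof. by move=> HU; apply: (tr_eqv_trans (rtruth HU)). Qed.

Lemma rbr_cong U rho rho' phi : rultra U ->
  (forall i, i \in fo_fv phi -> U (req (rho i) (rho' i))) -> U (rbr rho phi) -> U (rbr rho' phi).
Proof. by move=> HU; apply: (tr_cong (rtruth HU)). Qed.

Lemma rdistE a b : mdist a b = rmu (rneg (req a b)).
Proof.
by rewrite rmu_neg; have := rl_dK RL (fun i => if i == 0%N then a else b) 0 1; rewrite rbr_eq.
Qed.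

Lemma req_lipschitz a b c : mdist (req a c) (req b c) <= mdist a b.
Proof.
rewrite rdistE (rl_dB RL); apply: rmu_le => U HU; rewrite rultra_symdiff// rultra_neg// => H ab.
apply: H; split; last exact: req_trans.
by apply: req_trans => //; apply: req_sym.
Qed.

Lemma rbr_continuous phi e : 0 < e -> exists2 d, 0 < d & forall rho rho',
  (forall i, i \in fo_fv phi -> mdist (rho i) (rho' i) < d) ->
  mdist (rbr rho phi) (rbr rho' phi) <= e.
Proof.
move=> e0; exists (lipschitz_mod (size (fo_fv phi)) e); first exact: lipschitz_mod_gt0.
move=> rho rho' H; apply: (@cl_fint_unif R (rand_signature R L) N (REv phi) e e0) => k.
by apply: H; apply: mem_nth.
Qed.

Lemma rfull_step rho i phi b e : fo_valid (FEx i phi) -> 0 < e ->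
  exists a, rmu (rneg (rbr [eta rho with i |-> a] phi)) < e /\
    mdist b a <= e + rmu (rneg (rbr [eta rho with i |-> b] phi)).
Proof.
move=> v e0; pose j := maxn i.+1 (fo_bound phi).
have ij : (i == j) = false by rewrite ltn_eqF// leq_maxl.
have jphi k : k \in fo_fv phi -> (k == j) = false.
  by move=> /fo_boundP kb; rewrite ltn_eqF// leq_max kb orbT.
(* A witness of [chi] is one of [phi] that keeps the old value [b] wherever [b] already
   works; this makes successive approximate witnesses converge. *)
pose chi := FAnd (fo_imp (fo_ren [eta id with i |-> j] phi) (FEq (FVar i) (FVar j))) phi.
have vchi : fo_valid (FEx i chi).
  move=> M r; have renE (a : M) : fo_holds [eta r with i |-> a] (fo_ren [eta id with i |-> j] phi) <->
      fo_holds [eta r with i |-> r j] phi.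
    rewrite fo_holds_ren; apply: fo_holds_local => k kp /=.
    by case: (k =P i) => [|/eqP/negbTE ->//]; rewrite eq_sym ij.
  have [H|H] := pselect (fo_holds [eta r with i |-> r j] phi).
    by exists (r j); split=> //; apply/fo_holds_imp => _ /=; rewrite eqxx eq_sym ij.
  have [a Ha] := v M r; exists a; split=> //; apply/fo_holds_imp => /renE //.
have [a] := rl_full RL [eta rho with j |-> b] i chi e0.
rewrite (rl_valid RL _ vchi) rdist_top; set E := rbr _ chi => Ee.
have rE c : {in fo_fv phi, [eta [eta rho with j |-> b] with i |-> c] =1 [eta rho with i |-> c]}.
  by move=> k kp /=; rewrite jphi.
have Ephi : rle E (rbr [eta rho with i |-> a] phi).
  move=> U HU; rewrite /E (rl_and RL) (rultra_meet HU) => -[_].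
  by rewrite (rbr_local (rE a)).
have Eeq : rle (rmeet E (rbr [eta rho with i |-> b] phi)) (req b a).
  move=> U HU; rewrite (rultra_meet HU) /E (rl_and RL) (rultra_meet HU) => -[[H _] Hb].
  have TS := rtruth HU.
  have /(tr_or TS)[/(tr_not TS)[]|] := H; last first.
    by rewrite rbr_eq /= eqxx eq_sym ij eqxx; apply: req_sym.
  rewrite rbr_ren (rbr_local (rho' := [eta rho with i |-> b]))// => k kp /=.
  by case: (k =P i) => [|/eqP/negbTE ->]; rewrite ?eqxx ?jphi// eq_sym ij.
exists a; split.
  by apply: le_lt_trans Ee; apply: rmu_le => U HU; rewrite !rultra_neg//; have := Ephi U HU; tauto.
rewrite rdistE; apply: (@le_trans _ _ (rmu (rneg E) + rmu (rneg (rbr [eta rho with i |-> b] phi)))); last first.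
  by rewrite lerD2r ltW.
apply: le_trans (rmu_le_join _ _); apply: rmu_le => U HU.
rewrite rultra_join// !rultra_neg//; have := Eeq U HU; rewrite rultra_meet//.
by have [] := pselect (U E); tauto.
Qed.

(** [b n] fails on measure below [2^-1 ^+ n.+1], so the next witness lies within [2^-1 ^+ n] of it
    and the sequence converges. The event of [phi] depends continuously on its arguments, so the
    limit fails on measure 0. *)
Lemma rfull_valid rho i phi : fo_valid (FEx i phi) ->
  exists a, rbr [eta rho with i |-> a] phi = rtop N.
Proof.
move=> v; have /choice[f fP] : forall bn : rkar N * nat, exists a,
    rmu (rneg (rbr [eta rho with i |-> a] phi)) < 2^-1 ^+ bn.2.+1 /\
    mdist bn.1 a <= 2^-1 ^+ bn.2.+1 + rmu (rneg (rbr [eta rho with i |-> bn.1] phi)).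
  by move=> [b n]; apply: rfull_step => //; apply: half_pow_gt0.
pose b := fix b n := if n is m.+1 then f (b m, m.+1) else f (rho 0%N, 0%N).
have bmu n : rmu (rneg (rbr [eta rho with i |-> b n] phi)) < 2^-1 ^+ n.+1.
  case: n => [|n]; first by have [] := fP (rho 0%N, 0%N).
  by have [] := fP (b n, n.+1).
have [n|y yP] := @cl_seq_complete _ _ N sK b.
  have [_ /= H] := fP (b n, n.+1); apply: le_trans H _; have := bmu n.
  rewrite !exprS; set c := _ ^+ n => /ltW H; apply: le_trans (lerD (lexx _) H) _.
  by have c0 : 0 < c := half_pow_gt0 R n; lra.
exists y; apply: rmu_neg_eq0; apply/ler_addgt0Pl => e e0; rewrite addr0.
have e2 : 0 < e / 2 by lra.
have [d d0 dP] := rbr_continuous phi e2.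
have [n [n1 n2]] : exists n, 2 * 2^-1 ^+ n < d /\ 2^-1 ^+ n.+1 < e / 2 :> R.
  have : ~ (Num.min (d / 2) (e / 2) <= 0).
    by apply/negP; rewrite -ltNge lt_min e2 divr_gt0.
  move=> H; apply: contrapT => /forallNP H'; apply: H; apply: (@geometric_le0 _ _ 1) => n.
  rewrite mul1r leNgt; apply/negP; rewrite lt_min => /andP[h1 h2]; apply: (H' n); split; first by lra.
  rewrite exprS; move: h2; set c := _ ^+ n => h2; have : 0 < c := half_pow_gt0 R n.
  by lra.
have near : mdist (rbr [eta rho with i |-> y] phi) (rbr [eta rho with i |-> b n] phi) <= e / 2.
  apply: dP => k _ /=; case: (k == i); last by rewrite mdistxx.
  by rewrite metric_sym; apply: le_lt_trans (yP n) n1.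
rewrite rmu_neg; have := bmu n; rewrite rmu_neg.
have := rmu_lipschitz (rbr [eta rho with i |-> b n] phi) (rbr [eta rho with i |-> y] phi).
by rewrite metric_sym; lra.
Qed.

(** Some element satisfies [phi] if any does: this implication is valid under its quantifier, which
    reduces the claim to [rfull_valid]. *)
Lemma rfull rho i phi : exists a, rbr [eta rho with i |-> a] phi = rbr rho (FEx i phi).
Proof.
have notin : i \notin fo_fv (FEx i phi) by rewrite mem_undup /= mem_filter eqxx.
have locE (M : fo_structure L) (r : nat -> M) a : fo_holds [eta r with i |-> a] (FEx i phi) <-> fo_holds r (FEx i phi).
  by apply: fo_holds_local => k kp /=; case: (k =P i) kp notin => // -> ->.
have [M r|a Ha] := @rfull_valid rho i (fo_imp (FEx i phi) phi).
  have [[a Ha]|H] := pselect (fo_holds r (FEx i phi)).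
    by exists a; apply/fo_holds_imp.
  by exists (r 0%N); apply/fo_holds_imp; rewrite locE.
exists a; apply: rext => U HU; have TS := rtruth HU.
have loc : rbr [eta rho with i |-> a] (FEx i phi) = rbr rho (FEx i phi).
  by apply: rbr_local => k kp /=; case: (k =P i) kp notin => // -> ->.
rewrite -loc; split=> [|H].
  by apply: (tr_entail TS) => M r H; exists (r i); apply/(fo_holds_local _).1: H => k _ /=; case: eqP => // ->.
have : U (rbr [eta rho with i |-> a] (fo_imp (FEx i phi) phi)) by rewrite Ha; apply: ultra_top HU.
by move=> /(tr_or TS)[/(tr_not TS)|].
Qed.

(** Exact fullness supplies the witnesses that [truth_system_realized] asks for. *)
Lemma rquotient U : rultra U -> exists (M : fo_structure L) (c : rkar N -> M),
  [/\ fo_model T M, forall x, exists a, c a = x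
    & forall rho phi, fo_holds (c \o rho) phi <-> U (rbr rho phi)].
Proof.
move=> HU; have inhK : inhabited (rkar N) := cl_inh N sK.
have ex rho i phi : U (rbr rho (FEx i phi)) -> exists a, U (rbr [eta rho with i |-> a] phi).
  by have [a <-] := rfull rho i phi; exists a.
have [M [c [cs cP]]] := truth_system_realized inhK (rtruth HU) ex.
exists M, c; split=> // phi Tphi r.
have [r' ->] := surj_lift r cs.
by apply/cP; rewrite (rl_transfer RL)//; apply: ultra_top HU.
Qed.

Lemma rbr_model_entail U rho phi psi : rultra U ->
  (forall (M : fo_structure L) (r : nat -> M), fo_model T M -> fo_holds r phi -> fo_holds r psi) ->
  U (rbr rho phi) -> U (rbr rho psi).
Proof.
by move=> HU H; have [M [c [TM _ cP]]] := rquotient HU; rewrite -!cP; apply: H.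
Qed.

(** Definition by cases along an event [[[a = b]]]. It is an instance of fullness, because [phi] can
    always be solved for variable 4. *)
Lemma rbr_select (a b c d : rkar N) : exists x, forall U, rultra U ->
  (U (req a b) -> U (req x c)) /\ (~ U (req a b) -> U (req x d)).
Proof.
pose rho i := if i == 0%N then a else if i == 1%N then b else if i == 2%N then c else d.
pose phi : fo_formula L := FAnd (fo_imp (FEq (FVar 0) (FVar 1)) (FEq (FVar 4) (FVar 2)))
  (fo_imp (FNot (FEq (FVar 0) (FVar 1))) (FEq (FVar 4) (FVar 3))).
have [M r|x Hx] := @rfull_valid rho 4 phi.
  have [e|e] := pselect (r 0%N = r 1%N).
    by exists (r 2%N); split; apply/fo_holds_imp.
  by exists (r 3%N); split; apply/fo_holds_imp.
exists x => U HU; have TS := rtruth HU.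
have : U (rbr [eta rho with 4%N |-> x] phi) by rewrite Hx; apply: ultra_top HU.
move=> /(tr_and TS)[/(tr_or TS)[/(tr_not TS)|] h1 /(tr_or TS)[/(tr_not TS)|] h2];
  move: h1 h2; rewrite ?(rl_not RL) ?rultra_neg// !rbr_eq /=; tauto.
Qed.

Hypothesis T_nontrivial : forall M : fo_structure L, fo_model T M -> exists x y : M, x <> y.

Lemma rdistinct : exists c d : rkar N, forall U, rultra U -> ~ U (req c d).
Proof.
have [k0] := cl_inh N sK; pose rho (i : nat) : rkar N := k0.
pose phi : fo_formula L := FNot (FEq (FVar 0) (FVar 1)).
have [c Hc] := rfull rho 0 (FEx 1 phi); have [d Hd] := rfull [eta rho with 0%N |-> c] 1 phi.
exists c, d => U HU; have [M [q [TM qs qP]]] := rquotient HU.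
have : U (rbr rho (FEx 0 (FEx 1 phi))).
  by apply/qP; have [x [y xy]] := T_nontrivial TM; exists x, y.
by rewrite -Hc -Hd (rl_not RL) rultra_neg// rbr_eq.
Qed.

(** The axiom gives events [[[a = b]]] tending to [E], but [a] and [b] need not converge. Each pair
    is replaced by one random element with the two values [c] and [d] only; the distance between two
    such elements is the distance between their events, so these do converge. *)
Lemma revent c d E : (forall U, rultra U -> ~ U (req c d)) ->
  exists x, forall U, rultra U -> U E <-> U (req x c).
Proof.
move=> cd; have /choice[x xP] : forall n, exists x, mdist E (req x c) < 2^-1 ^+ n.+1 /\
    forall U, rultra U -> ~ U (req x c) -> U (req x d).
  move=> n; have [a [b H]] := rl_event RL E (half_pow_gt0 R n.+1).
  have {}H := H (fun i => if i == 0%N then a else b) erefl erefl.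
  have [x xP] := rbr_select a b c d; exists x.
  have xE U : rultra U -> U (req x c) <-> U (req a b).
    move=> HU; have [h1 h2] := xP U HU; split=> // xc; apply: contrapT => /h2 xd.
    by apply: (cd U HU); apply: req_trans xd => //; apply: req_sym.
  split; first by rewrite (_ : req x c = req a b)//; apply: rext.
  by move=> U HU; rewrite xE// => /(xP U HU).2.
have [n|y yP] := @cl_seq_complete _ _ N sK x.
  have [h1 g1] := xP n; have [h2 g2] := xP n.+1.
  apply: (@le_trans _ _ (mdist (req (x n) c) (req (x n.+1) c))).
    rewrite rdistE (rl_dB RL); apply: rmu_le => U HU; rewrite rultra_symdiff// rultra_neg//.
    move=> ne eqc; apply: ne.
    have [c1|c1] := pselect (U (req (x n) c)).
      by apply: (req_trans HU c1); apply: req_sym => //; apply/eqc.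
    apply: (req_trans HU (g1 U HU c1)); apply: req_sym => //; apply: g2 => //.
    by rewrite -eqc.
  apply: le_trans (metric_triangle _ E _) _; rewrite metric_sym.
  apply: le_trans (lerD (ltW h1) (ltW h2)) _; rewrite !exprS; set q := _ ^+ n.
  by have q0 : 0 < q := half_pow_gt0 R n; lra.
exists y; suff -> : E = req y c by [].
apply: mdist_positivity; apply/eqP; rewrite eq_le mdist_ge0 andbT.
apply: (@geometric_le0 _ _ 3) => n; apply: le_trans (metric_triangle _ (req (x n) c) _) _.
have [h1 _] := xP n; apply: le_trans (lerD (ltW h1) (le_trans (req_lipschitz _ _ _) (yP n))) _.
rewrite exprS; set q := _ ^+ n.
by have q0 : 0 < q := half_pow_gt0 R n; lra.
Qed.

(** Once [E] is written as an equation, [rbr_select] cuts along it. *)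
Lemma rglue E (x y : rkar N) : exists z, forall U, rultra U ->
  (U E -> U (req z x)) /\ (~ U E -> U (req z y)).
Proof.
have [c [d cd]] := rdistinct; have [e eP] := revent E cd.
have [z zP] := rbr_select e c x y; exists z => U HU; rewrite (eP U HU); exact: zP.
Qed.

(** The axiom halves only approximately; an error of [rmu G / 6] leaves both parts between one third
    and two thirds of [G]. *)
Lemma rthird G : exists H, [/\ rle H G, rmu H <= 2 / 3 * rmu G & rmu (rmeet G (rneg H)) <= 2 / 3 * rmu G].
Proof.
have [G0|G0] := leP (rmu G) 0.
  exists G; have -> : G = rbot N by apply: rmu_eq0.
  split=> //; rewrite ?(rl_mu0 RL) ?mulr0// (_ : rmeet _ _ = rbot N) ?(rl_mu0 RL)//.
  by apply: rext => U HU; rewrite rultra_meet// rultra_neg// rultra_bot//; tauto.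
have e0 : 0 < rmu G / 6 by rewrite divr_gt0.
have [F] := rl_atomless RL G e0; rewrite ltr_distl => /andP[h1 h2].
have := rmu_split G F; exists (rmeet G F); split; first by move=> U HU /(rultra_meet HU)[].
  by lra.
rewrite (_ : rmeet G (rneg (rmeet G F)) = rmeet G (rneg F)); first by lra.
by apply: rext => U HU; rewrite !(rultra_meet HU, rultra_neg HU); tauto.
Qed.

Lemma rsplit E r : 0 <= r <= rmu E -> exists2 F, rle F E & rmu F = r.
Proof.
move=> /andP[r0 rE].
(* Greedy bisection: [F] is the part chosen so far, [G] a reservoir of vanishing measure. *)
pose P (FG : rbar N * rbar N) := [/\ rle FG.1 E, rle FG.2 E, rdisj FG.1 FG.2,
  rmu FG.1 <= r & r <= rmu FG.1 + rmu FG.2].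
pose Q (FG FG' : rbar N * rbar N) (q : R) := [/\ rle FG.1 FG'.1, rle FG'.1 (rjoin FG.1 FG.2),
  rle FG'.2 FG.2 & rmu FG'.2 <= q * rmu FG.2].
have step FG : P FG -> exists FG', P FG' /\ Q FG FG' (2 / 3).
  case: FG => F G [/= FE GE FG Fr rFG]; have [H [HG h1 h2]] := rthird G.
  have FH : rdisj F H by move=> U HU UF /(HG U HU); apply: FG.
  (* If [H] fits below [r], it joins [F] and the rest of [G] is the new reservoir; otherwise [H] is
     the new reservoir. *)
  have [le|lt] := leP (rmu F + rmu H) r.
    exists (rjoin F H, rmeet G (rneg H)); split; split=> //=.
    - by move=> U HU /(rultra_join HU)[/(FE U HU)|/(HG U HU)/(GE U HU)].
    - by move=> U HU /(rultra_meet HU)[/(GE U HU)].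
    - move=> U HU /(rultra_join HU)[UF|UH] /(rultra_meet HU)[]; first by move=> /(FG U HU UF).
      by move=> _ /(rultra_neg HU).
    - by rewrite rmu_disj.
    - rewrite rmu_disj// -addrA (_ : rmu H = rmu (rmeet G H)) -?rmu_split//.
      by congr rmu; apply: rext => U HU; rewrite rultra_meet//; have := HG U HU; tauto.
    - by move=> U HU UF; apply/(rultra_join HU); left.
    - by move=> U HU; rewrite !rultra_join//; have := HG U HU; tauto.
    - by move=> U HU /(rultra_meet HU)[].
  exists (F, H); split; split=> //=.
  - by move=> U HU /(HG U HU)/(GE U HU).
  - exact: ltW.
  - by move=> U HU UF; apply/(rultra_join HU); left.
(* Two steps multiply the reservoir by at most [4 / 9], below the [1 / 2] that [cl_seq_complete] is
   tuned to. *)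
have {}step FG : exists FG', P FG -> P FG' /\ Q FG FG' 2^-1.
  have [PFG|nP] := pselect (P FG); last by exists FG.
  have [FG1 [P1 [a1 a2 a3 a4]]] := step _ PFG; have [FG2 [P2 [b1 b2 b3 b4]]] := step _ P1.
  exists FG2 => _; split=> //; split.
  - by move=> U HU /(a1 U HU)/(b1 U HU).
  - by move=> U HU /(b2 U HU)/(rultra_join HU)[/(a2 U HU)//|/(a3 U HU) h]; apply/(rultra_join HU); right.
  - by move=> U HU /(b3 U HU)/(a3 U HU).
  - by have := rmu_ge0 FG.2; lra.
have [f fP] := choice step.
pose s n := iter n f (rbot N, E).
have sP n : P (s n).
  elim: n => [|n IH]; last by have [] := fP _ IH.
  split=> //=; rewrite ?(rl_mu0 RL) ?add0r//; move=> U HU; rewrite rultra_bot//.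
have sQ n : Q (s n) (s n.+1) 2^-1 by have [] := fP _ (sP n).
have E1 : rmu E <= 1.
  by rewrite -(rl_mu1 RL); apply: rmu_le => U HU _; rewrite rultra_top.
have sG n : rmu (s n).2 <= 2^-1 ^+ n.
  elim: n => [|n IH]; first by rewrite expr0.
  have [_ _ _ h] := sQ n; apply: le_trans h _; rewrite exprS.
  by rewrite ler_pM2l// invr_gt0.
have [n|F FP] := @cl_seq_complete _ _ N sB (fun n => (s n).1).
  apply: le_trans (sG n); rewrite (rl_dB RL); have [h1 h2 _ _] := sQ n.
  apply: rmu_le => U HU; rewrite rultra_symdiff//; have := h1 U HU; have := h2 U HU.
  rewrite rultra_join//; have [] := pselect (U (s n).1).
    by have [] := pselect (U (s n.+1).1); tauto.
  by have [] := pselect (U (s n.+1).1); tauto.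
exists F.
  have -> : F = rmeet F E; last by move=> U HU /(rultra_meet HU)[].
  (* The part of the limit outside [E] lies in the difference between the limit and each
     approximation, so it is null. *)
  have z : rmeet F (rneg E) = rbot N.
    apply: rmu_eq0; apply: (@geometric_le0 _ _ 2) => n; apply: le_trans (FP n).
    rewrite (rl_dB RL); have [h _ _ _ _] := sP n.
    apply: rmu_le => U HU; rewrite rultra_symdiff// rultra_meet// rultra_neg//.
    by have := h U HU; tauto.
  apply: rext => U HU; rewrite rultra_meet//; split=> [UF|[]//]; split=> //.
  apply: contrapT => nE; apply/(rultra_bot HU); rewrite -z rultra_meet// rultra_neg//.
have F1 n := rmu_lipschitz F (s n).1; have F2 n := rmu_lipschitz (s n).1 F.
apply/eqP; rewrite -subr_eq0 -normr_le0; apply: (@geometric_le0 _ _ 3) => n.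
have [_ _ _ h1 h2] := sP n; have := F1 n; have := F2 n; have := FP n; have := sG n.
rewrite (metric_sym F) ler_norml; set q := _ ^+ n => h3 h4 h5 h6.
by apply/andP; split; lra.
Qed.

End RandomizationModel.

(** * Matching types of random elements *)
Lemma eta_with_id (X : Type) (r : nat -> X) n i : [eta r with n |-> r n] i = r i.
Proof. by rewrite /=; case: eqP => [->|]. Qed.

Section FinitePartitions.
Variables (R : realType) (L : fo_signature) (T : fo_theory L).
Variable N : cl_structure (rand_signature R L).
Hypothesis RL : randomization_laws T N.
Variable I : finType.
Implicit Types (E F : rbar N) (s : seq I) (G : I -> rbar N) (U : rbar N -> Prop).

Definition rjoins s G := foldr (@rjoin R L N) (rbot N) (map G s).

Lemma rultra_joins U s G : rultra U -> U (rjoins s G) <-> exists2 i, i \in s & U (G i).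
Proof.
move=> HU; elim: s => [|x s IH] /=; first by rewrite (rultra_bot RL HU); split=> // -[].
rewrite (rultra_join RL HU) IH; split=> [[Ux|[i si Ui]]|[i]].
- by exists x; rewrite ?inE ?eqxx.
- by exists i; rewrite // inE si orbT.
- by rewrite inE => /orP[/eqP->|si Ui]; [left|right; exists i].
Qed.

Definition rpairwise s G :=
  forall U i j, rultra U -> i \in s -> j \in s -> U (G i) -> U (G j) -> i = j.

Lemma rmu_joins s G E : uniq s -> rpairwise s G ->
  rmu (rmeet E (rjoins s G)) = \sum_(i <- s) rmu (rmeet E (G i)).
Proof.
elim: s => [|x s IH] /=.
  move=> _ _; rewrite big_nil (_ : rmeet _ _ = rbot N) ?(rl_mu0 RL)//.
  apply: (rext RL) => U HU; rewrite (rultra_meet HU) /rjoins/= (rultra_bot RL HU); tauto.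
move=> /andP[xs us] disj; rewrite big_cons -IH//; last first.
  by move=> U i j HU si sj; apply: disj => //; rewrite inE ?si ?sj orbT.
rewrite -(rmu_disj RL).
  congr rmu; apply: (rext RL) => U HU.
  by rewrite (rultra_join RL HU) !(rultra_meet HU) (rultra_join RL HU); tauto.
move=> U HU; rewrite !(rultra_meet HU) => -[_ Ux] [_ /(rultra_joins s G HU)[i si Ui]].
have xi : x = i by apply: (disj U) => //; rewrite inE ?eqxx ?si ?orbT.
by rewrite xi si in xs.
Qed.

Lemma rmu_partition G E : rpairwise (enum I) G ->
  (forall U, rultra U -> exists i, U (G i)) -> rmu E = \sum_i rmu (rmeet E (G i)).
Proof.
move=> disj cov; rewrite -[RHS]big_enum/= -rmu_joins ?enum_uniq//; congr rmu.
apply: (rext RL) => U HU; rewrite (rultra_meet HU) rultra_joins//; split=> [UE|[]//].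
by split=> //; have [i Ui] := cov U HU; exists i => //; rewrite mem_enum.
Qed.

(** The pieces are cut by [rsplit] one at a time, each from what the others leave of [E]. *)
Lemma rsplits (p : I -> R) s E : uniq s -> (forall i, 0 <= p i) ->
  \sum_(i <- s) p i <= rmu E ->
  exists G, [/\ forall i, i \in s -> rle (G i) E, forall i, i \in s -> rmu (G i) = p i & rpairwise s G].
Proof.
move=> + p0; elim: s => [|x s IH] /=; first by exists (fun=> E); split.
move=> /andP[xs us]; rewrite big_cons => ple.
have [|G [GE Gp Gd]] := IH us; first by apply: le_trans ple; rewrite lerDr.
pose H := rmeet E (rneg (rjoins s G)).
have HE : rmu (rmeet E (rjoins s G)) = \sum_(i <- s) p i.
  rewrite rmu_joins//; apply: eq_big_seq => i si; rewrite -Gp//; congr rmu.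
  by apply: (rext RL) => U HU; rewrite (rultra_meet HU); have := GE i si U HU; tauto.
have [|F FH Fp] := @rsplit _ _ _ _ RL H (p x).
  by rewrite p0 /=; have := rmu_split RL E (rjoins s G); rewrite HE -/H; lra.
have Gx i : i \in s -> (i == x) = false by move=> si; apply/eqP => ix; rewrite -ix si in xs.
exists [eta G with x |-> F]; split.
- move=> i; rewrite inE /= => /orP[/eqP->|si]; last by rewrite Gx//; apply: GE.
  by rewrite eqxx => U HU /(FH U HU)/(rultra_meet HU)[].
- by move=> i; rewrite inE /= => /orP[/eqP->|si]; [rewrite eqxx|rewrite Gx// Gp].
- have sep U i : rultra U -> i \in s -> U (G i) -> U F -> False.
    move=> HU si Ui /(FH U HU)/(rultra_meet HU)[_ /(rultra_neg HU)]; apply.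
    by apply/rultra_joins => //; exists i.
  move=> U i j HU; rewrite !inE => /orP[/eqP->|si] /orP[/eqP->|sj] //=;
    rewrite ?eqxx ?Gx//.
  + by move=> UF Uj; case: (sep U j HU sj Uj UF).
  + by move=> Ui UF; case: (sep U i HU si Ui UF).
  + exact: Gd.
Qed.

Hypothesis T_nontrivial : forall M : fo_structure L, fo_model T M -> exists x y : M, x <> y.

Lemma rglues G (b : I -> rkar N) s : rpairwise s G ->
  exists z, forall U i, rultra U -> i \in s -> U (G i) -> U (req z (b i)).
Proof.
elim: s => [|x s IH] disj.
  by have [k0] := cl_inh N sK; exists k0.
have [|z0 z0P] := IH; first by move=> U i j HU si sj; apply: disj => //; rewrite inE ?si ?sj orbT.
have [z zP] := rglue RL T_nontrivial (G x) (b x) z0; exists z => U i HU si Ui.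
have [h1 h2] := zP U HU; have [Ux|nUx] := pselect (U (G x)).
  by rewrite (disj U i x HU si _ Ui Ux) ?inE ?eqxx//; apply: h1.
apply: (req_trans RL HU (h2 nUx)); apply: z0P => //.
by move: si; rewrite inE => /orP[/eqP ix|//]; rewrite ix in Ui.
Qed.

End FinitePartitions.

(** Equality of the distributions that the two tuples induce on the types of T; by [rvalue_eq] these
    determine the values of continuous formulas. *)
Definition rsame (R : realType) (L : fo_signature) (N N' : cl_structure (rand_signature R L))
    (D : nat -> Prop) (rho : nat -> rkar N) (rho' : nat -> rkar N') :=
  forall phi : fo_formula L, (forall i, i \in fo_fv phi -> D i) ->
    rmu (rbr rho phi) = rmu (rbr rho' phi).

Section Extension.
Variables (R : realType) (L : fo_signature) (T : fo_theory L).
Variables N N' : cl_structure (rand_signature R L).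
Hypotheses (RL : randomization_laws T N) (RL' : randomization_laws T N').
Hypothesis T_nontrivial : forall M : fo_structure L, fo_model T M -> exists x y : M, x <> y.
Hypothesis RN : forall n, exists k (theta : 'I_k -> fo_formula L), isolating_family T n theta.

Lemma rbr_isolating n k (theta : 'I_k -> fo_formula L) (P : cl_structure (rand_signature R L))
    (PL : randomization_laws T P) (rho : nat -> rkar P) : isolating_family T n theta ->
  rpairwise (enum 'I_k) (fun j => rbr rho (theta j)) /\
  forall U, rultra U -> exists j, U (rbr rho (theta j)).
Proof.
move=> [_ cov disj _]; split=> [U i j HU _ _|U HU]; have [M [c [TM _ cP]]] := rquotient PL HU.
  by rewrite -!cP; apply: disj.
by have [j Hj] := cov M (c \o rho) TM; exists j; apply/cP.
Qed.

(** In [N] the type of the longer tuple divides each event of [psi i] into parts of measures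
    [p (i, j)]. The event of [psi i] in [N'] is cut in the same way, and the new element is glued
    from witnesses on the parts. *)
Lemma rsame_extend n rho rho' (a : rkar N) : rsame (fun i => (i < n)%N) rho rho' ->
  exists b : rkar N', rsame (fun i => (i < n.+1)%N) [eta rho with n |-> a] [eta rho' with n |-> b].
Proof.
move=> same; have [l [psi psiI]] := RN n; have [k [theta thetaI]] := RN n.+1.
have [pfv pcov pdisj pdec] := psiI; have [tfv tcov tdisj tdec] := thetaI.
(* The pair records the event of [psi i] to be cut; incompatible pairs simply get measure 0. *)
pose chi (ij : 'I_l * 'I_k) := FAnd (psi ij.1) (theta ij.2).
have updp (P : cl_structure (rand_signature R L)) (r : nat -> rkar P) x i :
    rbr [eta r with n |-> x] (psi i) = rbr r (psi i).
  by apply: rbr_local => j /pfv jn /=; rewrite ltn_eqF.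
have chiI (P : cl_structure (rand_signature R L)) (PL : randomization_laws T P) (r : nat -> rkar P) :
    rpairwise (enum {: 'I_l * 'I_k}) (fun ij => rbr r (chi ij)) /\
    forall U, rultra U -> exists ij, U (rbr r (chi ij)).
  have [d1 c1] := rbr_isolating PL r psiI; have [d2 c2] := rbr_isolating PL r thetaI.
  split=> [U [i j] [i' j'] HU _ _|U HU].
    rewrite !(rl_and PL) !(rultra_meet HU) => -[/= Ui Uj] [Ui' Uj'].
    by rewrite (d1 U i i') ?mem_enum// (d2 U j j') ?mem_enum.
  have [i Ui] := c1 U HU; have [j Uj] := c2 U HU; exists (i, j).
  by rewrite (rl_and PL) (rultra_meet HU).
pose ra := [eta rho with n |-> a].
pose p ij := rmu (rbr ra (chi ij)).
have p_ge0 ij : 0 <= p ij by apply: rmu_ge0.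
have /choice[G GP] : forall i, exists G : 'I_k -> rbar N',
    [/\ forall j, rle (G j) (rbr rho' (psi i)), forall j, rmu (G j) = p (i, j)
      & rpairwise (enum 'I_k) G].
  move=> i; have [|G [h1 h2 h3]] := rsplits RL' (p := fun j => p (i, j)) (enum_uniq 'I_k)
      (fun j => p_ge0 (i, j)) (E := rbr rho' (psi i)).
    have [d2 c2] := rbr_isolating RL ra thetaI.
    rewrite big_enum -same ?(rmu_partition RL (rbr rho (psi i)) d2 c2)//; last exact: pfv.
    by apply: ler_sum => j _; rewrite /p /chi (rl_and RL) updp.
  by exists G; split=> // j; [apply: h1|apply: h2]; rewrite mem_enum.
pose G2 (ij : 'I_l * 'I_k) := G ij.1 ij.2.
have G2d : rpairwise (enum {: 'I_l * 'I_k}) G2.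
  move=> U [i j] [i' j'] HU _ _ /= Uij Uij'.
  have [h1 _ h3] := GP i; have [h1' _ _] := GP i'.
  have [d1 _] := rbr_isolating RL' rho' psiI.
  have ii : i = i' by apply: (d1 U) => //; rewrite ?mem_enum//; [apply: h1 Uij|apply: h1' Uij'].
  move: Uij'; rewrite -ii => Uij'; rewrite (h3 U j j')// mem_enum//.
have /choice[b bP] : forall ij, exists b, rbr [eta rho' with n |-> b] (chi ij) = rbr rho' (FEx n (chi ij)).
  by move=> ij; apply: (rfull RL').
have [z zP] := rglues RL' T_nontrivial b G2d.
pose rz := [eta rho' with n |-> z].
(* A nonempty part has [p (i, j) > 0], so [chi (i, j)] is realized in a quotient of [N]. Since
   [psi i] decides whether [chi (i, j)] has a solution in [x_n], it implies this, in [N'] too. *)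
have Gle ij : rle (G2 ij) (rbr rz (chi ij)).
  move=> U HU UG; case: ij => i j in UG *; have [h1 h2 _] := GP i.
  have Uex : U (rbr rho' (FEx n (chi (i, j)))).
    have pij : rbr ra (chi (i, j)) <> rbot N.
      move=> e; have : rmu (G i j) <= 0 by rewrite h2 /p e (rl_mu0 RL).
      by move=> /(rmu_eq0 RL') Gb; move: UG; rewrite /G2 /= Gb (rultra_bot RL' HU).
    have [V [HV Vchi]] := rultra_exists RL pij; have [M [c [TM _ cP]]] := rquotient RL HV.
    have cchi : fo_holds (c \o ra) (chi (i, j)) by apply/cP.
    have exfv q : q \in fo_fv (FEx n (chi (i, j))) -> (q < n)%N.
      rewrite mem_undup /= mem_filter mem_cat -!(mem_undup (fo_free_occ _)) => /andP[qn /orP[/pfv//|/tfv]].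
      by rewrite ltnS leq_eqVlt (negbTE qn).
    have [H|H] := pdec i (FEx n (chi (i, j))) exfv; last first.
      exfalso; apply: (H M (c \o ra) TM cchi.1); exists ((c \o ra) n).
      apply/(fo_holds_local _).1: cchi => q _.
      by rewrite eta_with_id.
    by apply: (rbr_model_entail RL' HU H); apply: h1 UG.
  rewrite -bP in Uex; apply: (rbr_cong RL' HU _ Uex) => q _ /=.
  case: (q == n); last exact: (req_refl RL').
  by apply: (req_sym RL' HU); apply: zP => //; rewrite mem_enum.
have [da ca] := chiI N RL ra; have [dz cz] := chiI N' RL' rz.
have sum1 : \sum_ij p ij = 1.
  rewrite -(rl_mu1 RL) (rmu_partition RL (rtop N) da ca); apply: eq_bigr => ij _.
  congr rmu; apply: (rext RL) => U HU; rewrite (rultra_meet HU) (rultra_top HU); tauto.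
have sum1' : \sum_ij rmu (rbr rz (chi ij)) = 1.
  rewrite -(rl_mu1 RL') (rmu_partition RL' (rtop N') dz cz); apply: eq_bigr => ij _.
  congr rmu; apply: (rext RL') => U HU; rewrite (rultra_meet HU) (rultra_top HU); tauto.
(* One inequality holds for each pair and both families sum to 1, so all are equalities. *)
have pz ij : rmu (rbr rz (chi ij)) = p ij.
  have ge q : p q <= rmu (rbr rz (chi q)).
    by case: q => i j; have [_ h2 _] := GP i; rewrite -h2; apply: (rmu_le RL'); apply: (Gle (i, j)).
  apply/eqP; rewrite eq_le ge andbT.
  have := sum1'; rewrite -sum1 (bigD1 ij)//= [RHS](bigD1 ij)//= => e.
  have : \sum_(q | q != ij) p q <= \sum_(q | q != ij) rmu (rbr rz (chi q)) by apply: ler_sum.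
  by lra.
exists z => phi phifv; rewrite (rmu_partition RL _ da ca) (rmu_partition RL' _ dz cz).
apply: eq_bigr => ij _; have [H|H] := tdec ij.2 phi phifv.
  transitivity (p ij); last rewrite -pz; congr rmu.
    apply: (rext RL) => U HU; rewrite (rultra_meet HU); split=> [[]//|Uc]; split=> //.
    by apply: (rbr_model_entail RL HU H); move: Uc; rewrite (rl_and RL) (rultra_meet HU) => -[].
  apply: (rext RL') => U HU; rewrite (rultra_meet HU); split=> [Uc|[]//]; split=> //.
  by apply: (rbr_model_entail RL' HU H); move: Uc; rewrite (rl_and RL') (rultra_meet HU) => -[].
transitivity (0 : R).
  rewrite (_ : rmeet _ _ = rbot N) ?(rl_mu0 RL)//.
  apply: (rext RL) => U HU; rewrite (rultra_meet HU) (rultra_bot RL HU); split=> // -[Up].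
  rewrite (rl_and RL) (rultra_meet HU) => -[_ Ut].
  move: Up; apply/(rultra_neg HU); rewrite -(rl_not RL).
  exact: (rbr_model_entail RL HU (psi := FNot phi) H).
apply/esym; rewrite (_ : rmeet _ _ = rbot N') ?(rl_mu0 RL')//.
apply: (rext RL') => U HU; rewrite (rultra_meet HU) (rultra_bot RL' HU); split=> // -[Up].
rewrite (rl_and RL') (rultra_meet HU) => -[_ Ut].
move: Up; apply/(rultra_neg HU); rewrite -(rl_not RL').
exact: (rbr_model_entail RL' HU (psi := FNot phi) H).
Qed.

(** No variable is below 0, so only sentences are compared; a complete theory makes their events
    [rtop] or [rbot]. *)
Lemma rsame0 rho rho' : fo_complete T -> @rsame R L N N' (fun i => (i < 0)%N) rho rho'.
Proof.
move=> [_ Tdec] phi phifv.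
have sent : fo_fv phi == [::].
  by case E : (fo_fv phi) => [//|i l]; have := phifv i; rewrite E inE eqxx => /(_ isT).
have [H|H] := Tdec (exist (fun psi => fo_fv psi == [::]) phi sent).
  have Top (P : cl_structure (rand_signature R L)) (PL : randomization_laws T P) r : rbr r phi = rtop P.
    apply: (rext PL) => U HU; rewrite (rultra_top HU); split=> // _.
    by have [M [c [TM _ cP]]] := rquotient PL HU; apply/cP; apply: (H M TM).
  by rewrite (Top N RL) (Top N' RL') (rl_mu1 RL) (rl_mu1 RL').
have Bot (P : cl_structure (rand_signature R L)) (PL : randomization_laws T P) r : rbr r phi = rbot P.
  apply: (rext PL) => U HU; rewrite (rultra_bot PL HU); split=> //.
  by have [M [c [TM _ cP]]] := rquotient PL HU; move=> /cP; apply: (H M TM).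
by rewrite (Bot N RL) (Bot N' RL') (rl_mu0 RL) (rl_mu0 RL').
Qed.

End Extension.

(** * Back-and-forth between models of T^R *)

Section Correspondence.
Variables (R : realType) (L : fo_signature) (T : fo_theory L).
Let LR : cl_signature R := rand_signature R L.

(** Events correspond through a common formula over matched random elements, so only random elements
    have to be matched by hand. [D] is an initial segment during the construction and everything at
    its end. *)
Definition rrel (N N' : cl_structure LR) (D : nat -> Prop) (rho : nat -> rkar N) (rho' : nat -> rkar N')
    (s : rand_sort) : @cl_car R LR N s -> @cl_car R LR N' s -> Prop :=
  match s return @cl_car R LR N s -> @cl_car R LR N' s -> Prop with
  | sK => fun x x' => exists m, [/\ D m, x = rho m & x' = rho' m]
  | sB => fun E E' => exists chi : fo_formula L,
      [/\ forall i, i \in fo_fv chi -> D i, E = rbr rho chi & E' = rbr rho' chi]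
  end.

Lemma rrel_sym N N' D rho rho' s x y : @rrel N N' D rho rho' s x y -> @rrel N' N D rho' rho s y x.
Proof. by case: s x y => x y [z [h1 h2 h3]]; exists z. Qed.

Section Fixed.
Variables N N' : cl_structure LR.
Hypotheses (RL : randomization_laws T N) (RL' : randomization_laws T N').
Variables (D : nat -> Prop) (rho : nat -> rkar N) (rho' : nat -> rkar N').
Hypothesis same : rsame D rho rho'.

Local Notation rrel0 := (@rrel N N' D rho rho').

Lemma rrel_isometric s (x : N s) (y : N' s) x' y' : rrel0 x y -> rrel0 x' y' -> mdist x x' = mdist y y'.
Proof.
case: s x y x' y' => x y x' y' /= [m [Dm -> ->]] [m' [Dm' -> ->]].
  rewrite (rl_dK RL) (rl_dK RL') same// => i; rewrite mem_undup /= !inE.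
  by move=> /orP[]/eqP->.
rewrite (rl_dB RL) (rl_dB RL') /rsymdiff.
have := @same (FOr (FAnd m (FNot m')) (FAnd (FNot m) m')).
rewrite !(rl_or RL) !(rl_and RL) !(rl_not RL) !(rl_or RL') !(rl_and RL') !(rl_not RL'); apply.
by move=> i; rewrite mem_undup /= !mem_cat -!(mem_undup (fo_free_occ _)) => /orP[]/orP[/Dm|/Dm'].
Qed.

(** Definable events are closed under every symbol: for [REv phi] the free variables are renamed to
    the indices of the arguments, and the Boolean operations are connectives. *)
Lemma rrel_fint (f : cl_fun LR) x y : (forall k, rrel0 (x k) (y k)) ->
  rrel0 (@cl_fint R LR N f x) (@cl_fint R LR N' f y).
Proof.
case: f x y => [phi|||||] x y H /=.
- have /choice[m mP] : forall k : 'I_(size (fo_fv phi)), exists m, [/\ D m, x k = rho m & y k = rho' m].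
    exact: H.
  pose sg i := if insub (index i (fo_fv phi)) is Some k then m k else 0%N.
  have sgE (k : 'I_(size (fo_fv phi))) : sg (nth 0%N (fo_fv phi) k) = m k.
    by rewrite /sg index_uniq ?undup_uniq// valK.
  exists (fo_ren sg phi); split.
  - move=> i /fo_fv_ren[j jp ->]; have jlt : (index j (fo_fv phi) < size (fo_fv phi))%N by rewrite index_mem.
    by rewrite /sg insubT; have [] := mP (Ordinal jlt).
  - rewrite (rbr_ren RL); apply: rfint_ev => k /=.
    by rewrite sgE; have [_ ->] := mP k.
  - rewrite (rbr_ren RL'); apply: rfint_ev => k /=.
    by rewrite sgE; have [_ _ ->] := mP k.
- exists (fo_top L); split; first by move=> i; rewrite mem_undup.
    by rewrite rfint_top (rl_valid RL)// => M r; apply: fo_holds_top.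
  by rewrite rfint_top (rl_valid RL')// => M r; apply: fo_holds_top.
- exists (FNot (fo_top L)); split; first by move=> i; rewrite mem_undup.
    rewrite rfint_bot (rl_not RL) (rl_valid RL); last by move=> M r; apply: fo_holds_top.
    by apply: (rext RL) => U HU; rewrite (rultra_bot RL HU) (rultra_neg HU) (rultra_top HU); tauto.
  rewrite rfint_bot (rl_not RL') (rl_valid RL'); last by move=> M r; apply: fo_holds_top.
  by apply: (rext RL') => U HU; rewrite (rultra_bot RL' HU) (rultra_neg HU) (rultra_top HU); tauto.
- have [c [h1 h2 h3]] := H ord0; exists (FNot c).
  by rewrite (rl_not RL) (rl_not RL') (@rfint_neg R L N x) (@rfint_neg R L N' y) h2 h3.
- have [c [h1 h2 h3]] := H ord0; have [c' [h1' h2' h3']] := H (lift ord0 ord0); exists (FOr c c').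
  rewrite (rl_or RL) (rl_or RL') (@rfint_join R L N x) (@rfint_join R L N' y) h2 h3 h2' h3'; split=> //.
  by move=> i; rewrite mem_undup /= mem_cat -!(mem_undup (fo_free_occ _)) => /orP[/h1|/h1'].
- have [c [h1 h2 h3]] := H ord0; have [c' [h1' h2' h3']] := H (lift ord0 ord0); exists (FAnd c c').
  rewrite (rl_and RL) (rl_and RL') (@rfint_meet R L N x) (@rfint_meet R L N' y) h2 h3 h2' h3'; split=> //.
  by move=> i; rewrite mem_undup /= mem_cat -!(mem_undup (fo_free_occ _)) => /orP[/h1|/h1'].
Qed.

Lemma rrel_pint (p : cl_pred LR) x y : (forall k, rrel0 (x k) (y k)) ->
  @cl_pint R LR N p x = @cl_pint R LR N' p y.
Proof.
case: p x y => x y H; rewrite (@rpint_mu R L N x) (@rpint_mu R L N' y).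
by have [c [h1 -> ->]] := H ord0; apply: same.
Qed.

Lemma rrel_teval (r : cl_assignment N) (r' : cl_assignment N') s (t : @cl_term R LR s) :
  (forall v, v \in cl_term_vars t -> rrel0 (r v.1 v.2) (r' v.1 v.2)) ->
  rrel0 (cl_teval r t) (cl_teval r' t).
Proof.
elim: t => [s' i|f a IH] /= H; first by apply: (H (s', i)); rewrite inE.
apply: (@rrel_fint f) => k; apply: IH => v vk; apply: H.
exact: mem_flatten_enum vk.
Qed.

End Fixed.

Hypothesis T_complete : fo_complete T.
Hypothesis T_nontrivial : forall M : fo_structure L, fo_model T M -> exists x y : M, x <> y.
Hypothesis RN : forall n, exists k (theta : 'I_k -> fo_formula L), isolating_family T n theta.

Lemma rrel_widen N N' n rho rho' (a : rkar N) (b : rkar N') s x y :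
  @rrel N N' (fun i => (i < n)%N) rho rho' s x y ->
  @rrel N N' (fun i => (i < n.+1)%N) [eta rho with n |-> a] [eta rho' with n |-> b] s x y.
Proof.
case: s x y => x y /= [m [h1 h2 h3]]; exists m.
  by rewrite !ltn_eqF// leqW.
split=> [i /h1/leqW//||]; [rewrite h2|rewrite h3];
  by apply: rbr_local => i /h1 ilt /=; rewrite ltn_eqF.
Qed.

(** An event enters as an equation [[[e = c]]], at the cost of two new random elements. *)
Lemma rrel_extend N N' (RL : randomization_laws T N) (RL' : randomization_laws T N') n rho rho' s
    (x : @cl_car R LR N s) : @rsame R L N N' (fun i => (i < n)%N) rho rho' ->
  exists n1 rho1 rho1' y, [/\ @rsame R L N N' (fun i => (i < n1)%N) rho1 rho1',
    @rrel N N' (fun i => (i < n1)%N) rho1 rho1' s x y &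
    forall s' x' y', @rrel N N' (fun i => (i < n)%N) rho rho' s' x' y' ->
      @rrel N N' (fun i => (i < n1)%N) rho1 rho1' s' x' y'].
Proof.
move=> same; case: s x => x.
  have [b sameb] := rsame_extend RL RL' T_nontrivial RN x same.
  exists n.+1, [eta rho with n |-> x], [eta rho' with n |-> b], b; split=> //.
    by exists n; rewrite /= eqxx.
  by move=> s' x' y'; apply: rrel_widen.
have [c [d cd]] := rdistinct RL T_nontrivial.
have [e eP] := revent RL x cd.
have xE : x = req e c by apply: (rext RL).
have [b1 same1] := rsame_extend RL RL' T_nontrivial RN e same.
have [b2 same2] := rsame_extend RL RL' T_nontrivial RN c same1.
exists n.+2, [eta [eta rho with n |-> e] with n.+1 |-> c],
  [eta [eta rho' with n |-> b1] with n.+1 |-> b2], (req b1 b2); split=> //.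
  exists (FEq (FVar n) (FVar n.+1)); split.
  - by move=> i; rewrite mem_undup /= !inE => /orP[]/eqP->.
  - by rewrite (rbr_eq RL) /= !eqxx ltn_eqF.
  - by rewrite (rbr_eq RL') /= !eqxx ltn_eqF.
by move=> s' x' y' H; apply/rrel_widen/rrel_widen.
Qed.

(** Extension is exact, so at a quantifier both sides range over the same set of values, and suprema
    and infima need no approximation. *)
Lemma rvalue_eq N N' (RL : randomization_laws T N) (RL' : randomization_laws T N')
    (chi : cl_formula LR) n rho rho' (r : cl_assignment N) (r' : cl_assignment N') :
  @rsame R L N N' (fun i => (i < n)%N) rho rho' ->
  (forall v, v \in cl_fv chi -> @rrel N N' (fun i => (i < n)%N) rho rho' _ (r v.1 v.2) (r' v.1 v.2)) ->
  cl_value r chi = cl_value r' chi.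
Proof.
have same_sym P P' n0 q q' : @rsame R L P P' n0 q q' -> @rsame R L P' P n0 q' q.
  by move=> H phi pfv; rewrite H.
(* Stated for arbitrary [P] and [P'] in order to serve both directions. *)
have step (P P' : cl_structure LR) (PL : randomization_laws T P) (PL' : randomization_laws T P')
    s i psi n0 q q' (u : cl_assignment P) (u' : cl_assignment P') :
    (forall n1 q1 q1' (w : cl_assignment P) (w' : cl_assignment P'),
      @rsame R L P P' (fun i => (i < n1)%N) q1 q1' ->
      (forall v, v \in cl_fv psi -> @rrel P P' (fun i => (i < n1)%N) q1 q1' _ (w v.1 v.2) (w' v.1 v.2)) ->
      cl_value w psi = cl_value w' psi) ->
    @rsame R L P P' (fun i => (i < n0)%N) q q' ->
    (forall v, v \in [seq v <- cl_fv psi | v != (s, i)] ->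
      @rrel P P' (fun i => (i < n0)%N) q q' _ (u v.1 v.2) (u' v.1 v.2)) ->
    forall a : P s, exists b : P' s, cl_value (cl_update u i a) psi = cl_value (cl_update u' i b) psi.
  move=> IH same H a; have [n1 [q1 [q1' [b [same1 rab mono]]]]] := rrel_extend PL PL' a same.
  exists b; apply: IH same1 _ => -[s' j] vp /=.
  have [ss'|ss'] := eqVneq s s'; last first.
    rewrite !cl_update_out//; apply/mono/(H (s', j)).
    by rewrite mem_filter vp andbT xpair_eqE eq_sym (negbTE ss').
  subst s'; rewrite !cl_updateE /=; have [//|ji] := eqVneq j i.
  by apply/mono/(H (s, j)); rewrite mem_filter vp andbT xpair_eqE eqxx.
have rangeE s i psi (u : cl_assignment N) (u' : cl_assignment N') :
    (forall a : N s, exists b : N' s, cl_value (cl_update u i a) psi = cl_value (cl_update u' i b) psi) ->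
    (forall b : N' s, exists a : N s, cl_value (cl_update u' i b) psi = cl_value (cl_update u i a) psi) ->
    range (fun a : N s => cl_value (cl_update u i a) psi) =
    range (fun b : N' s => cl_value (cl_update u' i b) psi).
  move=> h1 h2; apply/seteqP; split=> [_ [a _ <-]|_ [b _ <-]].
    by have [b ->] := h1 a; exists b.
  by have [a ->] := h2 b; exists a.
elim: chi n rho rho' r r' => [s t u|p a|m c a IH|s i psi IH|s i psi IH] n rho rho' r r' same H /=.
- by apply: (rrel_isometric RL RL' same); apply: (rrel_teval RL RL') => v vt; apply: H;
    rewrite /= mem_cat vt ?orbT.
- apply: (rrel_pint same) => k; apply: (rrel_teval RL RL') => v vt; apply: H.
  exact: mem_flatten_enum vt.
- congr (conn_fun _ _); apply/rowP => k; rewrite !mxE; apply: IH same _ => v vk; apply: H.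
  exact: mem_flatten_enum vk.
- congr sup; apply: rangeE; first exact: (step N N' RL RL' s i psi n rho rho' r r').
  apply: (step N' N RL' RL s i psi n rho' rho r' r _ (same_sym _ _ _ _ _ same)).
    move=> n1 q1 q1' w w' h1 h2; apply: esym; apply: (IH n1 q1' q1); first exact: same_sym.
    by move=> v vp; apply/rrel_sym/h2.
  by move=> v vp; apply/rrel_sym/H.
- congr inf; apply: rangeE; first exact: (step N N' RL RL' s i psi n rho rho' r r').
  apply: (step N' N RL' RL s i psi n rho' rho r' r _ (same_sym _ _ _ _ _ same)).
    move=> n1 q1 q1' w w' h1 h2; apply: esym; apply: (IH n1 q1' q1); first exact: same_sym.
    by move=> v vp; apply/rrel_sym/h2.
  by move=> v vp; apply/rrel_sym/H.
Qed.

Lemma randomization_complete : (exists N : cl_structure LR, cl_model (@randomization R L T) N) ->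
  cl_complete (@randomization R L T).
Proof.
move=> [N TN]; split; first by exists N.
have RL := randomization_lawsP TN.
move=> chi; have inh s : {x : @cl_car R LR N s | True}.
  by apply: cid; have [x] := cl_inh N s; exists x.
pose r : cl_assignment N := fun s _ => sval (inh s).
exists (cl_value r (sval chi)) => N' /randomization_lawsP RL' r'.
apply/esym/(rvalue_eq RL RL' (rho := r sK) (rho' := r' sK) (n := 0%N)).
  exact: (rsame0 RL RL').
by move: (svalP chi) => /eqP ->.
Qed.

Lemma dense_enum (N : cl_structure LR) s : cl_separable N ->
  exists e : nat -> @cl_car R LR N s, forall x d, 0 < d -> exists n, mdist x (e n) < d.
Proof.
move=> sep; have [D Dc Dd] := sep s; have [x0] := cl_inh N s.
have ballD x (d : R) : 0 < d -> exists y, D y /\ mdist x y < d.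
  move=> d0; have ne : (ball x d)° !=set0 by exists x; exact: nbhsx_ballx.
  have [y [xy Dy]] := Dd _ ne (open_interior _).
  by exists y; split=> //; have := interior_subset xy; rewrite ballEmdist.
have [y0 [Dy0 _]] := ballD x0 1 ltr01.
have [f finj] := (countable_injP _ Dc).
pose e n := if pselect (exists y, D y /\ f y = n) is left h then projT1 (cid h) else y0.
exists e => x d /(ballD x)[y [Dy xy]]; exists (f y).
rewrite /e; case: pselect => [h|[]]; last by exists y.
case: (cid h) => z /= [Dz /finj]; rewrite !inE => -> //.
Qed.

(** Only dense sequences of random elements are enumerated. An event is some [[[e = c]]], and close
    random elements have close equality events, so density among events follows. *)
Lemma randomization_unique (N N' : cl_structure LR) :
  randomization_laws T N -> randomization_laws T N' -> cl_separable N -> cl_separable N' -> cl_iso N N'.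
Proof.
move=> RL RL' sepN sepN'.
have [eN eNP] := dense_enum sK sepN; have [eN' eN'P] := dense_enum sK sepN'.
have same_sym P P' n0 q q' : @rsame R L P P' n0 q q' -> @rsame R L P' P n0 q' q.
  by move=> H phi pfv; rewrite H.
have [||n a b x same|n a b y same|a [b [Pab aE bE]]] :=
    @back_and_forth (rkar N) (rkar N') eN eN' (fun n a b => @rsame R L N N' (fun i => (i < n)%N) a b).
- move=> n a b a' b' e same phi phifv; rewrite -(rbr_local (rho := a)); last by move=> i /phifv/e[].
  by rewrite same//; congr rmu; apply: rbr_local => i /phifv/e[].
- exact: (rsame0 RL RL').
- exact: (rsame_extend RL RL').
- have [x H] := rsame_extend RL' RL T_nontrivial RN y (same_sym _ _ _ _ _ same).
  by exists x; apply: same_sym H.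
have same : @rsame R L N N' (fun=> True) a b.
  by move=> phi _; apply: (Pab (fo_bound phi)) => i /fo_boundP.
have dense_dom P P' (PL : randomization_laws T P) (q : nat -> rkar P) (q' : nat -> rkar P') (eP : nat -> rkar P) :
    (forall (x : rkar P) d, 0 < d -> exists n, mdist x (eP n) < d) -> (forall m, exists n, q n = eP m) ->
    forall s (x : @cl_car R LR P s) (d : R), 0 < d -> exists x' y', @rrel P P' (fun=> True) q q' s x' y' /\ mdist x x' < d.
  move=> dn qE [] x d d0.
    have [m xm] := dn x d d0; have [n nm] := qE m; exists (q n), (q' n).
    by rewrite nm; split=> //; exists n.
  have [c [c' cc']] := rdistinct PL T_nontrivial; have [e eE] := revent PL x cc'.
  have xE : x = req e c by apply: (rext PL).
  have d2 : 0 < d / 2 by rewrite divr_gt0.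
  have [m1 em1] := dn e _ d2; have [n1 nm1] := qE m1.
  have [m2 cm2] := dn c _ d2; have [n2 nm2] := qE m2.
  exists (rbr q (FEq (FVar n1) (FVar n2))), (rbr q' (FEq (FVar n1) (FVar n2))); split.
    by exists (FEq (FVar n1) (FVar n2)).
  have reqC (u v : rkar P) : req u v = req v u by apply: (rext PL) => U HU; split; apply: (req_sym PL HU).
  rewrite (rbr_eq PL) nm1 nm2 xE; apply: le_lt_trans (metric_triangle _ (req (eP m1) c) _) _.
  rewrite [ltRHS](splitr d); apply: ltrD; first exact: le_lt_trans (req_lipschitz PL _ _ _) em1.
  by rewrite reqC [X in mdist _ X]reqC; apply: le_lt_trans (req_lipschitz PL _ _ _) cm2.
apply: (@cl_iso_of_relation R LR N N' (@rrel N N' (fun=> True) a b)).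
- exact: (rrel_isometric RL RL' same).
- exact: (dense_dom _ _ RL _ _ eN).
- move=> s y d d0; have [x' [y' [H1 H2]]] := dense_dom _ _ RL' b a eN' eN'P bE s y d d0.
  by exists y', x'; split=> //; apply: rrel_sym.
- exact: (rrel_fint RL RL').
- exact: (rrel_pint same).
Qed.

End Correspondence.

(** * Completion of a premetric space *)
Record premetric (R : realType) := Premetric {
  pm_car :> Type;
  pm_inh : inhabited pm_car;
  pm_dist : pm_car -> pm_car -> R;
  pm_distxx : forall x, pm_dist x x = 0;
  pm_sym : forall x y, pm_dist x y = pm_dist y x;
  pm_triangle : forall y x z, pm_dist x z <= pm_dist x y + pm_dist y z;
  pm_le1 : forall x y, pm_dist x y <= 1 }.

(* Closure of the Kuratowski embedding [x |-> pm_dist x] in sup distance. *)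
Definition completion (R : realType) (P : premetric R) : Type :=
  {F : P -> R | forall e, 0 < e -> exists x, forall y, `|F y - pm_dist x y| <= e}.

Section Completion.
Variables (R : realType) (P : premetric R).
Implicit Types (x y z : P) (F G H : completion P).

Lemma pm_ge0 x y : 0 <= pm_dist x y.
Proof. by have := pm_triangle y x x; rewrite pm_distxx (pm_sym y x); lra. Qed.

Definition cdist F G : R := sup (range (fun y => `|sval F y - sval G y|)).

(** At most 1 for a distance and 1 for an approximation with error 1. *)
Lemma completion_bound F y : `|sval F y| <= 2.
Proof.
have [x /(_ y)] := svalP F 1 ltr01; rewrite !ler_norml => /andP[h1 h2].
by have := pm_ge0 x y; have := pm_le1 x y; move=> h3 h4; apply/andP; split; lra.
Qed.

Lemma cdist_ge F G y : `|sval F y - sval G y| <= cdist F G.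
Proof.
apply: ub_le_sup; last by exists y.
exists 4 => _ [z _ <-]; apply: le_trans (ler_normB _ _) _.
by have := completion_bound F z; have := completion_bound G z; lra.
Qed.

Lemma cdist_le F G c : (forall y, `|sval F y - sval G y| <= c) -> cdist F G <= c.
Proof.
move=> H; have [x0] := pm_inh P.
by apply: ge_sup => [|_ [y _ <-]//]; exists (`|sval F x0 - sval G x0|), x0.
Qed.

Lemma cdistxx F : cdist F F = 0.
Proof.
have [x0] := pm_inh P; apply/eqP; rewrite eq_le; apply/andP; split.
  by apply: cdist_le => y; rewrite subrr normr0.
exact: le_trans (normr_ge0 _) (cdist_ge F F x0).
Qed.

Lemma cdist_eq0 F G : cdist F G = 0 -> F = G.
Proof.
move=> e; have : sval F = sval G.
  by apply: funext => y; have := cdist_ge F G y; rewrite e normr_le0 subr_eq0 => /eqP.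
case: F G {e} => F hF [G hG] /= FG; subst G; congr exist; exact: Prop_irrelevance.
Qed.

Lemma cdist_sym F G : cdist F G = cdist G F.
Proof. by congr sup; apply: eq_imagel => y _; rewrite distrC. Qed.

Lemma cdist_triangle G F H : cdist F H <= cdist F G + cdist G H.
Proof.
apply: cdist_le => y; apply: le_trans (lerD (cdist_ge F G y) (cdist_ge G H y)).
exact: ler_distD.
Qed.

Lemma pm_lipschitz x y z : `|pm_dist x z - pm_dist y z| <= pm_dist x y.
Proof.
have := pm_triangle y x z; have := pm_triangle x y z; rewrite (pm_sym y x) => h1 h2.
by rewrite ler_norml; apply/andP; split; lra.
Qed.

Lemma embedP x : forall e, 0 < e -> exists x', forall y, `|pm_dist x y - pm_dist x' y| <= e.
Proof. by move=> e e0; exists x => y; rewrite subrr normr0 ltW. Qed.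

Definition embed x : completion P := exist _ (pm_dist x) (embedP x).

Lemma cdist_embed x y : cdist (embed x) (embed y) = pm_dist x y.
Proof.
apply/eqP; rewrite eq_le; apply/andP; split; first exact/cdist_le/pm_lipschitz.
apply: le_trans (cdist_ge _ _ y); rewrite /= pm_distxx subr0; exact: ler_norm.
Qed.

Lemma embed_dense F e : 0 < e -> exists x, cdist F (embed x) <= e.
Proof. by move=> /(svalP F)[x H]; exists x; apply: cdist_le. Qed.

(** The limit is the infimum of the upper bounds [pm_dist (x n) y + 2^-1 ^+ n]; the Cauchy condition
    keeps it within [2^-1 ^+ n] of each distance function. *)
Lemma embed_limit (x : nat -> P) :
  (forall n m, pm_dist (x n) (x m) <= 2^-1 ^+ n + 2^-1 ^+ m) ->
  exists G, forall n, cdist G (embed (x n)) <= 2^-1 ^+ n.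
Proof.
move=> xC.
pose G y := inf (range (fun n => pm_dist (x n) y + 2^-1 ^+ n)).
have GE n y : `|G y - pm_dist (x n) y| <= 2^-1 ^+ n.
  rewrite ler_norml; apply/andP; split.
    rewrite lerBrDl; apply: lb_le_inf => [|_ [m _ <-]].
      by exists (pm_dist (x 0%N) y + 2^-1 ^+ 0), 0%N.
    by have := pm_triangle (x m) (x n) y; have := xC n m; lra.
  rewrite lerBlDl; apply: ge_inf; last by exists n.
  by exists 0 => _ [m _ <-]; rewrite addr_ge0 ?pm_ge0// ltW// half_pow_gt0.
have GP e : 0 < e -> exists z, forall y, `|G y - pm_dist z y| <= e.
  by move=> /geometric_lt[n ne]; exists (x n) => y; apply: le_trans (GE n y) (ltW ne).
by exists (exist _ G GP) => n; apply: cdist_le => y; apply: GE.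
Qed.

HB.instance Definition _ := gen_eqMixin (completion P).
HB.instance Definition _ := gen_choiceMixin (completion P).
HB.instance Definition _ := @isMetric.Build R (completion P) cdist cdistxx cdist_eq0
  cdist_sym cdist_triangle.

Lemma mdist_completion F G : mdist F G = cdist F G.
Proof. by []. Qed.

Lemma completion_complete (F : set_system (completion P)) :
  ProperFilter F -> cauchy F -> exists G, F --> G.
Proof.
move=> FF /cauchyP FC.
have /choice[c cP] : forall n, exists c, F (ball c (2^-1 ^+ n.+1)) by move=> n; apply/FC/half_pow_gt0.
have /choice[x xP] : forall n, exists x, cdist (c n) (embed x) <= 2^-1 ^+ n.+1.
  by move=> n; apply/embed_dense/half_pow_gt0.
have ballP n G : ball (c n) (2^-1 ^+ n.+1) G -> cdist (embed (x n)) G <= 2^-1 ^+ n.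
  rewrite ballEmdist /= mdist_completion => /ltW h; apply: le_trans (cdist_triangle (c n) _ _) _.
  by rewrite cdist_sym -half_powS lerD.
have [n m|G GP] := @embed_limit x.
  have [H [/ballP h1 /ballP h2]] := filter_ex (filterI (cP n) (cP m)).
  rewrite -cdist_embed; apply: le_trans (cdist_triangle H _ _) _.
  by rewrite (cdist_sym H) lerD.
exists G; apply/metricType_numDomainType.fcvgrPdist_lt => e e0.
have [n ne] : exists n, 2^-1 ^+ n < e / 2 by apply: geometric_lt; rewrite divr_gt0.
apply: filterS (cP n) => H /ballP h; rewrite mdist_completion.
apply: le_lt_trans (cdist_triangle (embed (x n)) _ _) _.
by have := GP n; lra.
Qed.

Lemma mdist_completion_le1 F G : mdist F G <= 1.
Proof.
apply/ler_addgt0Pl => e e0; have e2 : 0 < e / 2 by lra.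
have [x Fx] := embed_dense F e2; have [y Gy] := embed_dense G e2.
have := cdist_triangle (embed x) F G; have := cdist_triangle (embed y) (embed x) G.
by have := pm_le1 x y; rewrite cdist_embed mdist_completion (cdist_sym (embed y) G); lra.
Qed.

End Completion.

Section Extend.
Variables (R : realType) (n : nat) (D : 'I_n -> premetric R) (Q : premetric R).
Variable u : (forall k, D k) -> Q.
Hypothesis u_lip : forall x y, pm_dist (u x) (u y) <= \sum_k pm_dist (x k) (y k).
Implicit Types X Y : forall k, completion (D k).

(** The value is pinned down by an inequality against all tuples of the dense set, from which the
    Lipschitz bound of the extension follows without its approximating sequences. *)
Lemma extend_ex X : exists G : completion Q, forall a : (forall k, D k),
  mdist G (embed (u a)) <= \sum_k mdist (X k) (embed (a k)).
Proof.
(* With [n.+1] in place of [n], the errors of [n] arguments still sum to at most [2^-1 ^+ m], and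
   [n] may be 0. *)
have pow_gt0 m : 0 < 2^-1 ^+ m / n.+1%:R :> R by rewrite divr_gt0// half_pow_gt0.
pose a m k := projT1 (cid (embed_dense (X k) (pow_gt0 m))).
have aP m : \sum_k mdist (X k) (embed (a m k)) <= 2^-1 ^+ m.
  apply: (@le_trans _ _ (\sum_(k < n) 2^-1 ^+ m / n.+1%:R)).
    by apply: ler_sum => k _; rewrite mdist_completion /a; case: cid.
  rewrite sumr_const card_ord -[_ *+ n]mulr_natr mulrAC ler_pdivrMr// ler_pM2l ?ler_nat//.
  exact: half_pow_gt0.
have tri m b : pm_dist (u (a m)) (u b) <= 2^-1 ^+ m + \sum_k mdist (X k) (embed (b k)).
  apply: le_trans (u_lip _ _) (le_trans _ (lerD (aP m) (lexx _))).
  rewrite -big_split /=; apply: ler_sum => k _; rewrite -cdist_embed.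
  by rewrite (mdist_completion (X k)) (cdist_sym (X k)); apply: cdist_triangle.
have [m m'|G GP] := @embed_limit R Q (fun m => u (a m)).
  by apply: le_trans (tri m (a m')) _; rewrite lerD2l.
exists G => b; rewrite -subr_le0; apply: (@geometric_le0 _ _ 2) => m.
have := cdist_triangle (embed (u (a m))) G (embed (u b)).
by have := GP m; have := tri m b; rewrite cdist_embed !mdist_completion; lra.
Qed.

Definition extend X : completion Q := projT1 (cid (extend_ex X)).

Lemma extend_near X a : mdist (extend X) (embed (u a)) <= \sum_k mdist (X k) (embed (a k)).
Proof. by rewrite /extend; case: cid. Qed.

Lemma extend_embed a : extend (fun k => embed (a k)) = embed (u a).
Proof.
apply: mdist_positivity; apply/eqP; rewrite eq_le mdist_ge0 andbT.
by apply: le_trans (extend_near _ _) _; rewrite big1// => k _; rewrite mdistxx.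
Qed.

Lemma extend_lip X Y : mdist (extend X) (extend Y) <= \sum_k mdist (X k) (Y k).
Proof.
rewrite -subr_le0; apply: (@geometric_le0 _ _ 2) => m.
have pow_gt0 : 0 < 2^-1 ^+ m / n.+1%:R :> R by rewrite divr_gt0// half_pow_gt0.
pose b k := projT1 (cid (embed_dense (Y k) pow_gt0)).
have bP : \sum_k mdist (Y k) (embed (b k)) <= 2^-1 ^+ m.
  apply: (@le_trans _ _ (\sum_(k < n) 2^-1 ^+ m / n.+1%:R)).
    by apply: ler_sum => k _; rewrite mdist_completion /b; case: cid.
  rewrite sumr_const card_ord -[_ *+ n]mulr_natr mulrAC ler_pdivrMr// ler_pM2l ?ler_nat//.
  exact: half_pow_gt0.
have h1 := extend_near X b; have h2 := extend_near Y b.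
have h3 : \sum_k mdist (X k) (embed (b k)) <=
    \sum_k mdist (X k) (Y k) + \sum_k mdist (Y k) (embed (b k)).
  by rewrite -big_split /=; apply: ler_sum => k _; apply: metric_triangle.
have := metric_triangle (extend X) (embed (u b)) (extend Y).
by rewrite (metric_sym (embed (u b))); lra.
Qed.

End Extend.

(** * Periodic functions and their densities *)
Section Periodic.
Variable R : realType.

Definition periodic (X : Type) p (f : nat -> X) := (0 < p)%N /\ forall i, f (i + p)%N = f i.

Lemma periodic_dvd (X : Type) p q (f : nat -> X) : (0 < q)%N -> (p %| q)%N -> periodic p f -> periodic q f.
Proof.
move=> + /dvdnP[k qE]; rewrite {q}qE => q0 [p0 H]; split=> // i.
by elim: k {q0} => [|k IH]; rewrite ?addn0// mulSn (addnC p) addnA H.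
Qed.

Lemma periodic_mod (X : Type) p (f : nat -> X) i : periodic p f -> f i = f (i %% p)%N.
Proof.
move=> [p0 H]; rewrite {1}(divn_eq i p) addnC; elim: (i %/ p)%N => [|k IH]; first by rewrite addn0.
by rewrite mulSn (addnC p) addnA H.
Qed.

Definition count_below p (A : nat -> bool) : nat := \sum_(i < p) A i.

Lemma count_belowM p A k : periodic p A -> count_below (k * p) A = (k * count_below p A)%N.
Proof.
move=> [p0 H]; rewrite /count_below; elim: k => [|k IH]; first by rewrite !mul0n big_ord0.
rewrite !mulSn big_split_ord/= -IH; congr addn; apply: eq_bigr => i _.
by rewrite addnC H.
Qed.

(* [0] when [A] is not periodic. *)
Definition dens (A : nat -> bool) : R :=
  if pselect (exists p, periodic p A) is left h
  then (count_below (projT1 (cid h)) A)%:R / (projT1 (cid h))%:R else 0.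

(** Two periods [p] and [q] are compared by counting over [p * q] positions. *)
Lemma densE p A : periodic p A -> dens A = (count_below p A)%:R / p%:R.
Proof.
move=> pA; rewrite /dens; case: pselect => [h|[]]; last by exists p.
case: (cid h) => q qA /=; have [q0 _] := qA; have [p0 _] := pA.
apply/eqP; rewrite eqr_div ?pnatr_eq0 -?lt0n// -!natrM eqr_nat.
by rewrite mulnC -count_belowM// [X in _ == X]mulnC -count_belowM// mulnC.
Qed.

(** The union bound behind both the triangle inequality and the Lipschitz property of pointwise
    operations. *)
Lemma dens_le_sum n p (A : nat -> bool) (B : 'I_n -> nat -> bool) :
  periodic p A -> (forall k, periodic p (B k)) ->
  (forall i, A i -> exists k, B k i) -> dens A <= \sum_k dens (B k).
Proof.
move=> pA pB AB; rewrite (densE pA); under eq_bigr do rewrite (densE (pB _)).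
have [p0 _] := pA; rewrite -mulr_suml ler_pM2r ?invr_gt0 ?ltr0n// -natr_sum ler_nat.
rewrite exchange_big /=; apply: leq_sum => i _.
case Ai: (A i) => //; have [k Bk] := AB i Ai.
by rewrite (bigD1 k)//= Bk.
Qed.

Lemma dens_add p (A B C D : nat -> bool) :
  periodic p A -> periodic p B -> periodic p C -> periodic p D ->
  (forall i, A i + B i = C i + D i)%N -> dens A + dens B = dens C + dens D.
Proof.
move=> pA pB pC pD H; rewrite (densE pA) (densE pB) (densE pC) (densE pD).
rewrite -!mulrDl -!natrD -!big_split /=; congr (_%:R / _).
by apply: eq_bigr => i _; apply: H.
Qed.

Lemma dens0 A : (forall i, A i = false) -> dens A = 0.
Proof.
move=> H; rewrite (@densE 1) ?/count_below; last by split=> // i; rewrite !H.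
by rewrite big_ord1 H mul0r.
Qed.

Lemma dens1 (A : nat -> bool) : (forall i, A i) -> dens A = 1.
Proof.
move=> H; rewrite (@densE 1) ?/count_below; last by split=> // i; rewrite !H.
by rewrite big_ord1 H divr1.
Qed.

(** [V] keeps every other block of length [p], so over [2 * p] positions it meets exactly one of two
    copies of [A]. *)
Lemma dens_half p A : periodic p A -> exists V, periodic (2 * p) V /\
  dens (fun i => A i && V i) = dens A / 2.
Proof.
move=> pA; have [p0 pE] := pA; pose V i := ~~ odd (i %/ p).
have pV : periodic (2 * p) V.
  split=> [|i]; first by rewrite muln_gt0.
  by rewrite /V addnC divnMDl// oddD.
exists V; split=> //; have pAV : periodic (2 * p) (fun i => A i && V i).
  by split=> [|i]; rewrite ?muln_gt0// (pV.2 i) mul2n -addnn addnA !pE.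
rewrite (densE pAV) (densE pA) /count_below mul2n -addnn big_split_ord/=.
rewrite [X in (_ + X)%N]big1 ?addn0 => [|i _]; last first.
  by rewrite /V divnDl ?dvdnn// divnn p0 divn_small// addn0 andbF.
rewrite addnn -muln2 natrM invfM mulrA; congr (_%:R / _ / _).
by apply: eq_bigr => i _; rewrite /V divn_small// andbT.
Qed.

Definition per (X : Type) := {f : nat -> X | exists p, periodic p f}.

Definition per_of (X : Type) (f : nat -> X) (h : exists p, periodic p f) : per X :=
  exist (fun f => exists p, periodic p f) f h.

Definition pat (X : Type) (f : per X) : nat -> X := sval f.

Lemma per_common n (D : 'I_n -> Type) (a : forall k, per (D k)) :
  exists p, (0 < p)%N /\ forall k, periodic p (pat (a k)).
Proof.
have /choice[q qP] : forall k, exists q, periodic q (pat (a k)) by move=> k; apply: (svalP (a k)).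
have P0 : (0 < \prod_k q k)%N by rewrite prodn_gt0// => k; have [] := qP k.
exists (\prod_k q k)%N; split=> // k; apply: periodic_dvd (qP k) => //.
by rewrite (bigD1 k)//= dvdn_mulr.
Qed.

Lemma per_const_subproof (X : Type) (x : X) : exists p, periodic p (fun _ : nat => x).
Proof. by exists 1%N. Qed.

Definition per_const (X : Type) (x : X) : per X := exist _ _ (per_const_subproof x).

Definition per_neq (X : Type) (f g : nat -> X) i := `[< f i <> g i >].

Lemma per_neq_periodic (X : Type) p (f g : nat -> X) :
  periodic p f -> periodic p g -> periodic p (per_neq f g).
Proof. by move=> [p0 fE] [_ gE]; split=> // i; rewrite /per_neq fE gE. Qed.

Definition per_dist (X : Type) (f g : per X) : R := dens (per_neq (pat f) (pat g)).

Lemma per_distxx (X : Type) (f : per X) : per_dist f f = 0.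
Proof. by apply: dens0 => i; apply/asboolPn; apply. Qed.

Lemma per_dist_sym (X : Type) (f g : per X) : per_dist f g = per_dist g f.
Proof.
by congr dens; apply: funext => i; apply: asbool_equiv_eq; split=> H e; apply: H; rewrite e.
Qed.

Lemma per_dist_triangle (X : Type) (g f h : per X) : per_dist f h <= per_dist f g + per_dist g h.
Proof.
have [p [_ H]] := per_common (fun k : 'I_3 => tnth [tuple f; g; h] k).
have pf : periodic p (pat f) := H ord0.
have pg : periodic p (pat g) := H (lift ord0 ord0).
have ph : periodic p (pat h) := H (lift ord0 (lift ord0 ord0)).
have := @dens_le_sum 2 p (per_neq (pat f) (pat h))
  (fun k => if val k == 0%N then per_neq (pat f) (pat g) else per_neq (pat g) (pat h)).
rewrite big_ord_recl big_ord1 /=; apply; first exact: per_neq_periodic.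
  by move=> k; case: (_ == _); apply: per_neq_periodic.
move=> i /asboolP fh; have [fg|fg] := pselect (pat f i = pat g i).
  by exists (lift ord0 ord0) => /=; apply/asboolP; rewrite -fg.
by exists ord0 => /=; apply/asboolP.
Qed.

Lemma per_dist_le1 (X : Type) (f g : per X) : per_dist f g <= 1.
Proof.
have [p [p0 H]] := per_common (fun k : 'I_2 => tnth [tuple f; g] k).
rewrite /per_dist (densE (per_neq_periodic (H ord0) (H (lift ord0 ord0)))).
rewrite ler_pdivrMr ?ltr0n// mul1r ler_nat /count_below.
apply: (@leq_trans (\sum_(i < p) 1)); first by apply: leq_sum => i _; apply: leq_b1.
by rewrite sum1_card card_ord.
Qed.

Definition Per (X : Type) (inh : inhabited X) : premetric R :=
  @Premetric R (per X) (let: inhabits x := inh in inhabits (per_const x))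
    (@per_dist X) (@per_distxx X) (@per_dist_sym X) (@per_dist_triangle X) (@per_dist_le1 X).

Lemma pointwise_subproof n (D : 'I_n -> Type) (Y : Type) (op : (forall k, D k) -> Y)
    (a : forall k, per (D k)) : exists p, periodic p (fun i => op (fun k => pat (a k) i)).
Proof.
have [p [p0 H]] := per_common a; exists p; split=> // i; congr op.
by apply: functional_extensionality_dep => k; rewrite (H k).2.
Qed.

Definition pointwise n (D : 'I_n -> Type) (Y : Type) (op : (forall k, D k) -> Y)
    (a : forall k, per (D k)) : per Y := exist _ _ (pointwise_subproof op a).

(** Two results differ only where some argument does. *)
Lemma pointwise_lip n (D : 'I_n -> Type) (Y : Type) (op : (forall k, D k) -> Y) (a b : forall k, per (D k)) :
  per_dist (pointwise op a) (pointwise op b) <= \sum_k per_dist (a k) (b k).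
Proof.
have [p [p0 H]] := per_common a; have [q [q0 G]] := per_common b.
have pa k : periodic (p * q) (pat (a k)).
  by apply: periodic_dvd (H k); rewrite ?muln_gt0 ?p0// dvdn_mulr.
have pb k : periodic (p * q) (pat (b k)).
  by apply: periodic_dvd (G k); rewrite ?muln_gt0 ?p0// dvdn_mull.
apply: (@dens_le_sum _ (p * q)%N); last first.
- move=> i /asboolP ne; apply: contrapT => /forallNP H'; apply: ne; congr op.
  by apply: functional_extensionality_dep => k; apply: contrapT => ne; apply: (H' k); apply/asboolP.
- by move=> k; apply: per_neq_periodic.
- apply: per_neq_periodic; (split=> [|i]; first by rewrite muln_gt0 p0); congr op;
    by apply: functional_extensionality_dep => k; rewrite ?(pa k).2 ?(pb k).2.
Qed.

(** A periodic function repeats a finite word of codes; the empty word stands for a constant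
    function. *)
Lemma per_countable (X : Type) : inhabited X -> countable [set: X] -> countable [set: per X].
Proof.
move=> Xi Xc; have [e eP] := countable_surj Xi Xc; have [x0] := Xi.
have sub (s : seq nat) : exists p, periodic p (fun i => e (nth 0%N s (i %% size s))).
  case: s => [|x s]; first by exists 1%N; split=> // i; rewrite !nth_nil.
  by exists (size (x :: s)); split=> // i; rewrite modnDr.
apply: (@surj_countable _ _ (fun s : seq nat => exist _ _ (sub s) : per X)).
move=> [f [p pf]]; have /choice[l lP] : forall j, exists n, e n = f j by move=> j; apply: eP.
exists (mkseq l p); have E : (fun i => e (nth 0%N (mkseq l p) (i %% size (mkseq l p)))) = f.
  apply: funext => i; have [p0 _] := pf; rewrite size_mkseq nth_mkseq ?ltn_pmod// lP.
  by rewrite -(periodic_mod i pf).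
move: (sub (mkseq l p)); rewrite E => h; congr exist; exact: Prop_irrelevance.
Qed.

End Periodic.

Lemma mdist_lip2 (R : realType) (X : metricType R) (x x' y y' : X) :
  `|mdist x y - mdist x' y'| <= mdist x x' + mdist y y'.
Proof.
have h1 := metric_triangle x x' y; have h2 := metric_triangle x' y' y.
have h3 := metric_triangle x' x y'; have h4 := metric_triangle x y y'.
rewrite (metric_sym y' y) in h2; rewrite (metric_sym x' x) in h3.
by rewrite ler_norml; apply/andP; split; lra.
Qed.

(** * The randomization of a first-order structure *)

Section RandomizedStructure.
Variables (R : realType) (L : fo_signature) (M : fo_structure L) (m0 : M).
Let LR : cl_signature R := rand_signature R L.

(** Random elements are periodic functions into [M] and events periodic functions into [bool]. One
    construction thus covers both sorts, and each symbol acts pointwise. *)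
Definition rbase (s : rand_sort) : Type := match s with sK => M | sB => bool end.

Lemma rbase_inh s : inhabited (rbase s).
Proof. by case: s; [exists; exact: m0|exists; exact: true]. Qed.

Definition rper s : premetric R := Per R (rbase_inh s).

Definition rcar (s : rand_sort) : metricType R := completion (rper s).

Definition rassign phi (v : 'I_(size (fo_fv phi)) -> M) (i : nat) : M :=
  if insub (index i (@fo_fv L phi)) is Some k then v k else m0.

Definition rop (f : rand_fun L) : (forall k : 'I_(rand_far f), rbase (rand_fdom k)) -> bool :=
  match f return (forall k : 'I_(rand_far f), rbase (rand_fdom k)) -> bool with
  | REv phi => fun v => `[< fo_holds (rassign v) phi >]
  | RTop => fun=> true
  | RBot => fun=> false
  | RNeg => fun v => ~~ v ord0
  | RJoin => fun v => v ord0 || v (lift ord0 ord0)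
  | RMeet => fun v => v ord0 && v (lift ord0 ord0)
  end.

Lemma rop_lip (f : rand_fun L) (x y : forall k : 'I_(rand_far f), rper (rand_fdom k)) :
  @pm_dist R (rper sB) (pointwise (@rop f) x) (pointwise (@rop f) y) <= \sum_k pm_dist (x k) (y k).
Proof. exact: pointwise_lip. Qed.

Definition rfint (f : rand_fun L) (X : forall k : 'I_(rand_far f), rcar (rand_fdom k)) : rcar sB :=
  extend (@rop_lip f) X.

Lemma rfint_lip f (X Y : forall k : 'I_(rand_far f), rcar (rand_fdom k)) :
  mdist (rfint X) (rfint Y) <= \sum_k mdist (X k) (Y k).
Proof. exact: extend_lip. Qed.

Lemma rfint_unif (f : rand_fun L) (e : R) : 0 < e ->
  forall X Y : forall k : 'I_(rand_far f), rcar (rand_fdom k),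
  (forall k, mdist (X k) (Y k) < lipschitz_mod (rand_far f) e) -> mdist (rfint X) (rfint Y) <= e.
Proof.
move=> e0 X Y H; apply: le_trans (rfint_lip X Y) _.
apply: (@le_trans _ _ (\sum_(k < rand_far f) lipschitz_mod (rand_far f) e)).
  by apply: ler_sum => k _; apply: ltW.
rewrite sumr_const card_ord -[_ *+ rand_far f]mulr_natr /lipschitz_mod mulrAC.
by rewrite ler_pdivrMr// ler_pM2l// ler_nat.
Qed.

(** The measure of an event is interpreted as its distance to this one. *)
Definition rfalse : rcar sB := @embed R (rper sB) (per_const false).

Lemma rpint_range (X : 'I_1 -> rcar sB) : 0 <= mdist (X ord0) rfalse <= 1.
Proof. by rewrite mdist_ge0 mdist_completion_le1. Qed.

Lemma rpint_unif (e : R) : 0 < e -> forall X Y : 'I_1 -> rcar sB,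
  (forall k, mdist (X k) (Y k) < lipschitz_mod 1 e) ->
  `|mdist (X ord0) rfalse - mdist (Y ord0) rfalse| <= e.
Proof.
move=> e0 X Y /(_ ord0); rewrite /lipschitz_mod => H.
apply: le_trans (mdist_lip2 _ _ _ _) _; rewrite mdistxx addr0; apply: (le_trans (ltW H)).
by rewrite ler_pdivrMr// ler_peMr ?ler1n// ltW.
Qed.

Definition randomized : cl_structure LR :=
  @CLStructure R LR rcar (fun s => let: inhabits x := pm_inh (rper s) in inhabits (embed x))
    (fun s => @mdist_completion_le1 R (rper s)) (fun s => @completion_complete R (rper s))
    rfint rfint_unif (fun=> fun X => mdist (X ord0) rfalse) (fun=> rpint_range) (fun=> rpint_unif).

Implicit Types (r : cl_assignment randomized) (chi : cl_formula LR).

Definition rclose (d : R) r r' := forall s i, mdist (r s i : rcar s) (r' s i) <= d.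

Lemma teval_lip s (t : @cl_term R LR s) : exists2 C, 0 <= C & forall d r r', 0 <= d -> rclose d r r' ->
  mdist (cl_teval r t : rcar s) (cl_teval r' t) <= C * d.
Proof.
elim: t => [s' i|f a IH]; first by exists 1 => // d r r' _ H; rewrite mul1r; apply: H.
have /choice[C CP] : forall k, exists C, 0 <= C /\ forall d r r', 0 <= d -> rclose d r r' ->
    mdist (cl_teval r (a k) : rcar (rand_fdom k)) (cl_teval r' (a k)) <= C * d.
  by move=> k; have [C C0 H] := IH k; exists C.
exists (\sum_k C k); first by apply: sumr_ge0 => k _; have [] := CP k.
move=> d r r' d0 H; apply: le_trans (rfint_lip _ _) _; rewrite mulr_suml.
by apply: ler_sum => k _; have [_] := CP k; apply.
Qed.

(** Lipschitz dependence on the assignment, uniformly in all variables, reduces the axioms to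
    assignments by periodic functions. *)
Definition vlip chi := exists2 C, 0 <= C & forall d r r', 0 <= d -> rclose d r r' ->
  `|cl_value r chi - cl_value r' chi| <= C * d.

Lemma vlip_dist s (t u : @cl_term R LR s) : vlip (CDist t u).
Proof.
have [C C0 tP] := teval_lip t; have [D D0 uP] := teval_lip u.
exists (C + D); first exact: addr_ge0; move=> d r r' d0 H.
rewrite mulrDl /=; apply: le_trans (mdist_lip2 _ _ _ _) _.
by apply: lerD; [apply: tP|apply: uP].
Qed.

Lemma value_mu r U : cl_value r (@mu R L U) = mdist (cl_teval r U : rcar sB) rfalse.
Proof. by []. Qed.

Lemma vlip_mu U : vlip (@mu R L U).
Proof.
have [C C0 H] := teval_lip U; exists C => // d r r' d0 h; rewrite !value_mu.
apply: le_trans (mdist_lip2 _ _ _ _) _; rewrite mdistxx addr0; exact: H.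
Qed.

Lemma vlip_diff chi psi : vlip chi -> vlip psi -> vlip (Cdiff chi psi).
Proof.
move=> [C C0 H] [D D0 G]; exists (C + D); first exact: addr_ge0.
move=> d r r' d0 h; rewrite !rvalue_diff mulrDl.
have h1 := H d r r' d0 h; have h2 := G d r r' d0 h.
apply: le_trans (ler_dist_dist _ _) _; rewrite opprD addrACA -opprD.
apply: le_trans (ler_normD _ _) _; rewrite normrN addrC.
by rewrite addrC; apply: lerD.
Qed.

Lemma vlip_mean chi psi : vlip chi -> vlip psi -> vlip (Cmean chi psi).
Proof.
move=> [C C0 H] [D D0 G]; exists (C + D); first exact: addr_ge0.
move=> d r r' d0 h; rewrite !rvalue_mean mulrDl.
have := H d r r' d0 h; have := G d r r' d0 h; rewrite !ler_norml.
by move=> /andP[h1 h2] /andP[h3 h4]; apply/andP; split; lra.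
Qed.

Lemma vlip_compl chi : vlip chi -> vlip (Ccompl chi).
Proof.
move=> [C C0 H]; exists C => // d r r' d0 h; rewrite !rvalue_compl.
have := H d r r' d0 h; rewrite !ler_norml => /andP[h1 h2]; apply/andP; split; lra.
Qed.

Lemma vlip_half chi : vlip chi -> vlip (Chalf chi).
Proof.
move=> [C C0 H]; exists C => // d r r' d0 h; rewrite !rvalue_half.
have := H d r r' d0 h; have : 0 <= C * d by apply: mulr_ge0.
by rewrite !ler_norml => h0 /andP[h1 h2]; apply/andP; split; lra.
Qed.

Definition rembed (v : forall s, nat -> rper s) : cl_assignment randomized :=
  fun s i => embed (v s i).

(** [w] stands for updates still to come: the periodic assignment [v] is fixed before the witnesses
    of infima, which depend on it. *)
Lemma vlip_approx chi r e : vlip chi -> 0 < e -> exists v, forall w : cl_assignment randomized -> cl_assignment randomized,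
  (forall d r1 r2, 0 <= d -> rclose d r1 r2 -> rclose d (w r1) (w r2)) ->
  `|cl_value (w r) chi - cl_value (w (rembed v)) chi| < e.
Proof.
move=> [C C0 H] e0; have d0 : 0 < e / (C + 1) by rewrite divr_gt0// ltr_wpDl.
have d2 : 0 < e / (C + 1) by [].
pose v s i := projT1 (cid (embed_dense (r s i) d2)).
exists v => w wP; have vP : rclose (e / (C + 1)) r (rembed v).
  by move=> s i; rewrite /rembed /v; case: cid.
apply: le_lt_trans (H _ _ _ (ltW d0) (wP _ _ _ (ltW d0) vP)) _.
by rewrite mulrCA gtr_pMr// ltr_pdivrMr ?mul1r ?ltrDl// ltr_wpDl.
Qed.

Lemma vlip_eq0 chi : vlip chi -> (forall v, cl_value (rembed v) chi = 0) -> forall r, cl_value r chi = 0.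
Proof.
move=> lchi H r; apply/cl_value_eq0 => e e0; have [v /(_ id)] := vlip_approx r lchi e0.
by move=> /(_ (fun _ _ _ _ h => h)); rewrite H subr0; apply: le_lt_trans; apply: ler_norm.
Qed.

Lemma rclose_update d r1 r2 s i (b : rcar s) : 0 <= d -> rclose d r1 r2 ->
  rclose d (@cl_update R LR randomized r1 s i b) (@cl_update R LR randomized r2 s i b).
Proof.
move=> d0 H s' j; have [ss'|ss'] := eqVneq s s'; last by rewrite !cl_update_out.
by subst s'; rewrite !cl_updateE /=; case: (j == i); [rewrite mdistxx|apply: H].
Qed.

Definition pupdate (v : forall s, nat -> rper s) s i (b : rper s) : forall s, nat -> rper s :=
  dfwith v ([eta v s with i |-> b] : nat -> rper s).

Lemma rembed_update v s i (b : rper s) :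
  @cl_update R LR randomized (rembed v) s i (embed b) = rembed (pupdate v i b).
Proof.
apply: functional_extensionality_dep => s'; rewrite /rembed /cl_update /pupdate.
have [ss'|ss'] := eqVneq s s'; last by rewrite !dfwith_out//.
subst s'; rewrite !dfwith_in; apply: funext => j /=; by case: (j == i).
Qed.

(** A witness at a periodic assignment close to [r] is an approximate witness at [r]. *)
Lemma vlip_inf chi s i : vlip chi ->
  (forall v, exists b : rper s, cl_value (rembed (pupdate v i b)) chi = 0) ->
  forall r, cl_value r (@CInf R LR s i chi) = 0.
Proof.
move=> lchi H r; apply/cl_value_eq0 => e e0; apply/cl_value_inf_lt.
have [v /(_ (fun r => @cl_update R LR randomized r s i (embed (projT1 (cid (H v))))))] := vlip_approx r lchi e0.
case: (cid (H v)) => b Hb /= h; exists (embed b).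
move: h; rewrite rembed_update Hb subr0 => h; apply: le_lt_trans (ler_norm _) (h _).
by move=> d r1 r2; apply: rclose_update.
Qed.

(** Evaluation at a single coordinate, in the two-sorted structure on [M] and [bool]; through
    [teval_embed], values at periodic assignments become densities of sets of coordinates. *)
Fixpoint bteval (v : forall s, nat -> rbase s) (s : rand_sort) (t : @cl_term R LR s) : rbase s :=
  match t in @cl_term _ _ s return rbase s with
  | CVar s i => v s i
  | CApp f a => @rop f (fun k => bteval v (a k))
  end.

Definition bat (v : forall s, nat -> rper s) (i : nat) : forall s, nat -> rbase s :=
  fun s j => pat (v s j) i.

Lemma teval_embed v s (t : @cl_term R LR s) : exists f : per (rbase s),
  cl_teval (rembed v) t = @embed R (rper s) f /\ pat f = (fun i => bteval (bat v i) t).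
Proof.
elim: t => [s' i|f a IH]; first by exists (v s' i).
pose g k := projT1 (cid (IH k)).
have gP k : cl_teval (rembed v) (a k) = @embed R (rper (rand_fdom k)) (g k) /\
    pat (g k) = (fun i => bteval (bat v i) (a k)) by rewrite /g; case: cid.
exists (pointwise (@rop f) g); split.
  rewrite -(extend_embed (@rop_lip f)) /=; congr (@rfint f).
  by apply: functional_extensionality_dep => k; have [] := gP k.
apply: funext => i /=; congr rop; apply: functional_extensionality_dep => k.
by have [_ ->] := gP k.
Qed.

Lemma bteval_periodic v s (t : @cl_term R LR s) : exists p, periodic p (fun i => bteval (bat v i) t).
Proof. by have [f [_ <-]] := teval_embed v t; exact: (svalP f). Qed.

Lemma value_dist_embed v s (t u : @cl_term R LR s) :
  cl_value (rembed v) (CDist t u) =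
  dens R (fun i => `[< bteval (bat v i) t <> bteval (bat v i) u >]).
Proof.
rewrite /=; have [f [-> fE]] := teval_embed v t; have [g [-> gE]] := teval_embed v u.
by rewrite mdist_completion cdist_embed /= /per_dist fE gE.
Qed.

Lemma value_mu_embed v U :
  cl_value (rembed v) (@mu R L U) = dens R (fun i => bteval (bat v i) U).
Proof.
rewrite value_mu; have [f [-> fE]] := teval_embed v U.
rewrite mdist_completion cdist_embed /= /per_dist fE; congr dens; apply: funext => i.
rewrite /per_neq /=; case: (bteval _ _); first exact/asboolP.
by apply/asboolPn; apply.
Qed.

Lemma bteval_event (v : forall s, nat -> rbase s) phi :
  bteval v (event R phi) = `[< fo_holds (v sK) phi >].
Proof.
apply: asbool_equiv_eq; apply: fo_holds_local => j jp /=.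
have jlt : (index j (fo_fv phi) < size (fo_fv phi))%N by rewrite index_mem.
by rewrite /rassign insubT /= nth_index.
Qed.

Lemma bteval_join v U V : bteval v (@Bjoin R L U V) = bteval v U || bteval v V.
Proof. by []. Qed.

Lemma bteval_meet v U V : bteval v (@Bmeet R L U V) = bteval v U && bteval v V.
Proof. by []. Qed.

Lemma bteval_neg v U : bteval v (@Bneg R L U) = ~~ bteval v U.
Proof. by []. Qed.

Lemma value_dB_eq U V : (forall v, bteval v U = bteval v V) ->
  forall r, cl_value r (@dB R L U V) = 0.
Proof.
move=> H; apply: vlip_eq0; first exact: vlip_dist.
by move=> v; rewrite value_dist_embed; apply: dens0 => i; apply/asboolPn; apply.
Qed.

End RandomizedStructure.

Lemma periodic2 (X Y : Type) p q (f : nat -> X) (g : nat -> Y) : periodic p f -> periodic q g ->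
  exists r, periodic r f /\ periodic r g.
Proof.
move=> pf qg; have [p0 _] := pf; have [q0 _] := qg; exists (p * q)%N.
have pq : (0 < p * q)%N by rewrite muln_gt0 p0.
by split; [apply: periodic_dvd pf => //; rewrite dvdn_mulr|apply: periodic_dvd qg => //; rewrite dvdn_mull].
Qed.

Section RandomizedModel.
Variables (R : realType) (L : fo_signature) (T : fo_theory L) (M : fo_structure L) (m0 m1 : M).
Hypotheses (TM : fo_model T M) (m01 : m0 <> m1).
Let LR : cl_signature R := rand_signature R L.
Let N : cl_structure LR := randomized R m0.

Lemma bat_update s i (v : forall s, nat -> rper R m0 s) (b : rper R m0 s) k :
  bat (pupdate v i b) k s = [eta bat v k s with i |-> pat b k].
Proof.
by apply: funext => j; rewrite /bat /pupdate dfwith_in /=; case: (j == i).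
Qed.

Lemma bat_update_out s s' i (v : forall s, nat -> rper R m0 s) (b : rper R m0 s) k : s != s' ->
  bat (pupdate v i b) k s' = bat v k s'.
Proof. by move=> ss'; apply: funext => j; rewrite /bat /pupdate dfwith_out. Qed.

Lemma randomized_full (v : forall s, nat -> rper R m0 s) i (phi : fo_formula L) :
  exists b : rper R m0 sK, forall k,
    fo_holds [eta bat v k sK with i |-> pat b k] phi <-> fo_holds (bat v k sK) (FEx i phi).
Proof.
have /choice[W WP] : forall q : nat -> M, exists a, fo_holds q (FEx i phi) -> fo_holds [eta q with i |-> a] phi.
  move=> q; have [[a Ha]|H] := pselect (fo_holds q (FEx i phi)); first by exists a.
  by exists m0.
(* Infinitely many variables need not have a common period. Resetting those not free in [phi] leaves
   the Skolem function [W] finitely many to read, so its values are periodic. *)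
pose q k (j : nat) : M := if j \in fo_fv phi then bat v k sK j else m0.
have [p [p0 pP]] := per_common (fun k : 'I_(size (fo_fv phi)) => v sK (nth 0%N (fo_fv phi) k)).
have bP : exists p, periodic p (fun k => W (q k)).
  exists p; split=> // k; congr W; apply: funext => j; rewrite /q; case: ifP => // jp.
  have jlt : (index j (fo_fv phi) < size (fo_fv phi))%N by rewrite index_mem.
  have [_] := pP (Ordinal jlt); rewrite /= nth_index// /bat; exact.
exists (per_of bP) => k; split=> [H|[a Ha]].
  by eexists; exact: H.
have : fo_holds (q k) (FEx i phi).
  exists a; apply/(fo_holds_local _).1: Ha => j jp /=.
  by rewrite /q jp.
move=> /WP; apply/(fo_holds_local _).1 => j jp /=.
by rewrite {2}/q jp.
Qed.

Lemma randomized_model : cl_model (@randomization R L T) N.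
Proof.
apply/rmodelP => _ [phi h|phi|phi psi|phi psi|||||||||||i j||i phi||||||phi Tphi] r.
(* The ten Boolean axioms hold at each coordinate by truth tables. *)
5-14: by apply: value_dB_eq => v; rewrite !(bteval_join, bteval_meet, bteval_neg) /=;
  move: (v sB 0%N : bool) (v sB 1%N : bool) (v sB 2%N : bool) => [] [] [].
- by apply: value_dB_eq => v; rewrite bteval_event; apply/asboolP/h.
- by apply: value_dB_eq => v; rewrite bteval_neg !bteval_event -asbool_neg.
- by apply: value_dB_eq => v; rewrite bteval_join !bteval_event -asbool_or.
- by apply: value_dB_eq => v; rewrite bteval_meet !bteval_event -asbool_and.
- apply: vlip_eq0; first by apply: vlip_diff; [apply: vlip_dist|apply: vlip_compl; apply: vlip_mu].
  move=> v; rewrite rvalue_diff rvalue_compl value_dist_embed value_mu_embed.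
  have [p pi] := bteval_periodic v (Kvar R L i); have [q qj] := bteval_periodic v (Kvar R L j).
  have [p' [pi' pj']] := periodic2 pi qj.
  have [q' qe] := bteval_periodic v (event R (FEq (FVar i) (FVar j) : fo_formula L)).
  have [P [Pn Pe]] := periodic2 (per_neq_periodic pi' pj') qe.
  have c1 (b : bool) : periodic P (fun=> b) by split=> //; case: Pn.
  (* At each coordinate exactly one of the inequality and the equality holds, just as for the
     constants true and false. *)
  have := dens_add R Pn Pe (c1 true) (c1 false); rewrite (@dens1 R (fun=> true))// (@dens0 R (fun=> false))//.
  rewrite addr0 => e; apply/eqP; rewrite normr_eq0 subr_eq0; apply/eqP; rewrite -e ?addrK//.
  move=> k; rewrite bteval_event /per_neq /= /bat.
  by have [H|H] := pselect (pat (v sK i) k = pat (v sK j) k); [rewrite (asboolF (P := ~ _)) ?asboolT//; exact|rewrite asboolT// asboolF].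
- apply: vlip_eq0; first by apply: vlip_diff; [apply: vlip_dist|apply: vlip_mu].
  move=> v; rewrite rvalue_diff value_dist_embed value_mu_embed; apply/eqP.
  rewrite normr_eq0 subr_eq0; apply/eqP; congr dens; apply: funext => k.
  rewrite /Bsymdiff !(bteval_join, bteval_meet, bteval_neg) /=.
  move: (bat v k sB 0%N : bool) (bat v k sB 1%N : bool) => [] [];
    by [apply/asboolP | apply/asboolPn; apply].
- apply: vlip_inf; first exact: vlip_dist.
  move=> v; have [b bP] := randomized_full v i phi; exists b.
  rewrite value_dist_embed; apply: dens0 => k; apply/asboolPn; apply.
  rewrite !bteval_event bat_update; apply: asbool_equiv_eq; rewrite bP.
  by apply: fo_holds_local => j; rewrite mem_undup /= mem_filter => /andP[/negbTE->].
- apply/cl_value_eq0 => e e0; apply/cl_value_inf_lt.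
  have [v vP] := vlip_approx r (vlip_dist m0 (Bvar R L 0) (event R (FEq (FVar 0) (FVar 1)))) e0.
  (* [a] is [m0] on the event and [m1] off it, to be compared with the constant [m0]. *)
  have aper : exists p, periodic p (fun k => if (pat (v sB 0%N) k : bool) then m0 else m1).
    by have [p [p0 pE]] := svalP (v sB 0%N); exists p; split=> // k; rewrite /pat pE.
  pose a : rper R m0 sK := per_of aper; pose b : rper R m0 sK := per_const m0.
  exists (embed a); apply/cl_value_inf_lt; exists (embed b).
  have := vP (fun r => @cl_update R LR N (@cl_update R LR N r sK 0 (embed a)) sK 1 (embed b)).
  move=> /(_ (fun d r1 r2 d0 h => rclose_update _ _ d0 (rclose_update _ _ d0 h))).
  rewrite !rembed_update [cl_value (rembed _) _](_ : _ = 0).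
    by rewrite subr0; apply: le_lt_trans; apply: ler_norm.
  rewrite value_dist_embed; apply: dens0 => k; apply/asboolPn; apply.
  rewrite bteval_event !bat_update /= !bat_update_out// /bat /=.
  by case: (pat (v sB 0%N) k : bool); [rewrite asboolT|rewrite asboolF// => /esym].
- apply: vlip_eq0; first by apply: vlip_compl; apply: vlip_mu.
  by move=> v; rewrite rvalue_compl value_mu_embed dens1// subrr.
- apply: vlip_eq0; first exact: vlip_mu.
  by move=> v; rewrite value_mu_embed dens0.
- apply: vlip_eq0.
    by apply: vlip_diff; apply: vlip_mean; apply: vlip_mu.
  move=> v; rewrite rvalue_diff !rvalue_mean !value_mu_embed.
  apply/eqP; rewrite normr_eq0 subr_eq0; apply/eqP; congr (_ / 2).
  have [p pU] := bteval_periodic v (Bvar R L 0); have [q qV] := bteval_periodic v (Bvar R L 1).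
  have [P [PU PV]] := periodic2 pU qV.
  apply: (@dens_add R P) => //; try by split=> [|k]; [case: PU|rewrite ?bteval_join ?bteval_meet PU.2 PV.2].
  by move=> k; rewrite bteval_join bteval_meet /=; move: (bat v k sB 0%N : bool) (bat v k sB 1%N : bool) => [] [].
- apply: vlip_inf; first by apply: vlip_diff; [apply: vlip_mu|apply: vlip_half; apply: vlip_mu].
  move=> v; have [p pU] := bteval_periodic v (Bvar R L 0); have [V [pV VE]] := dens_half R pU.
  have Vper : exists p, periodic p V by exists (2 * p)%N.
  pose W : rper R m0 sB := per_of Vper.
  exists W; rewrite rvalue_diff rvalue_half !value_mu_embed.
  have -> : (fun k => bteval m0 (bat (pupdate v 1 W) k) (Bmeet (Bvar R L 0) (Bvar R L 1))) =
      (fun k => (bteval m0 (bat v k) (Bvar R L 0) : bool) && V k).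
    by apply: funext => k; rewrite bteval_meet /= bat_update.
  have -> : (fun k => bteval m0 (bat (pupdate v 1 W) k) (Bvar R L 0)) =
      (fun k => bteval m0 (bat v k) (Bvar R L 0)).
    by apply: funext => k; rewrite /= bat_update.
  by rewrite VE subrr normr0.
- by apply: value_dB_eq => v; rewrite bteval_event; apply/asboolP; apply: TM.
Qed.

Definition rconst (m : M) : rkar N := @embed R (rper R m0 sK) (per_const m).

Lemma rlaws : randomization_laws T N.
Proof. exact/randomization_lawsP/randomized_model. Qed.

Lemma rbr_embed_top (v : forall s, nat -> rper R m0 s) (phi : fo_formula L) :
  (forall k, fo_holds (bat v k sK) phi) -> @rbr R L N (@rembed R L M m0 v sK) phi = rtop N.
Proof.
move=> H; have := value_dist_embed v (event R phi) (Btop R L).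
rewrite dens0 => [|k]; first by rewrite (rvalue_dB (N := N)) !rvalueE => /mdist_positivity.
by apply/asboolPn; apply; rewrite bteval_event; apply/asboolP.
Qed.

Lemma rbr_const (rho : nat -> M) (phi : fo_formula L) : fo_holds rho phi ->
  rbr (rconst \o rho) phi = rtop N.
Proof.
pose v s : nat -> rper R m0 s := match s return nat -> rper R m0 s with
  | sK => fun i => per_const (rho i) | sB => fun=> per_const false end.
by move=> H; apply: (rbr_embed_top (v := v)).
Qed.

Definition rvals (A : Type) (x : A) (c : nat -> A) (i : nat) : A := if i is j.+1 then c j else x.

Definition fo_among k : fo_formula L :=
  fo_disj [seq FEq (FVar 0) (FVar j.+1) | j <- iota 0 k].

(** A periodic function within [e / 2] of [x] takes only the values of one period, and [x] is among
    these wherever the two agree. *)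
Lemma rconst_dense (x : rkar N) (e : R) : 0 < e -> exists k (g : nat -> M),
  1 - e < rmu (rbr (rvals x (rconst \o g)) (fo_among k)).
Proof.
move=> e0; have e2 : 0 < e / 2 by lra.
have [a xa] := @embed_dense R (rper R m0 sK) x _ e2; have [p pa] := svalP a.
exists p, (pat a); set y : rkar N := embed a in xa.
have RL := rlaws.
have ytop : rbr (rvals y (rconst \o pat a)) (fo_among p) = rtop N.
  pose v s : nat -> rper R m0 s := match s return nat -> rper R m0 s with
    | sK => rvals a (fun j => per_const (pat a j)) | sB => fun=> per_const false end.
  have -> : rvals y (rconst \o pat a) = @rembed R L M m0 v sK by apply: funext => -[].
  apply: rbr_embed_top => k.
  apply/(@fo_holds_disj L _ M (bat v k sK) (iota 0 p) (fun j => FEq (FVar 0) (FVar j.+1))).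
  have [p0 _] := pa; exists (k %% p)%N; first by rewrite mem_iota ltn_pmod.
  by rewrite /= /bat /=; apply: periodic_mod pa.
apply: (@lt_le_trans _ _ (rmu (req x y))).
  have := rdistE RL x y; rewrite (rmu_neg RL) => h.
  have : mdist x y <= e / 2 by exact: xa.
  by lra.
apply: (rmu_le RL) => U HU Uxy; apply: (@rbr_cong R L T N RL U (rvals y (rconst \o pat a))) => //.
  by case=> [|j] _ /=; [apply: (req_sym RL HU)|apply: (req_refl RL)].
by rewrite ytop; apply: ultra_top HU.
Qed.

Lemma randomized_separable : countable [set: M] -> cl_separable N.
Proof.
move=> Mc s; exists (range (@embed R (rper R m0 s))).
  have bc : countable [set: rbase M s] by case: s => //=; apply: countableP.
  have pc := per_countable (rbase_inh m0 s) bc.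
  exact: (@card_le_trans _ _ _ [set: per (rbase M s)] _ _ (card_image_le _ _) pc).
move=> O [F OF] Oop.
have /nbhs_ballP[e /= e0 eO] : nbhs F O by apply: open_nbhs_nbhs.
have e2 : 0 < e / 2 by lra.
have [a Fa] := @embed_dense R (rper R m0 s) F _ e2.
exists (embed a); split; last by exists a.
apply: eO; rewrite ballEmdist /=; apply: le_lt_trans Fa _.
by lra.
Qed.

End RandomizedModel.

(** * From the randomization back to the theory *)
Section IsoTransfer.
Variables (R : realType) (L : fo_signature) (T : fo_theory L).
Let LR : cl_signature R := rand_signature R L.
Variables N N' : cl_structure LR.
Hypothesis RL' : randomization_laws T N'.

Record riso (h : rkar N -> rkar N') (hB : rbar N -> rbar N') : Prop := RIso {
  riso_br : forall rho phi, hB (rbr rho phi) = rbr (h \o rho) phi;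
  riso_mu : forall E, rmu (hB E) = rmu E;
  riso_sur : forall y, exists x, h x = y }.

Lemma cl_iso_riso : cl_iso N N' -> exists h hB, riso h hB.
Proof.
move=> [h [hbij _ hf hp]]; exists (h sK), (h sB); split.
- move=> rho phi; rewrite -(rfint_ev (x := fun k => rho (nth 0%N (fo_fv phi) k)) (rho := rho))//.
  by rewrite (hf (REv phi)); apply: rfint_ev.
- move=> E; rewrite -(@rpint_mu R L N (fun=> E)) -(@rpint_mu R L N' (fun=> h sB E)).
  exact: (hp tt (fun=> E)).
- by move=> y; have [g _ gK] := hbij sK; exists (g y).
Qed.

End IsoTransfer.

Section IsoOfRandomizations.
Variables (R : realType) (L : fo_signature) (T : fo_theory L).
Variables (M N : fo_structure L) (m0 m1 : M) (n0 n1 : N).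
Hypotheses (TM : fo_model T M) (TN : fo_model T N) (m01 : m0 <> m1) (n01 : n0 <> n1).
Let HM := rlaws R TM m01.
Let HN := rlaws R TN n01.
Variables (h : rkar (randomized R m0) -> rkar (randomized R n0))
  (hB : rbar (randomized R m0) -> rbar (randomized R n0)).
Hypothesis hP : riso h hB.

Local Notation cM := (@rconst R L M m0).
Local Notation cN := (@rconst R L N n0).

(* Interleaves [h (a i)] and [b i], so that formulas can compare the two tuples. *)
Definition match_asg (a : nat -> M) (b : nat -> N) (i : nat) : rkar (randomized R n0) :=
  if odd i then cN (b i./2) else h (cM (a i./2)).

Definition fo_matched n : fo_formula L :=
  fo_conj [seq FEq (FVar i.*2) (FVar i.*2.+1) | i <- iota 0 n].

Definition match_event n (a : nat -> M) (b : nat -> N) := rbr (match_asg a b) (fo_matched n).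

Lemma match_eventP U n a b : rultra U ->
  U (match_event n a b) <-> forall i, (i < n)%N -> U (req (h (cM (a i))) (cN (b i))).
Proof.
move=> HU; have [P [c [_ cs cP]]] := rquotient HN HU.
rewrite /match_event -cP /fo_matched.
rewrite (@fo_holds_conj L _ P (c \o match_asg a b) (iota 0 n) (fun i => FEq (FVar i.*2) (FVar i.*2.+1))).
have E i : fo_holds (c \o match_asg a b) (FEq (FVar i.*2) (FVar i.*2.+1)) <->
    U (req (h (cM (a i))) (cN (b i))).
  by rewrite cP (rbr_eq HN) /match_asg /= odd_double /= doubleK uphalf_double.
by split=> H i; [move=> ilt; apply/E/H; rewrite mem_iota|rewrite mem_iota => /H/E].
Qed.

Lemma hB_const (rho : nat -> M) (phi : fo_formula L) : fo_holds rho phi ->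
  rbr (h \o (cM \o rho)) phi = rtop (randomized R n0).
Proof.
move=> H; rewrite -(riso_br hP) (rbr_const R m0 H); apply: (rmu_neg_eq0 HN).
by rewrite (rmu_neg HN) (riso_mu hP) (rl_mu1 HM) subrr.
Qed.

(** An ultrafilter containing the match event identifies [h (cM (a i))] with [cN (b i)]. The first
    tuple satisfies with probability 1 whatever [a] does, the second whatever [b] does. *)
Lemma match_elementary n a b (phi : fo_formula L) : 0 < rmu (match_event n a b) ->
  fo_below n phi -> fo_holds a phi <-> fo_holds b phi.
Proof.
move=> E0 phifv; have Eb : match_event n a b <> rbot (randomized R n0).
  by move=> e; rewrite e (rl_mu0 HN) ltxx in E0.
have [U [HU /match_eventP UE]] := rultra_exists HN Eb; have {}UE := UE HU.
have key psi : fo_below n psi -> fo_holds a psi -> fo_holds b psi.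
  move=> sfv Ha; apply: contrapT => nb.
  have : U (rbr (cN \o b) psi).
    apply: (rbr_cong HN HU (rho := h \o (cM \o a))) => [i /sfv/UE//|].
    by rewrite (hB_const Ha); apply: ultra_top HU.
  have : rbr (cN \o b) (FNot psi) = rtop (randomized R n0) by apply: rbr_const.
  rewrite (rl_not HN) => e; apply/(rultra_neg HU); rewrite e; exact: ultra_top HU.
split; first exact: key.
by move=> Hb; apply: contrapT => na; apply: (key (FNot phi) phifv na Hb).
Qed.

(** The measures of the match event and of the event that [x] is among the [g j] sum to more than 1,
    so these events overlap in positive measure; not all of finitely many parts of the overlap can
    be null. *)
Lemma match_pick n a b (x : rkar (randomized R n0)) k (g : nat -> rkar (randomized R n0)) :
  0 < rmu (match_event n a b) ->
  1 - rmu (match_event n a b) < rmu (rbr (rvals x g) (fo_among L k)) ->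
  exists j, 0 < rmu (rmeet (match_event n a b) (req x (g j))).
Proof.
move=> E0 lt; set E := match_event n a b in E0 lt *; set A := rbr _ _ in lt.
have pos : 0 < rmu (rmeet E A).
  have := rmu_split HN E A.
  have : rmu (rmeet E (rneg A)) <= rmu (rneg A) by apply: (rmu_le HN) => U HU /(rultra_meet HU)[].
  by rewrite (rmu_neg HN); lra.
apply: contrapT => /forallNP H.
have bot j : rmeet E (req x (g j)) = rbot (randomized R n0).
  by apply: (rmu_eq0 HN); rewrite leNgt; apply/negP/H.
have : rmeet E A <> rbot (randomized R n0) by move=> e; rewrite e (rl_mu0 HN) ltxx in pos.
move=> /(rultra_exists HN)[U [HU]]; rewrite (rultra_meet HU) => -[UE].
have [P [c [_ _ cP]]] := rquotient HN HU; rewrite /A -cP.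
move=> /(@fo_holds_disj L _ P _ (iota 0 k) (fun j => FEq (FVar 0) (FVar j.+1)))[j _].
rewrite cP (rbr_eq HN) /= => Uj; apply/(rultra_bot HN HU); rewrite -(bot j).
by rewrite (rultra_meet HU).
Qed.

Lemma match_extend n a b x y :
  0 < rmu (rmeet (match_event n a b) (req (h (cM x)) (cN y))) ->
  0 < rmu (match_event n.+1 [eta a with n |-> x] [eta b with n |-> y]).
Proof.
move=> H; apply: lt_le_trans H _; apply: (rmu_le HN) => U HU.
rewrite (rultra_meet HU) => -[/(match_eventP n a b HU) UE Uxy].
apply/(match_eventP _ _ _ HU) => i; rewrite ltnS leq_eqVlt => /orP[/eqP->|ilt].
  by rewrite /= eqxx.
by rewrite /= ltn_eqF//; apply: UE.
Qed.

(** Forth, [h (cM x)] is mostly among finitely many constants of [N]. Back, [cN y] is the image of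
    some [x0] that is mostly among finitely many constants of [M], and [h] transports this because
    measures are preserved. *)
Lemma fo_iso_of_riso : [set: M] #= [set: nat] -> [set: N] #= [set: nat] -> fo_iso M N.
Proof.
move=> Mnat Nnat.
have ctM : countable [set: M] by rewrite (eq_countable Mnat).
have ctN : countable [set: N] by rewrite (eq_countable Nnat).
have [eM eMP] := countable_surj (inhabits m0) ctM.
have [eN eNP] := countable_surj (inhabits n0) ctN.
have [||n a b x E0|n a b y E0|a [b [Pab aE bE]]] :=
    @back_and_forth M N eM eN (fun n a b => 0 < rmu (match_event n a b)).
- move=> n a b a' b' e; rewrite (_ : match_event n a b = match_event n a' b')//.
  by apply: (rext HN) => U HU; rewrite !match_eventP//; split=> H i ilt; have [e1 e2] := e i ilt;
    have := H i ilt; rewrite e1 e2.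
- rewrite (_ : match_event _ _ _ = rtop _) ?(rl_mu1 HN)//.
  by apply: (rext HN) => U HU; rewrite match_eventP// (rultra_top HU).
- have [k [g lt]] := rconst_dense TN n01 (h (cM x)) E0.
  have [j Hj] := match_pick E0 lt.
  by exists (g j); apply: match_extend.
- have [x0 hx0] := riso_sur hP (cN y).
  have [k [g]] := rconst_dense TM m01 x0 E0.
  rewrite -(riso_mu hP) (riso_br hP) (_ : h \o _ = rvals (cN y) (h \o (cM \o g))); last first.
    by apply: funext => -[].
  move=> /(match_pick E0)[j Hj]; exists (g j); apply: match_extend.
  rewrite (_ : req (h (cM (g j))) (cN y) = req (cN y) (h (cM (g j))))//.
  by apply: (rext HN) => U HU; split; apply: (req_sym HN HU).
apply: (@fo_iso_of_sequences L M N a b).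
- by move=> x; have [m <-] := eMP x; have [n nm] := aE m; exists n.
- by move=> y; have [m <-] := eNP y; have [n nm] := bE m; exists n.
- move=> phi; apply: (match_elementary (Pab (fo_bound phi))) => i; exact: fo_boundP.
Qed.

End IsoOfRandomizations.

(** * Transfer of omega-categoricity in both directions *)

Lemma cl_iso_sym (R : realType) (L : cl_signature R) (M N : cl_structure L) : cl_iso M N -> cl_iso N M.
Proof.
move=> [h [hbij hd hf hp]].
have gP s : exists g : N s -> M s, cancel (h s) g /\ cancel g (h s).
  by have [g h1 h2] := hbij s; exists g.
pose g s := projT1 (cid (gP s)).
have hK s : cancel (h s) (g s) by rewrite /g; case: cid => ? [].
have gK s : cancel (g s) (h s) by rewrite /g; case: cid => ? [].
exists g; split.
- by move=> s; exists (h s).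
- by move=> s x y; rewrite -hd !gK.
- move=> f x; rewrite -[RHS]hK hf; congr (g _ (cl_fint _)).
  by apply: functional_extensionality_dep => k; rewrite gK.
- move=> p x; rewrite -hp; congr cl_pint.
  by apply: functional_extensionality_dep => k; rewrite gK.
Qed.

Lemma cl_iso_trans (R : realType) (L : cl_signature R) (M N P : cl_structure L) :
  cl_iso M N -> cl_iso N P -> cl_iso M P.
Proof.
move=> [h [hbij hd hf hp]] [g [gbij gd gf gp]]; exists (fun s => g s \o h s); split.
- by move=> s; apply: bij_comp.
- by move=> s x y /=; rewrite gd hd.
- by move=> f x /=; rewrite hf gf.
- by move=> p x /=; rewrite gp hp.
Qed.

(** The randomization of a countable model of T is the separable model with which the others are
    compared. *)
Lemma randomization_omega_categorical (R : realType) (L : fo_signature) (T : fo_theory L) :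
  fo_countable L -> (forall M : fo_structure L, fo_model T M -> exists x y : M, x <> y) ->
  fo_omega_categorical T -> cl_omega_categorical (@randomization R L T).
Proof.
move=> Lc nt oc; have [Tc Tcat] := oc; have RN n := ryll_nardzewski n Lc oc.
have [M [TM Mc]] : exists M, fo_model T M /\ countable [set: M].
  case: Tcat => [[M TM /finite_set_countable Mc]|[M [TM Mnat] _]]; first by exists M.
  by exists M; rewrite (eq_countable Mnat).
have [m0 [m1 m01]] := nt M TM; have laws := rlaws R TM m01.
have sep : cl_separable (randomized R m0) by apply: randomized_separable.
have TR : cl_model (@randomization R L T) (randomized R m0) by apply: randomized_model m01.
split; first by apply: randomization_complete => //; exists (randomized R m0).
exists (randomized R m0); first by split.
by move=> N /randomization_lawsP RL sepN; exact: (randomization_unique Tc nt RN laws RL sep sepN).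
Qed.

Lemma omega_categorical_of_randomization (R : realType) (L : fo_signature) (T : fo_theory L) :
  fo_countable L -> (forall M : fo_structure L, fo_model T M -> exists x y : M, x <> y) ->
  cl_omega_categorical (@randomization R L T) -> fo_omega_categorical T.
Proof.
move=> Lc nt [[[N0 /randomization_lawsP RL0] Rdec] [N [TN sepN] uniq]].
have [M0 TM0] : exists M0, fo_model T M0.
  have tb : rtop N0 <> rbot N0.
    by move=> e; have := rl_mu1 RL0; rewrite e (rl_mu0 RL0) => /esym/eqP; rewrite oner_eq0.
  have [U [HU _]] := rultra_exists RL0 tb; have [M [c [TM _ _]]] := rquotient RL0 HU.
  by exists M.
have Tc : fo_complete T.
  split; first by exists M0.
  move=> phi; apply: contrapT => /not_orP[/existsNP[M /not_implyP[TM Mphi]] /existsNP[P /not_implyP[TP Pphi]]].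
  have sentE (S : fo_structure L) (q q' : nat -> S) : fo_holds q (sval phi) <-> fo_holds q' (sval phi).
    by apply: fo_holds_local => i; rewrite (eqP (svalP phi)).
  have [m0 [m1 m01]] := nt M TM; have [p0 [p1 p01]] := nt P TP.
  (* The measure of the event of a sentence is the value of a continuous sentence, so T^R fixes it;
     in the randomization of a model it is 1 or 0 according to the truth of the sentence there. *)
  have muP : cl_fv (mu (event R (sval phi))) == [::].
    case E : (cl_fv _) => [//|w l]; have : w \in cl_fv (mu (event R (sval phi))) by rewrite E inE eqxx.
    move=> /flatten_mapP[_ _ /flatten_mapP[[k kn] _ _]].
    by exfalso; move: (kn); rewrite /= (eqP (svalP phi)).
  have [v vE] := Rdec (exist (fun chi => cl_fv chi == [::]) _ muP).
  have valE (S : fo_structure L) (s0 s1 : S) (TS : fo_model T S) (s01 : s0 <> s1) (rho : nat -> rkar (randomized R s0)) :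
      rmu (rbr rho (sval phi)) = v.
    have := vE _ (@randomized_model R _ _ _ _ _ TS s01) (rasg rho (fun=> rtop _)).
    by rewrite [sval _]/(mu _) rvalue_mu rteval_event.
  have M0E : fo_holds (fun=> m0) (FNot (sval phi)).
    by move: Mphi => /existsNP[q Hq]; rewrite /= (sentE M _ q).
  have P0E : fo_holds (fun=> p0) (sval phi).
    by move: Pphi => /existsNP[q /contrapT Hq]; apply/(sentE P _ q).
  have vM := valE M m0 m1 TM m01 (@rconst R L M m0 \o (fun=> m0)).
  have vP := valE P p0 p1 TP p01 (@rconst R L P p0 \o (fun=> p0)).
  have LM := rlaws R TM m01; have LP := rlaws R TP p01.
  have := rbr_const R m0 M0E; rewrite (rl_not LM) => /(congr1 (@rmu R L _)).
  rewrite (rmu_neg LM) (rl_mu1 LM) vM -vP (rbr_const R p0 P0E) (rl_mu1 LP) subrr => /esym/eqP.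
  by rewrite oner_eq0.
(* A finite model settles the claim. Without one, the countable model extracted from any model is
   infinite. *)
have [[F [TF Ffin]]|nofin] := pselect (exists F, fo_model T F /\ finite_set [set: F]).
  by split=> //; left; exists F.
have LS (P : fo_structure L) : fo_model T P -> exists A, fo_model T A /\ [set: A] #= [set: nat].
  move=> TP; have [x0] := fo_inh P.
  have [A [K [g [c [cs _ cg]]]]] := lowenheim_skolem (fun=> x0) Lc.
  have TA : fo_model T A.
    move=> phi Tphi r; have [r' ->] := surj_lift r cs.
    by apply/cg; apply: TP.
  exists A; split=> //; apply: eq_card_nat; first exact: surj_countable cs.
  by move=> Afin; apply: nofin; exists A.
have [A [TA Anat]] := LS M0 TM0.
split=> //; right; exists A => // B TB Bnat.
have [a0 [a1 a01]] := nt A TA; have [b0 [b1 b01]] := nt B TB.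
have ctA : countable [set: A] by rewrite (eq_countable Anat).
have ctB : countable [set: B] by rewrite (eq_countable Bnat).
have sA : cl_separable (randomized R a0) by apply: randomized_separable.
have iA := uniq _ (@randomized_model R _ _ _ _ _ TA a01) sA.
have sB : cl_separable (randomized R b0) by apply: randomized_separable.
have iB := uniq _ (@randomized_model R _ _ _ _ _ TB b01) sB.
have [h [hB hP]] := cl_iso_riso (cl_iso_trans (cl_iso_sym iA) iB).
exact: fo_iso_of_riso TA TB a01 b01 _ _ hP Anat Bnat.
Qed.

Theorem theorem3p2 (R : realType) (L : fo_signature) (T : fo_theory L)
    (L_countable : fo_countable L)
    (T_nontrivial : forall M : fo_structure L,
      fo_model T M -> exists x y : M, x <> y) :
  fo_omega_categorical T <-> cl_omega_categorical (@randomization R L T).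
Proof.
split; first exact: randomization_omega_categorical.
exact: omega_categorical_of_randomization.
Qed.
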